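(* Let $p$ be a prime number, let $P(X)\in\mathbf{F}_p[X]$ be a non-zero polynomial and let $\chi:\mathbf{F}_p^\times\to\mathbf{C}^\times$ be a multiplicative character. Assume that either $\chi$ is non-trivial or that $\deg P\geq3$. Let $\varphi(x)=\chi(x)e_p(P(x))$ and $$\widehat\varphi(n)=\frac{1}{\sqrt p}\sum_{x \bmod p}\chi(x)e_p(P(x)+nx).$$ There exists $\delta>0$, depending only on $\deg P$, such that for any interval $I\subset\mathbf{R}$ with $p^{1/2-\delta}\le |I|\le p$ we have $$\Bigl|\sum_{n\in I}\widehat\varphi(n)\Bigr|\ll|I|^{1-\delta},$$ where the implied constant depends only on $\deg P$.
   Context: $e_p(t)=\exp(2\pi i t/p)$. A non-trivial character $\chi$ is extended to $\mathbf{F}_p$ by $\chi(0)=0$; when $\chi$ is trivial one takes $\chi(x)=1$ for all $x\in\mathbf{F}_p$, i.e. $\varphi(x)=e_p(P(x))$. For an interval $I\subset\mathbf{R}$, $|I|$ denotes its length, and $\sum_{n\in I}$ is a sum over integers $n\in I$. $A\ll B$ means $|A|\le CB$ for a constant $C$ (the implied constant). *)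

(* Defs.v *)
From HB Require Import structures.
From mathcomp Require Import all_boot all_order all_algebra all_fingroup.
From mathcomp Require Import all_classical all_reals all_analysis.
From mathcomp Require Import complex.
From mathcomp Require Import zify.

Set Implicit Arguments.
Unset Strict Implicit.
Unset Printing Implicit Defensive.

Import Order.TTheory GRing.Theory Num.Theory.

Local Open Scope ring_scope.
Local Open Scope complex_scope.

(* e_p(t) = exp(2 i pi t / p), with t in F_p represented in {0, ..., p - 1}. *)
Definition e_p (R : realType) (p : nat) (t : 'F_p) : R[i] :=
  let theta := 2 * pi * (t : nat)%:R / p%:R in cos theta +i* sin theta.

(* The group C^* is not available as a type; since chi 1 = 1, the values of a
   character are automatically nonzero. *)
Definition mul_character (R : realType) (p : nat)
    (chi : {unit 'F_p} -> R[i]) : Prop :=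
  chi 1%g = 1 /\ {morph chi : u v / (u * v)%g >-> u * v}.

Definition trivial_char (R : realType) (p : nat)
    (chi : {unit 'F_p} -> R[i]) : bool :=
  [forall u, chi u == 1].

(* Extension to F_p: by 0 at 0 when chi is nontrivial, but by 1 at 0 (so the
   constant 1) when chi is trivial. *)
Definition char_ext (R : realType) (p : nat)
    (chi : {unit 'F_p} -> R[i]) (x : 'F_p) : R[i] :=
  if trivial_char chi then 1
  else if insub x is Some u then chi u else 0.

(* Normalized Fourier transform of x |-> chi(x) e_p(P(x)). *)
Definition phi_hat (R : realType) (p : nat) (chi : {unit 'F_p} -> R[i])
    (P : {poly 'F_p}) (n : int) : R[i] :=
  ((Num.sqrt (p%:R : R))^-1)%:C *
  \sum_(x : 'F_p) char_ext chi x * e_p R (P.[x] + n%:~R * x).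

Definition int_points (R : realType) (I : interval R) : set int :=
  [set n : int | (n%:~R : R) \in I].

(* The sums \sum_(n \in A) are by convention 0 on a set with infinite support;
   this does not occur for the integers of a bounded interval. *)
Lemma finite_int_points (R : realType) (a b : R) (l r : bool) :
  finite_set (int_points (Interval (BSide l a) (BSide r b))).
Proof.
pose N := (`|Num.floor a| + `|Num.ceil b|)%N.
apply: (@sub_finite_set _ _
  ((fun k : nat => k%:Z - N%:Z) @` `I_(N + N).+1)%classic); last first.
  exact/finite_image/finite_II.
move=> n; rewrite /int_points /= itv_boundlr => /andP[la rb].
have an : (Num.floor a <= n)%R.
  have h : a <= n%:~R by case: l la => //= /ltW.
  by rewrite -(ler_int R); apply: le_trans h; exact: floor_le.
have nb : (n <= Num.ceil b)%R.
  have h : n%:~R <= b by case: r rb => //= /ltW.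
  by rewrite -(ler_int R); apply: (le_trans h); exact: ceil_ge.
by exists (absz (n + N%:Z)); rewrite /N /=; lia.
Qed.

(* Main.v *)
Require Import Defs.
From HB Require Import structures.
From mathcomp Require Import all_boot all_order all_algebra all_fingroup.
From mathcomp Require Import all_classical all_reals all_analysis.
From mathcomp Require Import complex zify ring lra.

Set Implicit Arguments.
Unset Strict Implicit.
Unset Printing Implicit Defensive.

Import Order.TTheory GRing.Theory Num.Theory.
Import numFieldNormedType.Exports.

Local Open Scope ring_scope.
Local Open Scope complex_scope.

(** Write [e] for [e_p] and [phi] for the function
    [chi(x) e(P(x))]. The sum of the Fourier transform over an interval with
    [H] integers is [p^(-1/2) sum_x phi(x) K(x)], where the kernel [K] is a
    geometric sum, of size [min(H, p / |x|)]. If [H] exceeds [p^(1/2)] by a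
    power of [p], the bound [sum_x |K(x)| << p log p] suffices. If [H] is
    close to [p^(1/2)], the range [|x| <= p^(1/2 - c)] is negligible, and on
    the rest partial summation reduces the claim to a power saving in short
    sums of [phi(x) e(n x)] over intervals of length about [p^(1/2)]
    ([completion_bound], [mixed_short_sum]).

    If [chi] is trivial then [P] has degree at least 3, and repeated squaring
    (Weyl) reduces to cubic phases. After two more squarings these become
    geometric sums with slopes proportional to [h k], with [h] and [k] below
    [p^(1/2)]; the products [h k] are nearly distinct, so that most slopes are
    far from 0 ([cubic_short_sum], [weyl_short_sum]).

    If [chi] is nontrivial, Burgess' method applies ([burgess_short_sum]): the
    shift [n -> n + a t] and [chi(n + a t) = chi(a) chi(n / a + t)] reduce to
    the sums of [chi(x + t) e(Q(t))] over very short ranges of [t], for almost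
    all [x] and all polynomials [Q] of bounded degree. Rounding the coefficients
    of [Q] leaves few phases, and for each of them a high moment over [x] is
    expanded into complete sums of a product of values of [chi] and its
    conjugate at shifted points. Since the order of the moment is free, any
    power saving in the complete sums is enough, and the Riemann hypothesis for
    curves can be replaced by the following argument.

    A complete sum with an isolated shift is bounded by a Gowers norm of [chi]
    ([complete_sum_bound]), because the substitution [z = y / x] exhibits it as
    an average of [w(y) prod_i G_i(x + c_i y)] with [w = chi], and repeated use
    of Cauchy-Schwarz removes the [G_i] ([weighted_von_neumann]). The Gowers
    norms of [chi] are small by induction on the order ([gowers_chi_step]).
    Let [D(h_1, ..., h_k)] be the mean over [x] of the iterated multiplicative
    derivative of [chi]. It is positive definite in [h_1], and, [chi] being
    multiplicative, [D(h_1 / t, h_2, ...) = D(h_1, t h_2, ...)] for [t != 0].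
    In the mean square of [D], one factor is thus a combination of the phases
    [e(xi h_1 / t)] and the other an average of products of functions of
    [x + c_i t]; their correlation is at most a Gowers norm of
    [t -> e(theta / t)]. The dilations of F_p permute these phases, so that this
    norm is an average over [theta], and it counts the zeros of a rational
    function ([gowers_inverse_phase]). Only the frequency 0 remains, and its
    contribution is the Gowers norm of the previous order. *)

(** * Absolute values and averages *)

Section AbsoluteValue.
Variable R : rcfType.
Implicit Types (z w : R[i]).

(** The norm of R[i] has its values in R[i], where not all elements are
    comparable; estimates are stated in R. *)
Definition abs z : R := complex.Re `|z|.

Lemma absE z : `|z| = (abs z)%:C.
Proof. by rewrite /abs RRe_real // normr_real. Qed.

Lemma abs_ge0 z : 0 <= abs z.
Proof. by rewrite -lecR -absE normr_ge0. Qed.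

Lemma absM z w : abs (z * w) = abs z * abs w.
Proof. by apply: complexI; rewrite rmorphM /= -!absE normrM. Qed.

Lemma absD z w : abs (z + w) <= abs z + abs w.
Proof. by rewrite -lecR rmorphD /= -!absE ler_normD. Qed.

Lemma absN z : abs (- z) = abs z.
Proof. by rewrite /abs normrN. Qed.

Lemma absB z w : abs (z - w) <= abs z + abs w.
Proof. by rewrite -(absN w) absD. Qed.

Lemma absBC z w : abs (z - w) = abs (w - z).
Proof. by rewrite -absN opprB. Qed.

Lemma absJ z : abs z^*%C = abs z.
Proof. by rewrite /abs normcJ. Qed.

Lemma abs0 : abs 0 = 0.
Proof. by rewrite /abs normr0. Qed.

Lemma abs1 : abs 1 = 1.
Proof. by rewrite /abs normr1. Qed.

Lemma absX z n : abs (z ^+ n) = abs z ^+ n.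
Proof. by elim: n => [|n IH]; rewrite ?expr0 ?abs1 // !exprS absM IH. Qed.

Lemma absV z : abs z^-1 = (abs z)^-1.
Proof. by apply: complexI; rewrite fmorphV /= -!absE normfV. Qed.

Lemma abs_real (x : R) : 0 <= x -> abs x%:C = x.
Proof. by move=> x0; rewrite /abs ger0_norm ?ler0c. Qed.

Lemma abs_nat n : abs n%:R = n%:R.
Proof. by rewrite /abs normr_nat /= -[n%:R in LHS](rmorph_nat (real_complex R)). Qed.

Lemma abs_eq0 z : (abs z == 0) = (z == 0).
Proof.
rewrite -[z == 0]normr_eq0 absE.
by apply/eqP/eqP => [->//|]; move/complexI.
Qed.

Lemma mulcJ_abs z : z * z^*%C = (abs z ^+ 2)%:C.
Proof. by rewrite -sqr_normc absE rmorphXn. Qed.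

Lemma abs_sum (I : Type) (r : seq I) (Q : pred I) (f : I -> R[i]) :
  abs (\sum_(i <- r | Q i) f i) <= \sum_(i <- r | Q i) abs (f i).
Proof.
elim/big_rec2: _ => [|i x y _ h]; first by rewrite abs0.
by apply: le_trans (absD _ _) _; rewrite lerD2l.
Qed.

Lemma abs_le1M z w : abs z <= 1 -> abs w <= 1 -> abs (z * w) <= 1.
Proof. by move=> hz hw; rewrite absM mulr_ile1 ?abs_ge0. Qed.

Lemma abs_prod_le1 (I : Type) (r : seq I) (Q : pred I) (f : I -> R[i]) :
  (forall i, abs (f i) <= 1) -> abs (\prod_(i <- r | Q i) f i) <= 1.
Proof.
move=> h; elim/big_rec: _ => [|i x _ hx]; first by rewrite abs1.
exact: abs_le1M.
Qed.

End AbsoluteValue.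

Section Average.
Variable F : finFieldType.

Definition avg (K : fieldType) (f : F -> K) : K :=
  #|F|%:R^-1 * \sum_x f x.

Section AnyField.
Variable K : fieldType.
Implicit Types f g : F -> K.

Lemma eq_avg f g : f =1 g -> avg f = avg g.
Proof. by move=> e; rewrite /avg (eq_bigr g). Qed.

Lemma avg_reindex (h : F -> F) f : bijective h -> avg (f \o h) = avg f.
Proof.
move=> hh; rewrite /avg; congr (_ * _).
by rewrite [in RHS](reindex h) //; apply: onW_bij.
Qed.

Lemma avg_shift a f : avg (fun x => f (x + a)) = avg f.
Proof.
apply: (@avg_reindex (fun x => x + a)).
by exists (fun x => x - a) => x; rewrite ?addrK ?subrK.
Qed.

Lemma avg_dilate a f : a != 0 -> avg (fun x => f (a * x)) = avg f.
Proof.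
move=> a0; apply: (@avg_reindex (fun x => a * x)).
by exists (fun x => a^-1 * x) => x; rewrite ?mulKf ?mulVKf.
Qed.

Lemma avg_exchange (f : F -> F -> K) :
  avg (fun x => avg (f x)) = avg (fun y => avg (f^~ y)).
Proof.
rewrite /avg -!mulr_sumr; congr (_ * (_ * _)); exact: exchange_big.
Qed.

Lemma avgZ c f : avg (fun x => c * f x) = c * avg f.
Proof. by rewrite /avg -mulr_sumr mulrCA. Qed.

Lemma avgZr c f : avg (fun x => f x * c) = avg f * c.
Proof. by rewrite /avg -mulr_suml mulrA. Qed.

Lemma avgD f g : avg (fun x => f x + g x) = avg f + avg g.
Proof. by rewrite /avg big_split mulrDr. Qed.

Lemma avg_sum (I : Type) (r : seq I) (f : I -> F -> K) :
  avg (fun x => \sum_(i <- r) f i x) = \sum_(i <- r) avg (f i).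
Proof. by rewrite /avg exchange_big /= mulr_sumr. Qed.

End AnyField.

Lemma card_field_gt0 (K : numFieldType) : 0 < #|F|%:R :> K.
Proof. by rewrite ltr0n; apply/card_gt0P; exists 0. Qed.

Lemma avg_const (K : numFieldType) (c : K) : avg (fun=> c) = c.
Proof.
rewrite /avg sumr_const -[c in LHS]mulr1 -mulrnAr mulrCA mulVf ?mulr1 //.
exact: lt0r_neq0 (card_field_gt0 K).
Qed.

Lemma avg_mono (K : numFieldType) (f g : F -> K) :
  (forall x, f x <= g x) -> avg f <= avg g.
Proof.
move=> h; apply: ler_wpM2l; first by rewrite invr_ge0 ler0n.
by apply: ler_sum => x _.
Qed.

Lemma avg_ge0 (K : numFieldType) (f : F -> K) :
  (forall x, 0 <= f x) -> 0 <= avg f.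
Proof. by move=> h; rewrite -(avg_const 0) avg_mono. Qed.

Lemma avg_le_const (K : numFieldType) (f : F -> K) c :
  (forall x, f x <= c) -> avg f <= c.
Proof. by move=> h; rewrite -[leRHS]avg_const avg_mono. Qed.

Lemma avg_indicator (K : numFieldType) (A : pred F) (s : seq F) n :
  (forall x, A x -> x \in s) -> (size s <= n)%N ->
  avg (fun x => (A x)%:R : K) <= n%:R / #|F|%:R.
Proof.
move=> As sn; rewrite /avg mulrC ler_wpM2r ?invr_ge0 ?ler0n //.
rewrite -natr_sum ler_nat.
rewrite (eq_bigr (fun x => if A x then 1 else 0)%N) => [|x _]; last by case: (A x).
rewrite -big_mkcond sum1dep_card.
apply: leq_trans (leq_trans (card_size s) sn); apply: subset_leq_card.
by apply/fintype.subsetP => x; rewrite inE => /As.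
Qed.

Lemma avg_jensen (K : realFieldType) (f : F -> K) k :
  (forall x, 0 <= f x) -> avg f ^+ (2 ^ k) <= avg (fun x => f x ^+ (2 ^ k)).
Proof.
have sq (g : F -> K) : avg g ^+ 2 <= avg (fun x => g x ^+ 2).
  have : 0 <= avg (fun x => (g x - avg g) ^+ 2).
    by apply: avg_ge0 => x; rewrite sqr_ge0.
  rewrite (@eq_avg _ _ (fun x => g x ^+ 2 + (- (2 * avg g) * g x + avg g ^+ 2))).
    by rewrite avgD avgD avgZ avg_const; nra.
  by move=> x; ring.
elim: k f => [|k IH] f f0; first by rewrite expr1 lexx.
rewrite expnS exprM.
have : avg f ^+ 2 <= avg (fun x => f x ^+ 2) by [].
move/(lerXn2r (2 ^ k)%N); rewrite !nnegrE sqr_ge0 => /(_ isT).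
have h : 0 <= avg (fun x => f x ^+ 2) by apply: avg_ge0 => x; rewrite sqr_ge0.
move=> /(_ h) /le_trans; apply.
apply: (le_trans (IH (fun x => f x ^+ 2) _)); first by move=> x; rewrite sqr_ge0.
by apply: avg_mono => x; rewrite -exprM.
Qed.

Section Complex.
Variable R : rcfType.
Implicit Types f g : F -> R[i].

Lemma abs_avg f : abs (avg f) <= avg (fun x => abs (f x)).
Proof.
rewrite /avg absM absV abs_nat ler_wpM2l ?invr_ge0 ?ler0n //.
exact: abs_sum.
Qed.

Lemma abs_avg_le1 f : (forall x, abs (f x) <= 1) -> abs (avg f) <= 1.
Proof. by move=> h; apply: le_trans (abs_avg _) _; apply: avg_le_const. Qed.

Lemma conj_avg f : (avg f)^*%C = avg (fun x => (f x)^*%C).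
Proof. by rewrite /avg rmorphM /= fmorphV /= rmorph_nat rmorph_sum. Qed.

Lemma avg_real (f : F -> R) : (avg f)%:C = avg (fun x => (f x)%:C).
Proof. by rewrite /avg rmorphM /= fmorphV /= rmorph_nat rmorph_sum. Qed.

Lemma cauchy_schwarz_avg f g :
  (forall x, abs (f x) <= 1) ->
  abs (avg (fun x => f x * g x)) ^+ 2 <= avg (fun x => abs (g x) ^+ 2).
Proof.
move=> f1.
apply: le_trans (avg_jensen 1 (fun x => abs_ge0 (g x))).
rewrite lerXn2r ?nnegrE ?abs_ge0 ?avg_ge0 // => [x|]; first exact: abs_ge0.
apply: le_trans (abs_avg _) _; apply: avg_mono => x.
by rewrite absM ler_piMl ?abs_ge0.
Qed.

(** The exceptional argument 0 is where a substitution by [t^-1] is not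
    invertible. *)
Lemma avg_almost_const f c :
  (forall x, x != 0 -> f x = c) -> (forall x, abs (f x) <= 1) -> abs c <= 1 ->
  abs c <= abs (avg f) + 2 / #|F|%:R.
Proof.
move=> fc f1 c1; have e : c = avg f + avg (fun x => c - f x).
  by rewrite -avgD (eq_avg (g := fun=> c)) ?avg_const // => x; rewrite addrC subrK.
rewrite {1}e; apply: le_trans (absD _ _) _; rewrite lerD2l.
apply: le_trans (abs_avg _) _.
apply: (@le_trans _ _ (avg (fun x : F => 2 * (x == 0)%:R))).
  apply: avg_mono => x; have [->|x0] := eqVneq x 0; last first.
    by rewrite fc // subrr abs0 mulr0.
  apply: le_trans (absB _ _) _; rewrite mulr1; have := f1 0; lra.
rewrite avgZ ler_pM2l // -[_^-1]mul1r.
apply: (@avg_indicator R (fun h => h == 0) [:: 0] 1) => // x.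
by rewrite inE.
Qed.

End Complex.

End Average.

(** * Gowers norms and weighted von Neumann inequalities *)

Section Gowers.
Variables (R : rcfType) (F : finFieldType).
Local Notation C := (R[i]).
Implicit Types (w f g : F -> C) (hs : seq F).

Definition Delta (h : F) w : F -> C := fun x => w (x + h) * (w x)^*%C.

(** The power [2 ^ k.+1] of the Gowers norm of order [k.+1]. *)
Fixpoint gowers k w : R :=
  if k is k'.+1 then avg (fun h => gowers k' (Delta h w)) else abs (avg w) ^+ 2.

Lemma eq_Delta h w w' : w =1 w' -> Delta h w =1 Delta h w'.
Proof. by move=> e x; rewrite /Delta !e. Qed.

Lemma eq_gowers k w w' : w =1 w' -> gowers k w = gowers k w'.
Proof.
elim: k w w' => [|k IH] w w' e /=; first by rewrite (eq_avg e).
by apply: eq_avg => h; apply: IH; apply: eq_Delta.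
Qed.

Lemma gowers_ge0 k w : 0 <= gowers k w.
Proof.
elim: k w => [|k IH] w /=; first by rewrite exprn_ge0 ?abs_ge0.
by apply: avg_ge0 => h; exact: IH.
Qed.

Lemma Delta_le1 h w : (forall x, abs (w x) <= 1) -> forall x, abs (Delta h w x) <= 1.
Proof. by move=> w1 x; rewrite /Delta; apply: abs_le1M; rewrite ?absJ; apply: w1. Qed.

Lemma gowers_conj k w : gowers k (fun x => (w x)^*%C) = gowers k w.
Proof.
elim: k w => [|k IH] w /=; first by rewrite -conj_avg absJ.
by apply: eq_avg => h; rewrite -[RHS]IH; apply: eq_gowers => x; rewrite /Delta rmorphM.
Qed.

Lemma avg_DeltaE w : (abs (avg w) ^+ 2)%:C = avg (fun h => avg (Delta h w)).
Proof.
rewrite -mulcJ_abs avg_exchange conj_avg -avgZ; apply: eq_avg => x.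
rewrite /Delta -(avg_shift x w) -avgZr; apply: eq_avg => y.
by rewrite addrC.
Qed.

(** Each application of Cauchy-Schwarz in [x] removes one factor and replaces
    [w] by a multiplicative derivative; the last factor splits off by a
    translation. *)
Lemma weighted_von_neumann n w (c : nat -> F) (G : nat -> F -> C) :
  (forall i x, abs (G i x) <= 1) ->
  abs (avg (fun x => avg (fun y => w y * \prod_(i < n.+1) G i (x + c i * y))))
    ^+ (2 ^ n.+1) <= gowers n w.
Proof.
elim: n w c G => [|n IH] w c G G1.
  rewrite avg_exchange.
  rewrite (@eq_avg _ _ _ (fun y => w y * avg (G 0%N))) => [|y]; last first.
    rewrite -(avg_shift (c 0%N * y) (G 0%N)) -avgZ.
    by apply: eq_avg => x; rewrite big_ord1.
  rewrite avgZr absM expn1 lerXn2r ?nnegrE ?mulr_ge0 ?abs_ge0 //.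
  by rewrite ler_piMr ?abs_ge0 // abs_avg_le1.
pose c' i := c i.+1 - c 0%N.
pose v x y := w y * \prod_(i < n.+1) G i.+1 (x + c' i * y).
have -> : avg (fun x => avg (fun y => w y * \prod_(i < n.+2) G i (x + c i * y)))
    = avg (fun x => G 0%N x * avg (v x)).
  rewrite avg_exchange.
  under [RHS]eq_avg do rewrite -avgZ.
  rewrite [RHS]avg_exchange; apply: eq_avg => y.
  rewrite -(avg_shift (- (c 0%N * y))); apply: eq_avg => x.
  rewrite big_ord_recl /= subrK /v mulrCA; congr (_ * (_ * _)).
  apply: eq_bigr => i _; congr (G _ _).
  by rewrite /bump /= add1n /c' mulrBl -addrA [- _ + _]addrC.
pose G' h i t := Delta (c' i * h) (G i.+1) t.
pose inner h :=
  avg (fun x => avg (fun y => Delta h w y * \prod_(i < n.+1) G' h i (x + c' i * y))).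
have CS : abs (avg (fun x => G 0%N x * avg (v x))) ^+ 2 <= abs (avg inner).
  have := cauchy_schwarz_avg (fun x => avg (v x)) (G1 0%N).
  move=> /le_trans; apply.
  set A := avg _.
  have A0 : 0 <= A by apply: avg_ge0 => x; rewrite exprn_ge0 ?abs_ge0.
  rewrite -(abs_real A0) /A avg_real le_eqVlt; apply/orP; left; apply/eqP.
  congr abs.
  under eq_avg do rewrite avg_DeltaE.
  rewrite avg_exchange; apply: eq_avg => h; apply: eq_avg => x; apply: eq_avg => y.
  rewrite /Delta /v rmorphM /= rmorph_prod /= mulrACA; congr (_ * _).
  rewrite -big_split /=; apply: eq_bigr => i _.
  by rewrite /G' /Delta mulrDr addrA.
rewrite [in leLHS]expnS exprM.
apply: (@le_trans _ _ (avg (fun h => abs (inner h)) ^+ (2 ^ n.+1))).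
  rewrite lerXn2r ?nnegrE ?exprn_ge0 ?abs_ge0 ?avg_ge0 // => [x|].
    exact: abs_ge0.
  by apply: le_trans CS _; exact: abs_avg.
apply: le_trans (avg_jensen _ _) _ => [h|]; first exact: abs_ge0.
apply: avg_mono => h; apply: IH => i x; exact: Delta_le1.
Qed.

Definition Deltas hs w := foldl (fun g h => Delta h g) w hs.

Fixpoint avgs (K : fieldType) k (Phi : seq F -> K) : K :=
  if k is k'.+1 then avg (fun h => avgs k' (fun hs => Phi (h :: hs)))
  else Phi [::].

Lemma gowers_avgs k j w :
  gowers (k + j) w = avgs k (fun hs => gowers j (Deltas hs w)).
Proof. by elim: k w => [//|k IH] w /=; apply: eq_avg => h; rewrite IH. Qed.

Lemma eq_Deltas hs w w' : w =1 w' -> Deltas hs w =1 Deltas hs w'.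
Proof.
elim: hs w w' => [//|h hs IH] w w' e /=; apply: IH; exact: eq_Delta.
Qed.

Lemma Deltas_le1 hs w : (forall x, abs (w x) <= 1) -> forall x, abs (Deltas hs w x) <= 1.
Proof. by elim: hs w => [//|h hs IH] w w1 /=; apply: IH; exact: Delta_le1. Qed.

Lemma DeltaC a b w : Delta a (Delta b w) =1 Delta b (Delta a w).
Proof.
by move=> x; rewrite /Delta !rmorphM /= conjcK addrAC; ring.
Qed.

Lemma Deltas_Delta hs h w : Delta h (Deltas hs w) =1 Deltas hs (Delta h w).
Proof.
elim: hs w => [//|a hs IH] w x /=.
by rewrite IH; apply: eq_Deltas; exact: DeltaC.
Qed.

(** The form in which iterated derivatives along a line of directions enter the
    weighted inequality above. *)
Lemma Deltas_dilate_prod hs w : (forall x, abs (w x) <= 1) ->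
  exists (c : nat -> F) (G : nat -> F -> C),
    (forall i x, abs (G i x) <= 1) /\
    forall t x, Deltas [seq t * h | h <- hs] w x =
      \prod_(i < 2 ^ size hs) G i (x + c i * t).
Proof.
elim/last_ind: hs w => [|hs h IH] w w1.
  exists (fun=> 0), (fun=> w); split=> // t x.
  by rewrite expn0 big_ord1 mul0r addr0.
have [c [G [G1 e]]] := IH w w1.
pose n := (2 ^ size hs)%N.
exists (fun i => if (i < n)%N then c i + h else c (i - n)%N).
exists (fun i x => if (i < n)%N then G i x else (G (i - n)%N x)^*%C).
split=> [i x|t x]; first by case: ifP => _; rewrite ?absJ.
rewrite map_rcons -cats1 /Deltas foldl_cat /=.
rewrite /Delta -!/(Deltas _ _) !e size_rcons expnS mul2n -addnn.
rewrite big_split_ord /= rmorph_prod /=; congr (_ * _); apply: eq_bigr => i _.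
  by rewrite ltn_ord mulrDl addrA addrAC [h * t]mulrC.
by rewrite ltnNge leq_addr /= addnC addnK.
Qed.

Section AvgsTheory.
Variable K : numFieldType.
Implicit Types Phi Psi : seq F -> K.

Lemma eq_avgs k Phi Psi :
  (forall hs, size hs = k -> Phi hs = Psi hs) -> avgs k Phi = avgs k Psi.
Proof.
elim: k Phi Psi => [|k IH] Phi Psi e /=; first exact: e.
by apply: eq_avg => h; apply: IH => hs sz; apply: e; rewrite /= sz.
Qed.

Lemma avgs_mono k Phi Psi :
  (forall hs, size hs = k -> Phi hs <= Psi hs) -> avgs k Phi <= avgs k Psi.
Proof.
elim: k Phi Psi => [|k IH] Phi Psi e /=; first exact: e.
by apply: avg_mono => h; apply: IH => hs sz; apply: e; rewrite /= sz.
Qed.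

Lemma avgs_const k (c : K) : avgs k (fun=> c) = c.
Proof. by elim: k => [//|k IH] /=; rewrite IH avg_const. Qed.

Lemma avgsD k Phi Psi :
  avgs k (fun hs => Phi hs + Psi hs) = avgs k Phi + avgs k Psi.
Proof.
elim: k Phi Psi => [//|k IH] Phi Psi /=; rewrite -avgD.
by apply: eq_avg => h; rewrite IH.
Qed.

Lemma avg_avgs_exchange k (Phi : F -> seq F -> K) :
  avg (fun x => avgs k (Phi x)) = avgs k (fun hs => avg (fun x => Phi x hs)).
Proof.
elim: k Phi => [//|k IH] Phi /=.
by rewrite avg_exchange; apply: eq_avg => h; rewrite IH.
Qed.

End AvgsTheory.

Lemma avgs_real k (Phi : seq F -> R) :
  (avgs k Phi)%:C = avgs k (fun hs => (Phi hs)%:C).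
Proof.
elim: k Phi => [//|k IH] Phi /=; rewrite avg_real.
by apply: eq_avg => h; rewrite IH.
Qed.

Lemma gowers_avgsC k w :
  (gowers k w)%:C = avgs k.+1 (fun hs => avg (Deltas hs w)).
Proof.
elim: k w => [|k IH] w; first exact: avg_DeltaE.
rewrite [LHS]avg_real; apply: eq_avg => h; exact: IH.
Qed.

End Gowers.

(** * Additive characters and phases of rational functions *)

Section AdditiveCharacter.
Variables (R : rcfType) (F : finFieldType).
Local Notation C := (R[i]).

Definition additive_char (psi : F -> C) : Prop :=
  [/\ {morph psi : x y / x + y >-> x * y}, forall x, abs (psi x) = 1
    & \sum_x psi x = 0].

Variable psi : F -> C.
Hypothesis psiP : additive_char psi.

Lemma psiD x y : psi (x + y) = psi x * psi y.
Proof. by case: psiP => ->. Qed.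

Lemma abs_psi x : abs (psi x) = 1.
Proof. by case: psiP. Qed.

Lemma psi_neq0 x : psi x != 0.
Proof. by rewrite -abs_eq0 abs_psi oner_eq0. Qed.

Lemma psi0 : psi 0 = 1.
Proof.
by apply: (mulfI (psi_neq0 0)); rewrite mulr1 -psiD addr0.
Qed.

Lemma psiN x : psi (- x) = (psi x)^*%C.
Proof.
apply: (mulfI (psi_neq0 x)).
by rewrite -psiD subrr psi0 mulcJ_abs abs_psi expr1n.
Qed.

Lemma avg_psi a : avg (fun x => psi (x * a)) = (a == 0)%:R.
Proof.
have [->|a0] := eqVneq a 0.
  by under eq_avg do rewrite mulr0 psi0; rewrite avg_const.
under eq_avg do rewrite mulrC.
by rewrite (avg_dilate psi a0) /avg; case: psiP => _ _ ->; rewrite mulr0.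
Qed.

Lemma sum_psi a : \sum_x psi (x * a) = (a == 0)%:R * #|F|%:R.
Proof.
rewrite -(avg_psi a) /avg mulrAC mulVf ?mul1r //.
exact: lt0r_neq0 (card_field_gt0 F _).
Qed.

Lemma avg_pick (f : F -> C) h :
  avg (fun u => f u * ((h - u == 0)%:R * #|F|%:R)) = f h.
Proof.
rewrite /avg (bigD1 h) //= subrr eqxx mul1r big1 => [|u uh]; last first.
  by rewrite subr_eq0 eq_sym (negbTE uh) mul0r mulr0.
rewrite addr0 mulrCA mulVf ?mulr1 //.
exact: lt0r_neq0 (card_field_gt0 F _).
Qed.

(** The coefficients are nonnegative with sum [avg (abs g ^+ 2)], so that an
    autocorrelation is a convex combination of exponentials when [abs g <= 1]. *)
Lemma autocorrelation_fourier (g : F -> C) h :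
  avg (Delta h g) =
  \sum_xi (abs (avg (fun x => g x * psi (- (xi * x)))) ^+ 2)%:C * psi (xi * h).
Proof.
have coef xi : (abs (avg (fun x => g x * psi (- (xi * x)))) ^+ 2)%:C
    = avg (fun u => avg (Delta u g) * psi (- (xi * u))).
  rewrite avg_DeltaE; apply: eq_avg => u; rewrite -avgZr; apply: eq_avg => y.
  rewrite /Delta rmorphM /= -psiN opprK mulrACA; congr (_ * _).
  by rewrite -psiD; congr psi; ring.
under eq_bigr do rewrite coef -avgZr.
rewrite -avg_sum.
under [RHS]eq_avg => u.
  under eq_bigr => xi _.
    rewrite -mulrA -psiD (_ : _ + _ = xi * (h - u)); last by ring.
    over.
  rewrite -mulr_sumr sum_psi; over.
by rewrite avg_pick.
Qed.

End AdditiveCharacter.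

Section RationalPhase.
Variables (R : rcfType) (F : finFieldType).
Local Notation C := (R[i]).
Local Notation q := (#|F|%:R : R).

Definition Diff (h : F) (u : F -> F) : F -> F := fun x => u (x + h) - u x.
Definition Diffs (hs : seq F) (u : F -> F) := foldl (fun g h => Diff h g) u hs.

(** Coefficients and shifts of the iterated difference operator, the first
    shift being 0. *)
Fixpoint cube (hs : seq F) : seq (F * F) :=
  if hs is h :: hs' then
    [seq (- u.1, u.2) | u <- cube hs'] ++ [seq (u.1, u.2 + h) | u <- cube hs']
  else [:: (1, 0)].

Lemma Diffs_cube hs u x :
  Diffs hs u x = \sum_(e <- cube hs) e.1 * u (x + e.2).
Proof.
elim: hs u => [|h hs IH] u /=; first by rewrite big_seq1 mul1r addr0.
rewrite IH big_cat !big_map /= -big_split; apply: eq_bigr => e _ /=.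
by rewrite /Diff mulrBr mulNr addrC addrA.
Qed.

Lemma size_cube hs : size (cube hs) = (2 ^ size hs)%N.
Proof.
by elim: hs => //= h hs IH; rewrite size_cat !size_map IH expnS mul2n addnn.
Qed.

Lemma cube_head hs :
  exists2 e, e != 0 & cube hs = (e, 0) :: behead (cube hs).
Proof.
elim: hs => [|h hs [e e0 E]] /=; first by exists 1; rewrite ?oner_eq0.
by exists (- e); rewrite ?oppr_eq0 // E.
Qed.

(** The vertex 0 of the cube coincides with another vertex. *)
Definition degenerate hs := 0 \in [seq u.2 | u <- behead (cube hs)].

Lemma degenerate_rare k :
  avgs k (fun hs => (degenerate hs)%:R : R) <= (2 ^ k)%:R / q.
Proof.
elim: k => [|k IH] /=.
  by rewrite divr_ge0 ?ler0n.
rewrite avg_avgs_exchange.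
apply: (@le_trans _ _ (avgs k (fun hs => (degenerate hs)%:R + (2 ^ k)%:R / q))).
  apply: avgs_mono => hs sz.
  apply: (@le_trans _ _ (avg (fun h => (degenerate hs)%:R
      + (h \in [seq - u.2 | u <- cube hs])%:R))).
    apply: avg_mono => h; rewrite -natrD ler_nat /degenerate /=.
    have [e _ E] := cube_head hs; rewrite E /= map_cat mem_cat -!map_comp.
    case: (boolP (0 \in [seq u.2 | u <- (e, 0 + h) :: _])) => [hb|_]; last first.
      by rewrite orbF leq_addr.
    suff -> : h \in - 0 :: [seq - u.2 | u <- behead (cube hs)] by rewrite orbT addn1.
    move: hb; rewrite /= !in_cons add0r oppr0 (eq_sym 0) => /orP[->//|].
    rewrite -map_comp => /mapP[u ui /eqP] /=.
    rewrite eq_sym addrC addr_eq0 => /eqP ->.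
    by rewrite (map_f (fun u : F * F => - u.2)) ?orbT.
  rewrite avgD avg_const lerD2l.
  by apply: avg_indicator; [move=> x; apply | rewrite size_map size_cube sz].
rewrite avgsD avgs_const expnS mul2n -addnn natrD mulrDl lerD2r; exact: IH.
Qed.

(** A sum of distinct simple fractions has few zeros: clearing denominators
    gives a polynomial that does not vanish at the pole [0]. *)
Lemma simple_fractions_zeros (e0 : F) (T : seq (F * F)) :
  e0 != 0 -> 0 \notin [seq u.2 | u <- T] ->
  exists2 s : seq F, (size s <= 2 * (size T).+1)%N &
  forall y, e0 * y^-1 + \sum_(u <- T) u.1 * (y + u.2)^-1 = 0 -> y \in s.
Proof.
move=> e00 T0.
pose D := \prod_(u <- T) ('X + u.2%:P) : {poly F}.
have [M szM hM] : exists2 M : {poly F}, (size M <= size T)%N &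
    forall y, all (fun u => y + u.2 != 0) T ->
      M.[y] = D.[y] * \sum_(u <- T) u.1 * (y + u.2)^-1.
  rewrite {}/D; elim: T {T0} => [|u T [M szM hM]].
    by exists 0; rewrite ?size_poly0 // => y _; rewrite !big_nil mulr0 horner0.
  exists (u.1 *: \prod_(u <- T) ('X + u.2%:P) + ('X + u.2%:P) * M).
    rewrite (leq_trans (size_polyD _ _)) // geq_max; apply/andP; split.
      apply: leq_trans (size_scale_leq _ _) _.
      rewrite (eq_bigr (fun u : F * F => 'X - (- u.2)%:P)) => [|v _].
        by rewrite size_prod_XsubC.
      by rewrite polyCN opprK.
    apply: leq_trans (size_polyMleq _ _) _.
    by rewrite size_XaddC.
  move=> y /= /andP[yu ally]; rewrite !big_cons !hornerE hM //.
  by field.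
pose N := e0 *: D + 'X * M.
have N0 : N.[0] != 0.
  rewrite !hornerE mulf_neq0 // /D horner_prod prodf_seq_neq0.
  apply/allP => u uT /=; rewrite !hornerE.
  by apply: contra T0 => /eqP <-; exact: map_f.
have NN0 : N != 0 by apply: contraNneq N0 => ->; rewrite horner0.
have szD : (size D = (size T).+1)%N.
  rewrite /D (eq_bigr (fun u : F * F => 'X - (- u.2)%:P)) => [|v _].
    by rewrite size_prod_XsubC.
  by rewrite polyCN opprK.
have szN : (size N <= (size T).+1)%N.
  rewrite (leq_trans (size_polyD _ _)) // geq_max; apply/andP; split.
    by rewrite (leq_trans (size_scale_leq _ _)) // szD.
  by rewrite (leq_trans (size_polyMleq _ _)) // size_polyX.
exists (0 :: [seq - u.2 | u <- T] ++ [seq y <- enum F | root N y]).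
  rewrite /= size_cat size_map.
  have := @max_poly_roots _ N [seq y <- enum F | root N y] NN0.
  rewrite filter_all filter_uniq ?enum_uniq // => /(_ isT isT) szR.
  have := leq_trans szR szN; rewrite ltnS => szR'.
  by rewrite mulnS ltnS mul2n -addnn addnC -addSn leq_add // leqW.
move=> y hy; rewrite in_cons mem_cat mem_filter mem_enum andbT.
have [//|y0 /=] := eqVneq y 0.
have [ally|] := boolP (all (fun u => y + u.2 != 0) T); last first.
  move=> /allPn[u uT]; rewrite negbK addr_eq0 => /eqP ->.
  by rewrite (map_f (fun u : F * F => - u.2)).
apply/orP; right; rewrite /root /N !hornerE hM //.
set S := \sum_(_ <- _) _ in hy *.
have -> : e0 * D.[y] + y * (D.[y] * S) = y * D.[y] * (e0 * y^-1 + S) by field.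
by rewrite hy mulr0.
Qed.

Lemma Diffs_inv_zeros hs : ~~ degenerate hs ->
  avg (fun y => (Diffs hs (fun x => x^-1) y == 0)%:R : R)
    <= (2 * 2 ^ size hs)%:R / q.
Proof.
move=> nd; have [e e0 E] := cube_head hs.
have [s szs hs'] := simple_fractions_zeros e0 nd.
apply: (avg_indicator _ (s := s)).
  move=> y /eqP; rewrite Diffs_cube E big_cons /= addr0; exact: hs'.
by rewrite (leq_trans szs) // -size_cube E.
Qed.

Variable psi : F -> C.
Hypothesis psiP : additive_char psi.

Lemma Deltas_psi hs u :
  Deltas hs (fun x => psi (u x)) =1 fun x => psi (Diffs hs u x).
Proof.
elim: hs u => [//|h hs IH] u x /=; rewrite -IH; apply: eq_Deltas => y.
by rewrite /Delta /Diff (psiD psiP) (psiN psiP).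
Qed.

Lemma gowers_dilate k a (w : F -> C) : a != 0 ->
  gowers k (fun x => w (a * x)) = gowers k w.
Proof.
move=> a0; elim: k w => [|k IH] w /=; first by rewrite avg_dilate.
rewrite -[RHS](avg_dilate _ a0); apply: eq_avg => h.
by rewrite -[RHS]IH; apply: eq_gowers => x; rewrite /Delta mulrDr.
Qed.

(** Dilations permute the phases [psi (theta / t)], [theta != 0], so each of
    their Gowers norms equals the average over [theta], which counts the zeros
    of an iterated difference of [1 / t]. *)
Lemma gowers_inverse_phase k theta : theta != 0 ->
  gowers k (fun t => psi (theta * t^-1)) <= (2 ^ k.+4)%:R / q.
Proof.
move=> t0.
pose w th := fun t => psi (th * t^-1).
(* The phases are permuted by dilations. *)
have same th : th != 0 -> gowers k (w th) = gowers k (w theta).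
  move=> th0; rewrite -(gowers_dilate k (w theta) (a := theta / th)).
    apply: eq_gowers => t; rewrite /w; congr psi.
    by rewrite invfM invf_div mulrA [theta * _]mulrC divfK.
  by rewrite mulf_neq0 ?invr_eq0.
have q2 : 2 <= q.
  rewrite (ler_nat _ 2); by rewrite (cardD1 0) (cardD1 1) !inE oner_eq0.
set g := gowers k _.
set Z := avgs k.+1 (fun hs => avg (fun y =>
   (Diffs hs (fun x => x^-1) y == 0)%:R : R)).
have gZ : g * (q - 1) <= q * Z.
  have -> : q * Z = \sum_th gowers k (w th).
    apply: complexI; rewrite rmorphM /= rmorph_nat rmorph_sum /=.
    under [RHS]eq_bigr do rewrite gowers_avgsC.
    have -> (f : F -> C) : \sum_x f x = #|F|%:R * avg f.
      rewrite /avg mulVKf //; exact: lt0r_neq0 (card_field_gt0 F _).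
    congr (_ * _); rewrite avg_avgs_exchange /Z avgs_real.
    apply: eq_avgs => hs _; rewrite avg_exchange avg_real; apply: eq_avg => y.
    rewrite rmorph_nat -(avg_psi psiP); apply: eq_avg => th.
    rewrite /w (Deltas_psi hs (fun t => th * t^-1)); congr psi.
    rewrite !Diffs_cube mulr_sumr; apply: eq_bigr => e _; ring.
  rewrite (bigD1 0) //= (eq_bigr (fun=> g)) => [|th th0]; last exact: same.
  rewrite sumr_const cardC1 -[X in X <= _]add0r lerD ?gowers_ge0 //.
  by rewrite -[g *+ _]mulr_natr -subn1 natrB // ltnW // -(ltr_nat R) (lt_le_trans _ q2) ?ltr1n.
have Zb : Z <= (3 * 2 ^ k.+1)%:R / q.
  apply: (@le_trans _ _ (avgs k.+1 (fun hs =>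
      (degenerate hs)%:R + (2 * 2 ^ k.+1)%:R / q))).
    apply: avgs_mono => hs sz; have [d|nd] := boolP (degenerate hs).
      rewrite -[leLHS]addr0 lerD ?divr_ge0 ?ler0n //.
      by apply: avg_le_const => y; case: eqP.
    by rewrite add0r -sz Diffs_inv_zeros.
  rewrite avgsD avgs_const; have := degenerate_rare k.+1.
  rewrite (natrM _ 3) (natrM _ 2); set P := (2 ^ _)%:R; set c := avgs _ _.
  by set i := q^-1; move=> h; rewrite -/i in h *; lra.
have q0 : 0 < q by lra.
rewrite -/g ler_pdivlMr // !expnS !natrM in Zb *.
have g0 : 0 <= g by exact: gowers_ge0.
have P0 : 0 <= (2 ^ k)%:R :> R by rewrite ler0n.
have : g * q <= 2 * (g * (q - 1)) by nra.
by move=> h; rewrite ler_pdivlMr //; lra.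
Qed.

End RationalPhase.

(** * Gowers norms of multiplicative characters *)

Section MultiplicativeCharacter.
Variables (R : rcfType) (F : finFieldType).
Local Notation C := (R[i]).
Local Notation q := (#|F|%:R : R).

Definition mult_char (chi : F -> C) : Prop :=
  [/\ {morph chi : x y / x * y}, chi 0 = 0,
      forall x, x != 0 -> abs (chi x) = 1 & \sum_x chi x = 0].

Variable chi : F -> C.
Hypothesis chiP : mult_char chi.

Lemma chiM x y : chi (x * y) = chi x * chi y.
Proof. by case: chiP => ->. Qed.

Lemma chi0 : chi 0 = 0.
Proof. by case: chiP. Qed.

Lemma abs_chi x : x != 0 -> abs (chi x) = 1.
Proof. by case: chiP => _ _ + _; apply. Qed.

Lemma abs_chi_le1 x : abs (chi x) <= 1.
Proof.
by have [->|x0] := eqVneq x 0; rewrite ?chi0 ?abs0 ?ler01 // abs_chi.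
Qed.

Lemma chiJ x : x != 0 -> chi x * (chi x)^*%C = 1.
Proof. by move=> x0; rewrite mulcJ_abs abs_chi // expr1n. Qed.

Lemma gowers0_chi : gowers 0 chi = 0.
Proof.
by case: chiP => _ _ _ s0; rewrite /= /avg s0 mulr0 abs0 expr0n.
Qed.

Lemma Deltas_chi_dilate t hs : t != 0 ->
  exists2 c : C, c * c^*%C = 1 &
  forall x, Deltas [seq t * h | h <- hs] chi (t * x) = c * Deltas hs chi x.
Proof.
move=> t0; elim/last_ind: hs => [|hs h [c cc e]].
  by exists (chi t); [exact: chiJ | move=> x /=; rewrite chiM].
exists 1; first by rewrite rmorph1 mul1r.
move=> x; rewrite map_rcons -!cats1 /Deltas !foldl_cat /= -!/(Deltas _ _).
by rewrite /Delta -mulrDr !e rmorphM /= mulrACA cc.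
Qed.

Lemma Delta_chi_dilate t h hs : t != 0 ->
  avg (Delta (t^-1 * h) (Deltas hs chi)) =
  avg (Deltas [seq t * a | a <- hs] (Delta h chi)).
Proof.
move=> t0; have [c cc e] := Deltas_chi_dilate hs t0.
rewrite -[RHS](avg_dilate _ t0); apply: eq_avg => x.
rewrite -Deltas_Delta /Delta e -[t * x + h](_ : t * (x + t^-1 * h) = _).
  by rewrite e rmorphM /= mulrACA cc mul1r.
by rewrite mulrDr mulVKf.
Qed.

Variable psi : F -> C.
Hypothesis psiP : additive_char psi.

(** Write [D h1 hs] for the mean of the iterated derivative of [chi]. As a
    function of [h1] it is positive definite, and it is homogeneous:
    [D (h1 / t) hs = D h1 (t * hs)]. Expanding the left-hand side into
    exponentials [psi (xi * h1 / t)] and the right-hand side into functions of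
    [x + c_i t], the correlation between the two is controlled by the Gowers
    norms of the phases [psi (theta / t)], which are negligible; only the zero
    frequency remains, and it contributes the previous Gowers norm. *)
Lemma gowers_chi_step j (eta : R) : 0 <= eta ->
  (forall theta, theta != 0 ->
     gowers (2 ^ j).-1 (fun t => psi (theta * t^-1)) <= eta ^+ (2 ^ 2 ^ j)) ->
  gowers j.+1 chi <= gowers j chi + (eta + 3 / q).
Proof.
move=> eta0 heta.
rewrite -[X in gowers X _ <= _]addn1 -[X in _ <= gowers X _ + _]addn0.
rewrite !gowers_avgs -[eta + _](avgs_const F j) -avgsD.
apply: avgs_mono => hs sz.
set g := Deltas hs chi.
have g1 x : abs (g x) <= 1 by apply: Deltas_le1; exact: abs_chi_le1.
pose E h := avg (Delta h g).
have E1 h : abs (E h) <= 1 by apply: abs_avg_le1; exact: Delta_le1.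
pose D h t := avg (Deltas [seq t * a | a <- hs] (Delta h chi)).
have D1 h t : abs (D h t) <= 1.
  by apply: abs_avg_le1; apply: Deltas_le1; apply: Delta_le1; exact: abs_chi_le1.
have ED h t : t != 0 -> E (t^-1 * h) = D h t by exact: Delta_chi_dilate.
pose c xi := abs (avg (fun x => g x * psi (- (xi * x)))) ^+ 2.
have c0 xi : 0 <= c xi by rewrite exprn_ge0 ?abs_ge0.
have EE h : E h = \sum_xi (c xi)%:C * psi (xi * h).
  exact: autocorrelation_fourier.
have sumc : \sum_xi c xi <= 1.
  have : E 0 = (\sum_xi c xi)%:C.
    rewrite EE rmorph_sum; apply: eq_bigr => xi _.
    by rewrite mulr0 (psi0 psiP) mulr1.
  move=> e; rewrite -(abs_real (sumr_ge0 _ (fun i _ => c0 i))) -e; exact: E1.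
have cz : c 0 = gowers 0 g.
  rewrite /c /=; congr (abs _ ^+ 2); apply: eq_avg => x.
  by rewrite mul0r oppr0 (psi0 psiP) mulr1.
have q0 : 0 < q by exact: card_field_gt0.
have ind0 : avg (fun h : F => (h == 0)%:R : R) <= 1 / q.
  apply: (@avg_indicator F R (fun h => h == 0) [:: 0] 1) => // x.
  by rewrite inE.
(* [Phi] is the mean square of [E]; the average [avg J] replaces one of the two
   factors [E (t^-1 * h)] by [D h t], which changes nothing for [t != 0]. *)
pose Phi := gowers 1 g.
have PhiE : Phi = avg (fun h => abs (E h) ^+ 2) by [].
have Phi0 : 0 <= Phi by exact: gowers_ge0.
have Phi1 : Phi <= 1.
  by apply: avg_le_const => h; apply: exprn_ile1; [exact: abs_ge0 | exact: E1].
pose J t := avg (fun h => E (t^-1 * h) * (D h t)^*%C).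
have J1 t : abs (J t) <= 1.
  by apply: abs_avg_le1 => h; apply: abs_le1M; rewrite ?absJ.
have JPhi t : t != 0 -> J t = Phi%:C.
  move=> t0; rewrite PhiE avg_real -[RHS](avg_dilate _ (invr_neq0 t0)).
  by apply: eq_avg => h; rewrite -ED // mulcJ_abs.
have PhiJ : Phi <= abs (avg J) + 2 / q.
  rewrite -{1}(abs_real Phi0).
  by apply: avg_almost_const JPhi J1 _; rewrite abs_real.
suff : abs (avg J) <= c 0 + (eta + 1 / q).
  rewrite -/Phi -cz; move: PhiJ; set i := q^-1; lra.
pose B h xi := abs (avg (fun t => psi (xi * h * t^-1) * (D h t)^*%C)).
have BB h xi : B h xi <= (xi == 0)%:R + (h == 0)%:R + eta.
  have B1 : B h xi <= 1.
    apply: abs_avg_le1 => t; apply: abs_le1M; rewrite ?absJ //.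
    by rewrite (abs_psi psiP).
  have [xi0|xi0] := eqVneq xi 0.
    by apply: le_trans B1 _; rewrite -addrA lerDl addr_ge0.
  have [h0|h0] := eqVneq h 0.
    by apply: le_trans B1 _; rewrite add0r lerDl.
  rewrite !add0r.
  have dh1 x : abs (Delta h chi x) <= 1 by apply: Delta_le1; exact: abs_chi_le1.
  have [s [G [G1 e]]] := Deltas_dilate_prod hs dh1.
  have := heta _ (mulf_neq0 xi0 h0).
  have vn := @weighted_von_neumann _ _ (2 ^ j).-1 (fun t => psi (xi * h * t^-1)) s
    (fun i x => (G i x)^*%C)
    (fun i x => eq_ind_r (fun z => z <= 1) (G1 i x) (absJ _)).
  rewrite prednK ?expn_gt0 // in vn.
  move=> /(le_trans vn); rewrite ler_pXn2r ?nnegrE ?abs_ge0 ?expn_gt0 //.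
  suff -> : B h xi = abs (avg (fun x => avg (fun y => psi (xi * h * y^-1) *
      \prod_(i < 2 ^ j) (G i (x + s i * y))^*%C))) by [].
  rewrite avg_exchange; congr abs; apply: eq_avg => t.
  rewrite avgZ /D conj_avg; congr (_ * _); apply: eq_avg => x.
  by rewrite e sz rmorph_prod.
have -> : avg J = avg (fun h => \sum_xi (c xi)%:C *
    avg (fun t => psi (xi * h * t^-1) * (D h t)^*%C)).
  rewrite /J avg_exchange; apply: eq_avg => h.
  under [RHS]eq_bigr do rewrite -avgZ.
  rewrite -avg_sum; apply: eq_avg => t.
  rewrite EE mulr_suml; apply: eq_bigr => xi _.
  by rewrite (_ : xi * (t^-1 * h) = xi * h * t^-1) ?mulrA //; ring.
apply: le_trans (abs_avg _) _.
apply: (@le_trans _ _ (avg (fun h : F => c 0 + eta + (h == 0)%:R))); last first.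
  by rewrite avgD avg_const -addrA lerD2l lerD2l.
apply: avg_mono => h; apply: le_trans (abs_sum _ _ _) _.
apply: (@le_trans _ _ (\sum_xi (c xi * (xi == 0)%:R + c xi * (eta + (h == 0)%:R)))).
  apply: ler_sum => xi _; rewrite absM abs_real // -mulrDr ler_wpM2l //.
  by rewrite addrCA addrC -addrA [_ + eta]addrC addrA; move: (BB h xi); rewrite /B; lra.
rewrite big_split /= -mulr_suml (bigD1 0) //= eqxx mulr1 big1 => [|xi xi0].
  rewrite addr0 -addrA lerD2l -[leRHS]mul1r ler_wpM2r //.
  by rewrite addr_ge0.
by rewrite (negbTE xi0) mulr0.
Qed.

End MultiplicativeCharacter.

(** The induction starts from [gowers 0 chi = 0]. A saving is expressed through
    a scale [b] with [b ^+ m <= q]: the roots taken at each step only increase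
    the exponent [m]. *)
Lemma gowers_chi_decay (R : rcfType) k e : exists m (K : R), 0 <= K /\
  forall (F : finFieldType) (chi psi : F -> R[i]) (b : R),
    mult_char chi -> additive_char psi -> 1 <= b -> b ^+ m <= #|F|%:R ->
    gowers k chi <= K / b ^+ e.
Proof.
elim: k => [|k [m [K [K0 IH]]]].
  exists 0%N, 0; split=> // F chi psi b chiP _ b1 _.
  by rewrite (gowers0_chi chiP) mul0r.
pose S := (2 ^ 2 ^ k)%N; pose A := (2 ^ ((2 ^ k).-1).+4)%:R : R.
have A1 : 1 <= A by rewrite ler1n expn_gt0.
exists (m + e * S + e)%N, (K + A + 3); split; first lra.
move=> F chi psi b chiP psiP b1 hb.
have b0 : 0 < b by lra.
have small i : (i <= m + e * S + e)%N -> b ^+ i <= #|F|%:R.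
  by move=> h; apply: le_trans hb; rewrite ler_weXn2l.
have q0 : 0 < #|F|%:R :> R by exact: card_field_gt0.
have inv i : (i <= m + e * S + e)%N -> (#|F|%:R : R)^-1 <= (b ^+ i)^-1.
  by move=> h; rewrite lef_pV2 ?posrE ?exprn_gt0 // small.
have := @gowers_chi_step _ _ _ chiP _ psiP k (A / b ^+ e) _ _.
move=> /(_ _ _) step; apply: (le_trans (step _ _)).
- by rewrite divr_ge0 ?exprn_ge0 ?(ltW b0) ?(le_trans ler01 A1).
- move=> theta t0; apply: le_trans (gowers_inverse_phase psiP _ t0) _.
  rewrite -/A -/S exprMn exprVn -exprM.
  apply: ler_pM; rewrite ?invr_ge0 ?(ltW q0) ?(le_trans ler01 A1) //.
    by apply: ler_eXnr => //; rewrite expn_gt0.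
  by apply: inv; lia.
- rewrite -[K + A + 3]addrA [(K + _) / _]mulrDl [(A + 3) / _]mulrDl; apply: lerD.
    apply: IH => //; first exact: psiP.
    by apply: small; lia.
  rewrite lerD2l ler_pM2l //; apply: inv; lia.
Qed.

(** * Complete character sums and moments of short sums *)

Section CompleteSums.
Variables (R : rcfType) (F : finFieldType).
Local Notation C := (R[i]).
Local Notation q := (#|F|%:R : R).

Lemma weighted_von_neumann_fin (I : finType) n (w : F -> C) (c : I -> F)
    (G : I -> F -> C) :
  #|I| = n.+1 -> (forall i x, abs (G i x) <= 1) ->
  abs (avg (fun x => avg (fun y => w y * \prod_i G i (x + c i * y))))
    ^+ (2 ^ n.+1) <= gowers n w.
Proof.
move=> cI G1; have [i0 _] : exists i0, i0 \in I.
  by apply/card_gt0P; rewrite cI.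
have := @weighted_von_neumann _ _ n w (fun k => c (nth i0 (enum I) k))
  (fun k => G (nth i0 (enum I) k)) (fun k => G1 _).
congr (abs _ ^+ _ <= _); apply: eq_avg => x; apply: eq_avg => y; congr (_ * _).
by rewrite -[RHS]big_enum (big_nth i0) big_mkord -cardE cI.
Qed.

(** A sum of products of characters at [b i], one of which is isolated, is a
    weighted count over the lines through the origin: the substitution
    [z = y / x] leaves it unchanged for every [x != 0], because the product of
    the characters is trivial, and it turns the isolated factor into a weight
    in [y] alone. *)
Lemma complete_sum_bound (I : finType) n (X : I -> F -> C) (b : I -> F) i0 zeta :
  #|I| = n.+1 -> (forall i x, abs (X i x) <= 1) ->
  (forall i, {morph X i : x y / x * y}) ->
  (forall x, x != 0 -> \prod_i X i x = 1) ->
  (forall i, i != i0 -> b i != b i0) ->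
  0 <= zeta -> gowers n (X i0) <= zeta ^+ (2 ^ n.+1) ->
  abs (avg (fun z => \prod_i X i (z + b i))) <= zeta + 2 / q.
Proof.
move=> cI X1 XM Xprod bi0 z0 hz.
(* After a translation the isolated shift is 0; the factor at [i0] becomes the
   weight, and the constant 1 takes its place among the [G i]. *)
pose b' i := b i - b i0.
pose G i t := if i == i0 then 1 else X i (b' i * t).
pose c i := (b' i)^-1.
pose T x := avg (fun y => X i0 y * \prod_i G i (x + c i * y)).
have G1 i x : abs (G i x) <= 1 by rewrite /G; case: ifP; rewrite ?abs1.
set S := avg _.
have TS x : x != 0 -> T x = S.
  move=> x0; rewrite /S -(avg_shift (- b i0)).
  rewrite -[RHS](avg_dilate _ (invr_neq0 x0)); apply: eq_avg => y.
  rewrite [RHS](eq_bigr (fun i => X i x^-1 * X i (y + b' i * x))) => [|i _]; last first.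
    rewrite -XM; congr X; rewrite mulrDr [_ * x]mulrC mulKf // /b'; ring.
  rewrite [RHS]big_split /= Xprod ?invr_neq0 // mul1r.
  rewrite (bigD1 i0) //= [in RHS](bigD1 i0) //=.
  rewrite {1}/G eqxx mul1r; congr (_ * _); first by rewrite /b' subrr mul0r addr0.
  apply: eq_bigr => i ii0; rewrite /G (negbTE ii0); congr X.
  have nz : b' i != 0 by rewrite /b' subr_eq0 bi0.
  by rewrite mulrDr /c mulVKf // addrC.
have S1 : abs S <= 1 by apply: abs_avg_le1 => x; exact: abs_prod_le1.
have T1 x : abs (T x) <= 1.
  by apply: abs_avg_le1 => y; apply: abs_le1M => //; exact: abs_prod_le1.
apply: le_trans (avg_almost_const TS T1 S1) _; rewrite lerD2r.
have := le_trans (weighted_von_neumann_fin (X i0) c cI G1) hz.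
by rewrite ler_pXn2r ?nnegrE ?abs_ge0 ?expn_gt0.
Qed.

Section Moments.
Variables (chi : F -> C).
Hypothesis chiP : mult_char chi.
Variables (r : nat).

Definition signed_char (j : 'I_r.+1 * bool) (x : F) : C :=
  if j.2 then (chi x)^*%C else chi x.

Lemma signed_char_le1 j x : abs (signed_char j x) <= 1.
Proof. by rewrite /signed_char; case: j.2; rewrite ?absJ (abs_chi_le1 chiP). Qed.

Lemma signed_char_prod x : x != 0 -> \prod_j signed_char j x = 1.
Proof.
move=> x0; rewrite -(pair_bigA _ (fun i s => signed_char (i, s) x)) /=.
by rewrite big1 // => i _; rewrite big_bool /= mulrC (chiJ chiP).
Qed.

Section Multisets.
Variables (I B : finType).

Definition isolated (f : {ffun I -> B}) :=
  [exists i, forall j, (j != i) ==> (f j != f i)].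

(** If no value is taken exactly once, then at most half as many values as
    indices occur, so the function factors through a set of that size. *)
Lemma card_non_isolated k : #|I| = (k.+1 * 2)%N ->
  (#|[pred f | ~~ isolated f]| <= #|B| ^ k.+1 * k.+1 ^ #|I|)%N.
Proof.
move=> cI; have [i0 _] : exists i0, i0 \in I.
  by apply/card_gt0P; rewrite cI muln_gt0.
pose comb (uv : {ffun 'I_k.+1 -> B} * {ffun I -> 'I_k.+1}) : {ffun I -> B} :=
  [ffun i => uv.1 (uv.2 i)].
have -> : (#|B| ^ k.+1 * k.+1 ^ #|I| =
    #|{: {ffun 'I_k.+1 -> B} * {ffun I -> 'I_k.+1}}|)%N.
  by rewrite card_prod !card_ffun !card_ord.
apply: leq_trans (leq_image_card comb predT).
apply: subset_leq_card; apply/fintype.subsetP => f; rewrite inE => ni.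
pose A := f @: I.
have cA : (#|A| <= k.+1)%N.
  rewrite -(leq_pmul2r (isT : 0 < 2)%N) -cI -sum_nat_const -sum1_card.
  rewrite (partition_big f (fun a => a \in A)) => [|i _] /=; last exact: imset_f.
  apply: leq_sum => a /imsetP[i _ ->].
  move: ni; rewrite negb_exists => /forallP/(_ i).
  rewrite negb_forall => /existsP[j]; rewrite negb_imply negbK => /andP[ji /eqP e].
  by rewrite (bigD1 i) //= (bigD1 j) //= e eqxx.
apply/fintype.imageP; exists ([ffun a : 'I_k.+1 => nth (f i0) (enum A) a],
  [ffun i => inord (index (f i) (enum A))]) => //.
apply/ffunP => i; rewrite !ffunE /=.
have iA : f i \in enum A by rewrite mem_enum imset_f.
rewrite inordK ?nth_index //.
by apply: leq_trans cA; rewrite cardE index_mem.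
Qed.

End Multisets.

(** Expanding the power, the products in which no shift is isolated are few,
    and the others cancel on average over [x]. *)
Lemma short_sum_moment B (t : 'I_B -> F) (a : 'I_B -> C) (zeta : R) :
  injective t -> (forall k, abs (a k) <= 1) -> 0 <= zeta ->
  gowers (r.*2.+1) chi <= zeta ^+ (2 ^ r.*2.+2) ->
  avg (fun x => abs (\sum_k a k * chi (x + t k)) ^+ (r.+1 * 2)) <=
    (B ^ r.+1 * r.+1 ^ (r.+1 * 2))%:R + (B ^ (r.+1 * 2))%:R * (zeta + 2 / q).
Proof.
move=> tinj a1 z0 hz.
pose I := ('I_r.+1 * bool)%type.
have cI : #|{: I}| = (r.+1 * 2)%N by rewrite card_prod card_ord card_bool.
pose a' (j : I) k := if j.2 then (a k)^*%C else a k.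
have a'1 j k : abs (a' j k) <= 1 by rewrite /a'; case: j.2; rewrite ?absJ.
set L := avg _.
pose c (f : {ffun I -> 'I_B}) :=
  (\prod_j a' j (f j)) * avg (fun x => \prod_j signed_char j (x + t (f j))).
have LE : L%:C = \sum_f c f.
  rewrite avg_real /c; under [RHS]eq_bigr do rewrite -avgZ.
  rewrite -avg_sum; apply: eq_avg => x.
  transitivity (\prod_(j : I) \sum_k a' j k * signed_char j (x + t k)).
    rewrite -(pair_bigA _ (fun i s =>
      \sum_k a' (i, s) k * signed_char (i, s) (x + t k))) /=.
    rewrite mulnC exprM rmorphXn /= -mulcJ_abs.
    rewrite [RHS](eq_bigr (fun=> (\sum_k a k * chi (x + t k)) *
        (\sum_k a k * chi (x + t k))^*%C)) ?prodr_const ?card_ord // => i _.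
    rewrite big_bool /= mulrC; congr (_ * _); rewrite rmorph_sum.
    by apply: eq_bigr => k _; rewrite rmorphM.
  rewrite bigA_distr_bigA /=; apply: eq_bigr => f _.
  by rewrite big_split.
have L0 : 0 <= L by apply: avg_ge0 => x; rewrite exprn_ge0 ?abs_ge0.
rewrite -(abs_real L0) LE.
apply: le_trans (abs_sum _ _ _) _.
have e0 : 0 <= zeta + 2 / q by rewrite addr_ge0 ?divr_ge0 ?ler0n.
have cb f : abs (c f) <= (~~ isolated f)%:R + (zeta + 2 / q).
  rewrite /c absM; apply: (@le_trans _ _ (1 * abs (avg (fun x =>
      \prod_j signed_char j (x + t (f j)))))).
    by rewrite ler_wpM2r ?abs_ge0 ?abs_prod_le1.
  rewrite mul1r; have [iso|] := boolP (isolated f); last first.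
    move=> _; apply: (@le_trans _ _ 1); last by rewrite lerDl.
    by apply: abs_avg_le1 => x; apply: abs_prod_le1 => j; exact: signed_char_le1.
  rewrite add0r; have /existsP[i0 /forallP hi] := iso.
  apply: (complete_sum_bound (n := r.*2.+1) (i0 := i0)) => //.
  - by rewrite cI mulSn -muln2.
  - exact: signed_char_le1.
  - move=> i x y; rewrite /signed_char; case: i.2; rewrite (chiM chiP) //.
    by rewrite rmorphM.
  - exact: signed_char_prod.
  - by move=> i ii0; rewrite (inj_eq tinj); apply: implyP ii0.
  - rewrite /signed_char; case: (i0.2) => //; by rewrite gowers_conj.
apply: le_trans (ler_sum _ (fun f _ => cb f)) _.
rewrite big_split /= sumr_const; apply: lerD; last first.
  by rewrite card_ffun cI card_ord -[_ *+ (_ ^ _)]mulr_natl.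
rewrite -natr_sum ler_nat.
rewrite (eq_bigr (fun f => if ~~ isolated f then 1 else 0)%N) => [|f _]; last by case: isolated.
rewrite -big_mkcond sum1_card.
by have := @card_non_isolated I 'I_B r cI; rewrite cI card_ord.
Qed.

End Moments.
End CompleteSums.

(** * Harmonic sums and the multiplicative energy of an interval *)

Section Harmonic.
Variable R : realFieldType.

Definition harmonic_sum n : R := \sum_(1 <= i < n.+1) i%:R^-1.

Lemma harmonic_sum_ge0 n : 0 <= harmonic_sum n.
Proof. by apply: sumr_ge0 => i _; rewrite invr_ge0. Qed.

Lemma harmonic_sumS n : harmonic_sum n.+1 = harmonic_sum n + n.+1%:R^-1.
Proof. by rewrite /harmonic_sum big_nat_recr. Qed.

Lemma harmonic_sum_mono m n : (m <= n)%N -> harmonic_sum m <= harmonic_sum n.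
Proof.
move=> /subnK <-; elim: (n - m)%N => [//|k IH].
by apply: le_trans IH _; rewrite addSn harmonic_sumS lerDl invr_ge0.
Qed.

Lemma harmonic_sum_log n k : (n < 2 ^ k)%N -> harmonic_sum n <= k%:R.
Proof.
move=> nk; have {nk} : (n <= (2 ^ k).-1)%N by rewrite -ltnS prednK ?expn_gt0.
move=> /harmonic_sum_mono /le_trans; apply.
elim: k => [|k IH]; first by rewrite /harmonic_sum big_geq.
rewrite /harmonic_sum !prednK ?expn_gt0 // in IH *.
rewrite (@big_cat_nat _ _ _ (2 ^ k)) ?expn_gt0 ?leq_exp2l //=.
rewrite -natr1; apply: lerD => //.
apply: (@le_trans _ _ (\sum_(2 ^ k <= i < 2 ^ k.+1) ((2 ^ k)%:R : R)^-1)).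
  rewrite big_nat [leRHS]big_nat; apply: ler_sum => i /andP[ki _].
  by rewrite lef_pV2 ?posrE ?ltr0n ?(leq_trans _ ki) ?expn_gt0 // ler_nat.
have nz : (2 ^ k)%:R != 0 :> R by rewrite pnatr_eq0 -lt0n expn_gt0.
by rewrite sumr_const_nat expnS mul2n -addnn addnK -[_ *+ _]mulr_natr mulVf.
Qed.

(** Since [b.+1 <= 2 ^ b], a logarithm of [p] is harmless at any scale [b] that
    is a fixed power of [p]. *)
Lemma harmonic_sum_base b m n : (n < b.+1 ^ m)%N -> harmonic_sum n <= (b * m)%:R.
Proof.
move=> h; apply: harmonic_sum_log; apply: leq_trans h _.
rewrite expnM; case: m => [//|m]; by rewrite leq_exp2r // ltn_expl.
Qed.

End Harmonic.

Section CauchySchwarz.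
Variable R : realFieldType.

Lemma cauchy_schwarz_sum (I : finType) (a b : I -> R) :
  (\sum_i a i * b i) ^+ 2 <= (\sum_i a i ^+ 2) * (\sum_i b i ^+ 2).
Proof.
have : 0 <= \sum_i \sum_j (a i * b j - a j * b i) ^+ 2.
  by apply: sumr_ge0 => i _; apply: sumr_ge0 => j _; rewrite sqr_ge0.
have -> : \sum_i \sum_j (a i * b j - a j * b i) ^+ 2 =
    2 * ((\sum_i a i ^+ 2) * (\sum_i b i ^+ 2)) - 2 * (\sum_i a i * b i) ^+ 2.
  have e (f g : I -> R) : (\sum_i f i) * (\sum_i g i) = \sum_i \sum_j f i * g j.
    by rewrite big_distrl; apply: eq_bigr => i _; rewrite big_distrr.
  rewrite [2 * (_ * _)]mulr_natl mulr2n.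
  rewrite {2}[_ * (\sum_i b i ^+ 2)]mulrC expr2 !e mulr_sumr -sumrN.
  rewrite -!big_split /=; apply: eq_bigr => i _.
  rewrite mulr_sumr -sumrN -!big_split /=; apply: eq_bigr => j _; ring.
by rewrite subr_ge0 ler_pM2l.
Qed.

(** Group the terms by the value of [f]: the squares of the sizes of the fibres
    add up to the number of collisions. *)
Lemma cauchy_schwarz_collisions (T Y : finType) (f : T -> Y) (w : Y -> R) :
  (\sum_t w (f t)) ^+ 2 <=
    (\sum_y w y ^+ 2) * (\sum_t \sum_u ((f t == f u)%:R)).
Proof.
pose nu y := \sum_t (f t == y)%:R : R.
have -> : \sum_t w (f t) = \sum_y w y * nu y.
  rewrite (partition_big f predT) //=; apply: eq_bigr => y _.
  rewrite /nu mulr_sumr big_mkcond; apply: eq_bigr => t _.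
  by case: eqP => [->|_]; rewrite ?mulr1 ?mulr0.
apply: le_trans (cauchy_schwarz_sum _ _) _.
rewrite le_eqVlt; apply/orP; left; apply/eqP; congr (_ * _).
transitivity (\sum_y \sum_t \sum_u ((f t == y)%:R * (f u == y)%:R : R)).
  apply: eq_bigr => y _; rewrite expr2 /nu big_distrl; apply: eq_bigr => t _.
  by rewrite big_distrr.
rewrite exchange_big; apply: eq_bigr => t _; rewrite exchange_big.
apply: eq_bigr => u _ /=; rewrite (bigD1 (f t)) //= eqxx mul1r big1 ?addr0 => [|y yt].
  by rewrite eq_sym.
by rewrite eq_sym (negbTE yt) mul0r.
Qed.

End CauchySchwarz.

Section Energy.
Variable R : realFieldType.
Variable p : nat.
Hypothesis pr : prime p.

Lemma natF_inj (x y : nat) : (x < p)%N -> (y < p)%N ->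
  x%:R = y%:R :> 'F_p -> x = y.
Proof.
move=> xp yp /(congr1 val) /=.
by rewrite !val_Fp_nat // !modn_small.
Qed.

Lemma natF_neq0 (x : nat) : (0 < x < p)%N -> x%:R != 0 :> 'F_p.
Proof.
move=> /andP[x0 xp]; apply/eqP => /(natF_inj xp (prime_gt0 pr)) e.
by rewrite e in x0.
Qed.

Lemma sum_multiples (g A : nat) (f : nat -> R) : (0 < g)%N ->
  \sum_(1 <= a < A.+1) (g %| a)%:R * f a =
  \sum_(1 <= u < (A %/ g).+1) f (g * u)%N.
Proof.
move=> g0; elim: A => [|A IH]; first by rewrite div0n !big_geq.
rewrite big_nat_recr //= IH divnS //; case: (boolP (g %| A.+1)%N) => gA /=.
  rewrite add1n [RHS]big_nat_recr //= mul1r; congr (_ + f _).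
  have := divnK gA; rewrite divnS // gA add1n => <-; exact: mulnC.
by rewrite mul0r addr0 add0n.
Qed.

(** Bound [gcdn a c] by the sum of the common divisors of [a] and [c]. *)
Lemma sum_gcd_ratio A :
  \sum_(1 <= a < A.+1) \sum_(1 <= c < A.+1) (gcdn a c)%:R / c%:R
    <= A%:R * harmonic_sum R A ^+ 2.
Proof.
set H := harmonic_sum R A.
apply: (@le_trans _ _ (\sum_(1 <= a < A.+1) \sum_(1 <= c < A.+1)
   \sum_(1 <= g < A.+1) (g %| a)%:R * ((g %| c)%:R * (g%:R / c%:R)))).
  rewrite big_nat [leRHS]big_nat; apply: ler_sum => a /andP[a1 aA].
  rewrite big_nat [leRHS]big_nat; apply: ler_sum => c /andP[c1 cA].
  have gr : gcdn a c \in index_iota 1 A.+1.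
    rewrite mem_index_iota gcdn_gt0 a1 /= (leq_trans _ aA) // ltnS dvdn_leq //.
    exact: dvdn_gcdl.
  rewrite (bigD1_seq _ gr) ?iota_uniq //= dvdn_gcdl dvdn_gcdr !mul1r lerDl.
  by apply: sumr_ge0 => g _; rewrite !mulr_ge0 ?invr_ge0.
under eq_bigr do rewrite exchange_big /=.
rewrite exchange_big /=.
apply: (@le_trans _ _ (\sum_(1 <= g < A.+1) (A%:R * g%:R^-1) * H)); last first.
  by rewrite -mulr_suml -mulr_sumr expr2 mulrA.
rewrite big_nat [leRHS]big_nat; apply: ler_sum => g /andP[g1 gA].
under eq_bigr do rewrite -mulr_sumr.
rewrite -mulr_suml; apply: ler_pM.
- by apply: sumr_ge0 => i _.
- by apply: sumr_ge0 => i _; rewrite !mulr_ge0 ?invr_ge0.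
- under eq_bigr do rewrite -[(g %| _)%:R]mulr1.
  rewrite (sum_multiples A (fun=> 1)) // sumr_const_nat subn1 /=.
  rewrite -[1 *+ _]/(_%:R) ler_pdivlMr ?ltr0n // -natrM ler_nat.
  exact: leq_trunc_div.
- rewrite (sum_multiples A (fun c => g%:R / c%:R)) //.
  apply: (@le_trans _ _ (harmonic_sum R (A %/ g))); last first.
    by apply: harmonic_sum_mono; exact: leq_div.
  rewrite /harmonic_sum big_nat [leRHS]big_nat; apply: ler_sum => u /andP[u1 _].
  by rewrite natrM invfM mulrA mulfV ?mul1r // pnatr_eq0 -lt0n.
Qed.

(** Two collisions with the same slopes [a, c] satisfy an equality of integers,
    since both sides are smaller than [p]; it forces a congruence modulo
    [c / gcd a c]. *)
Lemma card_collisions (A N : nat) (n0 : 'F_p) (a c : nat) :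
  (0 < a <= A)%N -> (0 < c <= A)%N -> (2 * A * N <= p)%N ->
  (#|[pred ij : 'I_N * 'I_N |
      ((n0 + ij.1%:R) * c%:R == (n0 + ij.2%:R) * a%:R :> 'F_p)%R]|
    <= N %/ (c %/ gcdn a c) + 1)%N.
Proof.
move=> /andP[a0 aA] /andP[c0 cA] hp.
set g := gcdn a c; set v := (c %/ g)%N; set u := (a %/ g)%N.
have g0 : (0 < g)%N by rewrite gcdn_gt0 a0.
have ea : a = (g * u)%N by rewrite mulnC divnK ?dvdn_gcdl.
have ec : c = (g * v)%N by rewrite mulnC divnK ?dvdn_gcdr.
have v0 : (0 < v)%N by rewrite lt0n; apply: contraTneq c0 => e; rewrite ec e muln0.
have uv : coprime v u.
  rewrite /coprime -(eqn_pmul2l g0) muln1 muln_gcdr -ec -ea gcdnC; exact: eqxx.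
pose f (ij : 'I_N * 'I_N) : 'I_(N %/ v).+1 := inord (ij.2 %/ v).
rewrite addn1 -[X in (_ <= X)%N]card_ord.
rewrite -(@card_in_image _ _ f) ?max_card // => -[i i'] [j j'].
rewrite !inE /= => /eqP e1 /eqP e2 ff.
have qq : (i' %/ v = j' %/ v)%N.
  have := congr1 val ff.
  by rewrite /f /= !inordK // ltnS leq_div2r // ltnW.
have lt (x y : 'I_N) (s t : nat) : (s <= A)%N -> (t <= A)%N -> (s * x + t * y < p)%N.
  move=> sA tA; apply: (@leq_trans (2 * A * N)%N) => //.
  have N0 : (0 < N)%N by apply: leq_ltn_trans (ltn_ord x).
  have A0 : (0 < A)%N by apply: leq_trans aA.
  have h1 : (s * x <= A * N.-1)%N by rewrite leq_mul // -ltnS prednK.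
  have h2 : (t * y <= A * N.-1)%N by rewrite leq_mul // -ltnS prednK.
  have eN : (A * N = A * N.-1 + A)%N by rewrite -mulnSr prednK.
  rewrite -mulnA eN; lia.
have e : (c * i + a * j' = c * j + a * i')%N.
  apply: natF_inj; [exact: lt | exact: lt|].
  rewrite !natrD !natrM.
  have -> : c%:R * i%:R + a%:R * j'%:R =
     ((n0 + i%:R) * c%:R - n0 * c%:R) + ((n0 + j'%:R) * a%:R - n0 * a%:R) :> 'F_p by ring.
  by rewrite e1 -e2; ring.
have {}e : (v * i + u * j' = v * j + u * i')%N.
  by apply/eqP; rewrite -(eqn_pmul2l g0) !mulnDr !mulnA -ea -ec e.
have mm : (i' = j' %[mod v])%N.
  have : (v * i + u * j' = v * j + u * i' %[mod v])%N by rewrite e.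
  rewrite ![(v * _)%N]mulnC !modnMDl => /eqP.
  wlog: i' j' {e e1 e2 ff qq} / (i' <= j')%N.
    move=> h; case/orP: (leq_total i' j') => [|l]; first exact: h.
    by rewrite eq_sym => /(h _ _ l).
  move=> l; rewrite eqn_mod_dvd ?leq_mul2l ?l ?orbT // -mulnBr Gauss_dvdr //.
  by rewrite -eqn_mod_dvd // eq_sym => /eqP.
have ij' : i' = j' by apply: val_inj; rewrite /= (divn_eq i' v) (divn_eq j' v) qq mm.
move: e; rewrite ij' => /addIn /eqP; rewrite eqn_pmul2l // => /eqP/val_inj ->.
by [].
Qed.

(** Each pair of denominators contributes at most 1 plus [N] times [gcdn a c / c],
    so that the fractions [(n0 + i) / a] are nearly distinct on average. *)
Lemma energy_bound (A N : nat) (n0 : 'F_p) (x : 'I_A * 'I_N -> 'F_p) :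
  (forall t, x t = (n0 + t.2%:R) / t.1.+1%:R) -> (2 * A * N <= p)%N ->
  \sum_t \sum_u ((x t == x u)%:R : R) <=
    A%:R ^+ 2 + A%:R * N%:R * harmonic_sum R A ^+ 2.
Proof.
move=> xE hp.
have [N0|N0] := posnP N.
  rewrite big1 => [|[a i] _]; first by rewrite addr_ge0 ?mulr_ge0 ?exprn_ge0 ?harmonic_sum_ge0.
  by have := ltn_ord i; rewrite {2}N0.
have Ap (a : 'I_A) : (0 < a.+1 < p)%N.
  have := ltn_ord a; have := leq_pmulr (2 * A) N0; lia.
apply: (@le_trans _ _ (\sum_(a : 'I_A) \sum_(c : 'I_A)
    (1 + N%:R * ((gcdn a.+1 c.+1)%:R / c.+1%:R)))).
  have -> : \sum_t \sum_u ((x t == x u)%:R : R) = \sum_(a < A) \sum_(i < N)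
      \sum_(c < A) \sum_(j < N) (x (a, i) == x (c, j))%:R.
    rewrite [RHS]pair_bigA /=; apply: eq_bigr => -[a i] _.
    by rewrite [RHS]pair_bigA /=; apply: eq_bigr => -[c j] _.
  apply: ler_sum => a _.
  rewrite exchange_big /=; apply: ler_sum => c _.
  rewrite pair_bigA /=.
  apply: (@le_trans _ _ (N %/ (c.+1 %/ gcdn a.+1 c.+1) + 1)%:R).
    have := @card_collisions A N n0 a.+1 c.+1 (ltn_ord a) (ltn_ord c) hp.
    rewrite -(ler_nat R) -sum1_card natr_sum; apply: le_trans.
    rewrite [leRHS]big_mkcond /=; apply: ler_sum => ij _ /=; rewrite inE !xE /=.
    rewrite eqr_div ?natF_neq0 ?Ap //.
    by case: eqP.
  rewrite natrD addrC lerD2l.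
  have d0 : (0 < c.+1 %/ gcdn a.+1 c.+1)%N.
    by rewrite divn_gt0 ?gcdn_gt0 // dvdn_leq // dvdn_gcdr.
  have -> : (gcdn a.+1 c.+1)%:R / c.+1%:R = (c.+1 %/ gcdn a.+1 c.+1)%:R^-1 :> R.
    rewrite -{2}(divnK (dvdn_gcdr a.+1 c.+1)) natrM invfM mulrCA mulfV ?mulr1 //.
    by rewrite pnatr_eq0 -lt0n gcdn_gt0.
  rewrite ler_pdivlMr ?ltr0n // -natrM ler_nat; exact: leq_trunc_div.
under eq_bigr do rewrite big_split /= sumr_const card_ord -mulr_sumr.
rewrite big_split /= sumr_const card_ord -mulr_sumr -[_ *+ A]mulr_natr -expr2 lerD2l.
rewrite [A%:R * _]mulrC -mulrA ler_wpM2l //.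
apply: le_trans (sum_gcd_ratio A).
rewrite big_add1 /= big_mkord; apply: ler_sum => a _.
by rewrite big_add1 /= big_mkord.
Qed.

End Energy.

(** * Short mixed sums with a nontrivial multiplicative character *)

Section ShiftsAndRounding.
Variable R : rcfType.
Local Notation C := (R[i]).

Lemma leq_expn2r (m n k : nat) : (m <= n)%N -> (m ^ k <= n ^ k)%N.
Proof. by move=> mn; elim: k => // k IH; rewrite !expnS leq_mul. Qed.

Lemma shift_sum (u : nat -> C) (N h : nat) : (forall i, abs (u i) <= 1) ->
  abs (\sum_(i < N) u i - \sum_(i < N) u (i + h)%N) <= (2 * h)%:R.
Proof.
move=> u1; elim: h => [|h IH].
  rewrite muln0 (eq_bigr (fun i : 'I_N => u (i + 0)%N)) => [|i _]; last by rewrite addn0.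
  by rewrite subrr abs0.
set S := \sum_(i < N) u i; set S1 := \sum_(i < N) u (i + h)%N in IH.
set S2 := \sum_(i < N) _.
have -> : S - S2 = (S - S1) + (S1 - S2) by ring.
apply: le_trans (absD _ _) _; rewrite mulnS addnC natrD lerD //.
have e : u h + S2 = S1 + u (N + h)%N.
  transitivity (\sum_(i < N.+1) u (i + h)%N).
    rewrite big_ord_recl; congr (_ + _); apply: eq_bigr => i _.
    by rewrite /= /bump /= add1n addSnnS.
  by rewrite big_ord_recr.
have -> : S1 - S2 = u h - u (N + h)%N.
  by apply/eqP; rewrite subr_eq addrAC e addrK.
by apply: le_trans (absB _ _) _; rewrite (_ : 2 = 1 + 1) // lerD ?u1.
Qed.

Variables (p : nat) (psi : 'F_p -> C).
Hypotheses (pr : prime p) (psiP : additive_char psi).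
Hypothesis psi1 : abs (psi 1 - 1) <= 8 / p%:R.

Lemma psi_nat_near1 (n : nat) : abs (psi n%:R - 1) <= n%:R * (8 / p%:R).
Proof.
elim: n => [|n IH]; first by rewrite (psi0 psiP) subrr abs0 mul0r.
rewrite -[X in psi X]natr1 -[X in _ <= X * _]natr1 (psiD psiP) [leRHS]mulrDl mul1r.
have -> : psi n%:R * psi 1 - 1 = psi n%:R * (psi 1 - 1) + (psi n%:R - 1) by ring.
apply: le_trans (absD _ _) _.
by rewrite addrC absM (abs_psi psiP) mul1r lerD.
Qed.

Let pp : 0 < p%:R :> R.
Proof. by rewrite ltr0n prime_gt0. Qed.

(** The values of a polynomial phase whose coefficients are multiples of a
    fixed step close to [p / M]. *)
Definition grid_phase (D M : nat) (k : {ffun 'I_D -> 'I_M}) (t : nat) : 'F_p :=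
  \sum_(j < D) (k j * (p %/ M).+1)%:R * t%:R ^+ j.

(** Rounding the coefficients moves the phase by little on a short interval, so
    finitely many phases represent all polynomials of bounded degree. *)
Lemma grid_phase_approx D M B (Q : {poly 'F_p}) :
  (0 < M <= p)%N -> (size Q <= D)%N ->
  exists k : {ffun 'I_D -> 'I_M}, forall t, (t < B)%N ->
    abs (psi Q.[t%:R] - psi (grid_phase k t)) <= (16 * D * B ^ D)%:R / M%:R.
Proof.
move=> /andP[M0 Mp] szQ; pose s := (p %/ M).+1.
have [M' eM] : exists M', M = M'.+1 by exists M.-1; rewrite prednK.
pose c (j : nat) : nat := Q`_j.
have cs j : (c j %/ s < M)%N.
  rewrite ltn_divLR // /s mulnS.
  have cp : (c j < p)%N by rewrite -[X in (_ < X)%N](Fp_cast pr) ltn_ord.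
  by rewrite {1}(divn_eq p M) in cp; have := ltn_pmod p M0; lia.
exists [ffun j : 'I_D => Ordinal (cs j)] => t tB.
pose tau := (\sum_(j < D) (c j %% s) * t ^ j)%N.
have e : Q.[t%:R] = grid_phase [ffun j : 'I_D => Ordinal (cs j)] t + tau%:R.
  rewrite (horner_coef_wide _ szQ) /grid_phase /tau natr_sum -big_split /=.
  apply: eq_bigr => j _; rewrite ffunE /= -/s [(_ * t ^ j)%:R]natrM natrX.
  rewrite -mulrDl -natrD -divn_eq.
  by rewrite /c natr_Zp.
rewrite e (psiD psiP) -[X in _ - X]mulr1 -mulrBr absM (abs_psi psiP) mul1r.
apply: le_trans (psi_nat_near1 _) _.
have tb : (tau <= D * (s * B ^ D))%N.
  rewrite -[X in (_ <= X * _)%N]card_ord -sum_nat_const; apply: leq_sum => j _.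
  apply: leq_mul.
    exact: (ltnW (ltn_pmod (c j) (isT : 0 < s)%N)).
  have B0 : (0 < B)%N by apply: leq_ltn_trans tB.
  apply: leq_trans (_ : (B ^ j <= _)%N); first by rewrite leq_expn2r // ltnW.
  by rewrite leq_pexp2l // ltnW.
have sb : s%:R <= 2 * p%:R / M%:R :> R.
  rewrite ler_pdivlMr ?ltr0n // -!natrM ler_nat /s mulSn.
  by rewrite mul2n -addnn leq_add // leq_trunc_div.
apply: (@le_trans _ _ ((D * (s * B ^ D))%:R * (8 / p%:R))).
  by rewrite ler_wpM2r ?divr_ge0 ?ler0n // ler_nat.
have -> : (16 * D * B ^ D)%:R / M%:R =
    (D%:R * (B ^ D)%:R) * ((2 * p%:R / M%:R) * (8 / p%:R)) :> R.
  rewrite !natrM; field; rewrite (lt0r_neq0 pp) /= pnatr_eq0 -lt0n M0 //.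
have -> : (D * (s * B ^ D))%:R * (8 / p%:R) =
    (D%:R * (B ^ D)%:R) * (s%:R * (8 / p%:R)) :> R by rewrite !natrM; ring.
rewrite ler_wpM2l ?mulr_ge0 ?ler0n //.
by rewrite ler_wpM2r ?divr_ge0 ?ler0n.
Qed.

End ShiftsAndRounding.

Section Burgess.
Variables (R : rcfType) (p : nat) (chi psi : 'F_p -> R[i]).
Hypotheses (pr : prime p) (chiP : mult_char chi) (psiP : additive_char psi).
Hypothesis psi1 : abs (psi 1 - 1) <= 8 / p%:R.

(** The points at which some grid phase correlates with the character on a
    range of length [B]. *)
Definition exceptional D M B (lam : R) : {set 'F_p} :=
  [set x | [exists k : {ffun 'I_D -> 'I_M},
     lam < abs (\sum_(t < B) psi (grid_phase p k t) * chi (x + (t : nat)%:R))]].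

(** Chebyshev's inequality for the moment of order [2 r.+1], for each of the
    [M ^ D] grid phases. *)
Lemma card_exceptional D M B r (lam zeta : R) :
  (B <= p)%N -> 0 <= lam -> 0 <= zeta ->
  gowers (r.*2.+1) chi <= zeta ^+ (2 ^ r.*2.+2) ->
  #|exceptional D M B lam|%:R * lam ^+ (r.+1 * 2) <=
    (M ^ D)%:R * (p%:R * ((B ^ r.+1 * r.+1 ^ (r.+1 * 2))%:R +
                          (B ^ (r.+1 * 2))%:R * (zeta + 2 / p%:R))).
Proof.
move=> Bp lam0 z0 hz.
pose V (k : {ffun 'I_D -> 'I_M}) x :=
  abs (\sum_(t < B) psi (grid_phase p k t) * chi (x + (t : nat)%:R)) ^+ (r.+1 * 2).
have V0 k x : 0 <= V k x by rewrite exprn_ge0 ?abs_ge0.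
apply: (@le_trans _ _ (\sum_x \sum_k V k x)).
  rewrite -[X in X%:R * _]sum1_card natr_sum mulr_suml [leLHS]big_mkcond.
  apply: ler_sum => x _; rewrite inE mul1r.
  case: ifP => [/existsP[k hk]|_]; last by apply: sumr_ge0.
  rewrite (bigD1 k) //= -[leLHS]addr0 lerD ?sumr_ge0 //.
  by rewrite lerXn2r ?nnegrE ?abs_ge0 // ltW.
rewrite exchange_big /=.
have -> : (M ^ D)%N = #|{: {ffun 'I_D -> 'I_M}}| by rewrite card_ffun !card_ord.
rewrite -[X in X%:R * _]sum1_card natr_sum mulr_suml; apply: ler_sum => k _.
rewrite mul1r.
have cF : #|'F_p|%:R = p%:R :> R by rewrite card_Fp.
have p0 : 0 < p%:R :> R by rewrite ltr0n prime_gt0.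
have tinj : injective (fun t : 'I_B => (t : nat)%:R : 'F_p).
  move=> s t /natF_inj e; apply: val_inj; apply: e => //=;
  by apply: leq_trans Bp.
have := short_sum_moment chiP (r := r) (zeta := zeta) tinj
  (a := fun t : 'I_B => psi (grid_phase p k t)) _ z0 hz.
rewrite /avg cF => /(_ (fun t => _)) h.
rewrite -ler_pdivrMl //; apply: h => t.
by rewrite (abs_psi psiP).
Qed.

(** Shifting the summation by [a * t] costs at most [2 A B]. As a function of
    [t], the shifted term is [chi (x + t)], with [x = (n0 + i) / a], times a
    polynomial phase; unless [x] is exceptional, the sum over [t] is small, and
    [x] is seldom exceptional because the fractions [x] have few collisions. *)
Lemma burgess_inequality D M (A B N : nat) (lam : R) (n0 : 'F_p) (Q : {poly 'F_p}) :
  (A < p)%N -> (0 < M <= p)%N -> (size Q <= D)%N -> (2 * A * N <= p)%N ->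
  0 <= lam ->
  (A * B)%:R * abs (\sum_(i < N) chi (n0 + (i : nat)%:R) * psi Q.[(i : nat)%:R]) <=
    (A * B)%:R * (2 * (A * B))%:R +
    (A * N)%:R * (lam + B%:R * ((16 * D * B ^ D)%:R / M%:R)) +
    B%:R * Num.sqrt (#|exceptional D M B lam|%:R *
      (A%:R ^+ 2 + A%:R * N%:R * harmonic_sum R A ^+ 2)).
Proof.
move=> Ap Mp szQ hAN lam0.
pose u (i : nat) := chi (n0 + i%:R) * psi Q.[i%:R].
have u1 i : abs (u i) <= 1.
  by apply: abs_le1M; rewrite ?(abs_chi_le1 chiP) ?(abs_psi psiP).
pose dlt : R := (16 * D * B ^ D)%:R / M%:R.
pose X := exceptional D M B lam.
pose x (t : 'I_A * 'I_N) : 'F_p := (n0 + t.2%:R) / t.1.+1%:R.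
set S := \sum_(i < N) _.
have a0 (a : 'I_A) : a.+1%:R != 0 :> 'F_p.
  by apply: natF_neq0 => //=; apply: leq_ltn_trans Ap.
have inner (a : 'I_A) (i : 'I_N) :
    abs (\sum_(t < B) u (i + a.+1 * t)%N) <=
      lam + B%:R * dlt + B%:R * (x (a, i) \in X)%:R.
  pose L : {poly 'F_p} := a.+1%:R *: 'X + (i : nat)%:R%:P.
  pose Q' := Q \Po L.
  have szQ' : (size Q' <= D)%N.
    have sl : (size L <= 2)%N.
      rewrite (leq_trans (size_polyD _ _)) // geq_max size_polyC.
      rewrite (leq_trans (size_scale_leq _ _)) ?size_polyX //; by case: eqP.
    have [Q0|Q0] := eqVneq Q 0; first by rewrite /Q' Q0 comp_poly0 size_poly0.
    apply: leq_trans (size_comp_poly_leq _ _) _.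
    have Q1 : (0 < size Q)%N by rewrite lt0n size_poly_eq0.
    apply: leq_trans szQ; rewrite -[leqRHS](prednK Q1) ltnS.
    by rewrite -[leqRHS]muln1 leq_mul2l; case: (size L) sl => [|[|[]]] //; rewrite ?orbT.
  have [k hk] := grid_phase_approx pr psiP psi1 B Mp szQ'.
  have ue (t : nat) : u (i + a.+1 * t)%N =
      chi a.+1%:R * (chi (x (a, i) + t%:R) * psi Q'.[t%:R]).
    rewrite /u mulrA -(chiM chiP) /x /=; congr (chi _ * psi _).
      by rewrite mulrDr mulrCA mulfV // mulr1 natrD natrM addrA.
    rewrite /Q' horner_comp (_ : L.[t%:R] = a.+1%:R * t%:R + i%:R); last by rewrite /L !hornerE.
    by rewrite -natrM -natrD addnC.
  under eq_bigr do rewrite ue.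
  rewrite -mulr_sumr absM (abs_chi chiP) // mul1r.
  have -> : \sum_(t < B) chi (x (a, i) + (t : nat)%:R) * psi Q'.[(t : nat)%:R] =
     \sum_(t < B) psi (grid_phase p k t) * chi (x (a, i) + (t : nat)%:R) +
     \sum_(t < B) chi (x (a, i) + (t : nat)%:R) *
        (psi Q'.[(t : nat)%:R] - psi (grid_phase p k t)).
    rewrite -big_split; apply: eq_bigr => t _ /=; ring.
  apply: le_trans (absD _ _) _.
  rewrite addrAC; apply: lerD; last first.
    apply: le_trans (abs_sum _ _ _) _.
    rewrite -[X in _ <= X%:R * _]card_ord mulr_natl -sumr_const; apply: ler_sum => t _.
    rewrite absM -[leRHS]mul1r ler_pM ?abs_ge0 ?(abs_chi_le1 chiP) //.
    exact: hk.
  have [xX|xX] := boolP (x (a, i) \in X).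
    rewrite mulr1 -[leLHS]add0r lerD //.
    apply: le_trans (abs_sum _ _ _) _.
    rewrite -[X in _ <= X%:R]card_ord -sumr_const; apply: ler_sum => t _.
    by apply: abs_le1M; rewrite ?(abs_chi_le1 chiP) ?(abs_psi psiP).
  rewrite mulr0 addr0 leNgt; apply: contra xX => h.
  by rewrite inE; apply/existsP; exists k.
have hit : \sum_t (x t \in X)%:R <= Num.sqrt (#|X|%:R *
      (A%:R ^+ 2 + A%:R * N%:R * harmonic_sum R A ^+ 2)).
  have s0 : 0 <= \sum_t (x t \in X)%:R :> R by apply: sumr_ge0.
  rewrite -[leLHS](ger0_norm s0) -sqrtr_sqr ler_sqrt; last first.
    by rewrite mulr_ge0 // addr_ge0 ?mulr_ge0 ?exprn_ge0 ?harmonic_sum_ge0.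
  apply: le_trans (cauchy_schwarz_collisions x (fun y => (y \in X)%:R)) _.
  apply: ler_pM.
  - by apply: sumr_ge0 => y _; rewrite sqr_ge0.
  - by apply: sumr_ge0 => y _; apply: sumr_ge0.
  - rewrite -[X in _ <= X%:R]sum1_card natr_sum [leRHS]big_mkcond.
    by apply: ler_sum => y _; case: (y \in X); rewrite ?expr1n ?expr0n.
  - exact: energy_bound.
have split_S : (A * B)%:R * S =
    \sum_(a < A) \sum_(t < B) (S - \sum_(i < N) u (i + a.+1 * t)%N) +
    \sum_(a < A) \sum_(i < N) \sum_(t < B) u (i + a.+1 * t)%N.
  rewrite -big_split /=.
  rewrite (eq_bigr (fun=> B%:R * S)) => [|a _].
    by rewrite sumr_const card_ord natrM -mulrA mulr_natl.
  rewrite [X in _ + X]exchange_big -big_split /=.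
  rewrite (eq_bigr (fun=> S)) => [|t _]; last by rewrite subrK.
  by rewrite sumr_const card_ord mulr_natl.
rewrite -[X in X * abs S](abs_nat R) -absM split_S.
apply: le_trans (absD _ _) _; rewrite -addrA; apply: lerD.
  apply: le_trans (abs_sum _ _ _) _.
  apply: (@le_trans _ _ (\sum_(a < A) \sum_(t < B) (2 * (A * B))%:R)); last first.
    by rewrite !sumr_const !card_ord -mulrnA mulr_natl [(B * A)%N]mulnC.
  apply: ler_sum => a _; apply: le_trans (abs_sum _ _ _) _.
  apply: ler_sum => t _; apply: le_trans (shift_sum N (a.+1 * t) u1) _.
  by rewrite ler_nat leq_mul2l leq_mul // ltnW.
apply: le_trans (abs_sum _ _ _) _.
apply: (@le_trans _ _ (\sum_(a < A) \sum_(i < N)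
    (lam + B%:R * dlt + B%:R * (x (a, i) \in X)%:R))).
  apply: ler_sum => a _; apply: le_trans (abs_sum _ _ _) _.
  by apply: ler_sum => i _; exact: inner.
under eq_bigr do rewrite big_split /= sumr_const card_ord -mulr_sumr.
rewrite big_split /= sumr_const card_ord -mulrnA [(A * N)%:R * _]mulr_natl.
rewrite [(N * A)%N]mulnC lerD2l.
rewrite -mulr_sumr ler_wpM2l //; apply: le_trans hit.
rewrite pair_bigA /= le_eqVlt; apply/orP; left; apply/eqP.
by apply: eq_bigr => -[a i].
Qed.

End Burgess.

(** The scale at which short sums are studied: [s] is about [sqrt p], savings
    are powers of [b], and [b] is a small power of [p], large enough to absorb
    logarithms. *)
Definition scale (R : rcfType) (m p b s : nat) : Prop :=
  [/\ (0 < b)%N, (b ^ m <= p)%N, harmonic_sum R p <= (b ^ 2)%:R,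
      (2 * s ^ 2 <= p)%N & (p <= 8 * s ^ 2)%N].

Lemma scale_weaken (R : rcfType) m m' p b s :
  (m <= m')%N -> scale R m' p b s -> scale R m p b s.
Proof.
move=> mm [b0 bm H s1 s2]; split=> //; apply: leq_trans bm.
by rewrite leq_pexp2l.
Qed.

Lemma scale_sqrt_ge (R : rcfType) k p b s :
  (0 < p)%N -> scale R (2 * k + 3) p b s -> (b ^ k <= s)%N.
Proof.
move=> p0 [b0 bm _ _ ps]; rewrite leqNgt; apply/negP => sb.
have [b1|b1] := leqP b 1.
  have b1' : b = 1%N by lia.
  move: sb; rewrite b1' exp1n ltnS leqn0 => /eqP s0.
  by rewrite s0 in ps; lia.
have s2 : (s ^ 2 < b ^ (2 * k))%N.
  by rewrite mulnC expnM ltn_exp2r.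
have b3 : (2 ^ 3 <= b ^ 3)%N by rewrite leq_exp2r.
have : (8 * b ^ (2 * k) <= p)%N.
  apply: leq_trans bm; rewrite expnD mulnC; exact: leq_mul.
lia.
Qed.

(** With [B = b ^ be], [A] about [s / b ^ k] and [M = B ^ D * b ^ e], the shifts
    [a * t] stay below [s / b ^ e] and the phases are rounded up to [b ^ - e].
    There are [M ^ D = b ^ T] grid phases, and the threshold [lam = B / b ^ e]
    exceeds the square root of [B] by a factor [b ^ (1 / 2)]; the moment of order
    [2 (T + W)] therefore leaves at most about [p / b ^ W] exceptional points. *)
Lemma burgess_short_sum (R : rcfType) (D e : nat) : exists m (K : R), 0 <= K /\
  forall (p : nat) (chi psi : 'F_p -> R[i]) (b s N : nat) (n0 : 'F_p) (Q : {poly 'F_p}),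
    prime p -> mult_char chi -> additive_char psi ->
    abs (psi 1 - 1) <= 8 / p%:R -> scale R m p b s ->
    (N <= s)%N -> (size Q <= D)%N ->
    abs (\sum_(i < N) chi (n0 + (i : nat)%:R) * psi Q.[(i : nat)%:R])
      <= K * s%:R / b%:R ^+ e.
Proof.
have le5 a1 a2 a3 a4 a5 (n := (a1 + a2 + a3 + a4 + a5)%N) :
    [/\ (a1 <= n)%N, (a2 <= n)%N, (a3 <= n)%N, (a4 <= n)%N & (a5 <= n)%N].
  by rewrite /n; split; lia.
have q1 T W : ((e + 1) * ((T + W) * 2) = (2 * e + 1) * (T + W) + T + W)%N by lia.
have q2 T W : ((2 * e + 1) * ((T + W) * 2) =
  (2 * e + 1) * (T + W) + (T + 2 * e * (T + W) + W))%N by lia.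
have q3 k : (2 * e + 4 + k = e * 2 + k + 4)%N by lia.
have q4 : (2 * e + 1 = e + 1 + e)%N by lia.
pose be := (2 * e + 1)%N; pose k := (e + be)%N.
pose T := ((be * D + e) * D)%N; pose W := (2 * e + 4 + k)%N.
pose r := (T + W).-1; have rE : r.+1 = (T + W)%N by rewrite prednK // /W; lia.
pose E := (T + 2 * e * (T + W) + W)%N.
pose P := (2 ^ r.*2.+2)%N; have P0 : (0 < P)%N by rewrite expn_gt0.
have [m1 [K1 [K10 decay]]] := gowers_chi_decay R r.*2.+1 (E * P).
pose K3 : R := 1 + K1 + 2.
pose c : R := (r.+1 ^ (r.+1 * 2))%:R.
pose K4 : R := 32 * (c + K3) + 1.
have c0 : 0 <= c by rewrite ler0n.
have K30 : 0 <= K3 by rewrite /K3; lra.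
have K40 : 1 <= K4 by rewrite /K4; lra.
exists (m1 + E + (be * D + e) + be + (2 * k + 3))%N, (2 + (1 + (16 * D)%:R) + K4).
split; first by have : 0 <= (16 * D)%:R :> R; [rewrite ler0n | lra].
move=> p chi psi b s N n0 Q pr chiP psiP psi1 sc Ns szQ.
have [b0 bm Hp s1 s2] := sc.
have pgt0 := prime_gt0 pr.
have [mm mE mM mB mk] := le5 m1 E (be * D + e)%N be (2 * k + 3)%N.
have pw i : (i <= m1 + E + (be * D + e) + be + (2 * k + 3))%N -> (b ^ i <= p)%N.
  by move=> h; apply: leq_trans bm; rewrite leq_pexp2l.
have sk : (b ^ k <= s)%N.
  apply: (@scale_sqrt_ge R k p b s pgt0); exact: scale_weaken mk sc.
pose x : R := b%:R; have x1 : 1 <= x by rewrite ler1n.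
have x0 : 0 < x by lra.
have xn0 i : x ^+ i != 0 by rewrite expf_neq0 // lt0r_neq0.
have xgt0 i : 0 < x ^+ i by rewrite exprn_gt0.
have pp : 0 < p%:R :> R by rewrite ltr0n.
pose B := (b ^ be)%N; pose A := (s %/ b ^ k)%N.
pose M := (B ^ D * b ^ e)%N; pose lam : R := x ^+ (e + 1).
have bk0 : (0 < b ^ k)%N by rewrite expn_gt0 b0.
have B0 : (0 < B)%N by rewrite expn_gt0 b0.
have BE : B%:R = x ^+ be :> R by rewrite natrX.
have A0 : (0 < A)%N by rewrite divn_gt0.
have As : (A <= s)%N by apply: leq_div.
have ss : (s <= s ^ 2)%N by rewrite -mulnn leq_pmulr // (leq_trans bk0).
have sp : (s < p)%N.
  apply: leq_trans s1; apply: leq_ltn_trans ss _.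
  by rewrite mul2n -addnn -[ltnLHS]addn0 ltn_add2l expn_gt0 (leq_trans bk0 sk).
have ME : M = (b ^ (be * D + e))%N by rewrite /M /B -expnM -expnD.
have M0 : (0 < M)%N by rewrite ME expn_gt0 b0.
have Mp : (M <= p)%N by rewrite ME pw.
have AN : (2 * A * N <= p)%N.
  by apply: leq_trans s1; rewrite -mulnA -mulnn leq_mul2l leq_mul.
have lam0 : 0 <= lam by exact: ltW (xgt0 _).
have AskR : A%:R * x ^+ k <= s%:R.
  by rewrite -natrX -natrM ler_nat leq_trunc_div.
have sAkR : s%:R <= 2 * (A%:R * x ^+ k).
  rewrite -natrX -!natrM ler_nat; have := ltn_ceil s bk0; rewrite -/A.
  have : (b ^ k <= A * b ^ k)%N by rewrite leq_pmull.
  rewrite mulSn mul2n -addnn => h1 h2; apply: ltnW; apply: leq_trans h2 _.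
  by rewrite leq_add2r.
have cX : #|exceptional chi psi D M B lam|%:R * x ^+ W <= p%:R * (c + K3).
  (* [1 + K1 >= 1], so the root of order [P] does not increase the constant. *)
  pose zeta : R := (1 + K1) / x ^+ E.
  have zeta0 : 0 <= zeta by rewrite divr_ge0 ?(ltW (xgt0 _)) //; lra.
  have hz : gowers (r.*2.+1) chi <= zeta ^+ (2 ^ r.*2.+2).
    have bm1 : x ^+ m1 <= #|'F_p|%:R.
      by rewrite card_Fp // -natrX ler_nat pw.
    apply: le_trans (decay _ _ _ _ chiP psiP x1 bm1) _.
    rewrite -/P /zeta expr_div_n -exprM ler_wpM2r ?invr_ge0 ?(ltW (xgt0 _)) //.
    apply: (@le_trans _ _ (1 + K1)); first lra.
    by apply: ler_eXnr => //; lra.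
  have Bp : (B <= p)%N by exact: pw.
  have := card_exceptional pr chiP psiP D M Bp lam0 zeta0 hz.
  have z3 : zeta + 2 / p%:R <= K3 / x ^+ E.
    rewrite /K3 [leRHS]mulrDl lerD2l ler_wpM2l // lef_pV2 ?posrE //.
    by rewrite -natrX ler_nat pw.
  set n := #|_|%:R.
  have -> : lam ^+ (r.+1 * 2) = x ^+ ((2 * e + 1) * (T + W)) * x ^+ T * x ^+ W.
    by rewrite /lam -exprM -!exprD rE q1.
  have -> : (M ^ D)%:R = x ^+ T by rewrite ME -expnM natrX.
  have -> : (B ^ r.+1 * r.+1 ^ (r.+1 * 2))%:R = x ^+ ((2 * e + 1) * (T + W)) * c.
    by rewrite natrM -/c /B -expnM rE natrX.
  have eB : (B ^ (r.+1 * 2))%:R / x ^+ E = x ^+ ((2 * e + 1) * (T + W)).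
    rewrite /B -expnM natrX -/x; apply: (mulIf (xn0 E)); rewrite divfK // -exprD.
    by rewrite rE /E /be q2.
  set y := x ^+ ((2 * e + 1) * (T + W)) in eB *.
  have y0 : 0 < y by exact: xgt0.
  move=> h; have {}h : n * (y * x ^+ T * x ^+ W) <=
      x ^+ T * (p%:R * (y * c + y * K3)).
    apply: le_trans h _; rewrite ler_wpM2l ?(ltW (xgt0 _)) // ler_wpM2l // lerD2l.
    apply: le_trans (ler_wpM2l (ler0n _ _) z3) _.
    by rewrite -eB [leRHS]mulrAC mulrA.
  rewrite -(ler_pM2l (mulr_gt0 y0 (xgt0 T))).
  have e1 : y * x ^+ T * (n * x ^+ W) = n * (y * x ^+ T * x ^+ W) by ring.
  have e2 : y * x ^+ T * (p%:R * (c + K3)) = x ^+ T * (p%:R * (y * c + y * K3)) by ring.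
  by rewrite e1 e2.
have root : Num.sqrt (#|exceptional chi psi D M B lam|%:R *
    (A%:R ^+ 2 + A%:R * N%:R * harmonic_sum R A ^+ 2)) <= K4 * (A%:R * s%:R) / x ^+ e.
  have z0 : 0 <= K4 * (A%:R * s%:R) / x ^+ e.
    by rewrite divr_ge0 ?(ltW (xgt0 _)) // mulr_ge0 ?mulr_ge0 ?ler0n //; lra.
  rewrite -[leRHS](ger0_norm z0) -sqrtr_sqr ler_sqrt ?sqr_ge0 //.
  have AsR : A%:R <= s%:R :> R by rewrite ler_nat.
  have NsR : N%:R <= s%:R :> R by rewrite ler_nat.
  have H2 : harmonic_sum R A ^+ 2 <= x ^+ 4.
    have h : harmonic_sum R A <= x ^+ 2.
      rewrite -natrX; apply: le_trans Hp; apply: harmonic_sum_mono.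
      by apply: leq_trans As (ltnW sp).
    by rewrite (exprM _ 2 2) lerXn2r ?nnegrE ?harmonic_sum_ge0 ?(ltW (xgt0 _)).
  have As0 : 0 <= A%:R * s%:R :> R by rewrite mulr_ge0.
  have en : A%:R ^+ 2 + A%:R * N%:R * harmonic_sum R A ^+ 2 <=
      2 * (A%:R * s%:R) * x ^+ 4.
    have -> : 2 * (A%:R * s%:R) * x ^+ 4 =
      (A%:R * s%:R) * x ^+ 4 + (A%:R * s%:R) * x ^+ 4 by ring.
    apply: lerD.
      rewrite expr2 -mulrA ler_wpM2l //; apply: le_trans AsR _.
      by rewrite ler_peMr // exprn_ege1.
    by apply: ler_pM; rewrite ?mulr_ge0 ?exprn_ge0 ?harmonic_sum_ge0 ?ler_wpM2l.
  have p16 : p%:R <= 16 * (A%:R * s%:R) * x ^+ k.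
    have : p%:R <= 8 * (s%:R * s%:R) :> R by rewrite -!natrM ler_nat mulnn.
    have : s%:R * s%:R <= s%:R * (2 * (A%:R * x ^+ k)) by rewrite ler_wpM2l.
    nra.
  set n := #|_|%:R in cX *.
  apply: le_trans (ler_wpM2l (ler0n _ _) en) _.
  have nW : n <= 16 * (A%:R * s%:R) * x ^+ k * (c + K3) / x ^+ W.
    rewrite ler_pdivlMr //; apply: le_trans cX _; rewrite ler_wpM2r //; lra.
  have en0 : 0 <= 2 * (A%:R * s%:R) * x ^+ 4.
    by rewrite mulr_ge0 ?mulr_ge0 ?(ltW (xgt0 _)).
  apply: le_trans (ler_wpM2r en0 nW) _.
  have -> : 16 * (A%:R * s%:R) * x ^+ k * (c + K3) / x ^+ W * (2 * (A%:R * s%:R) * x ^+ 4)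
      = 32 * (c + K3) * ((A%:R * s%:R) ^+ 2 / (x ^+ e) ^+ 2).
    have -> : x ^+ W = x ^+ e ^+ 2 * x ^+ k * x ^+ 4.
      by rewrite -exprM -!exprD /W q3.
    move: (x ^+ e) (x ^+ k) (x ^+ 4) (xn0 e) (xn0 k) (xn0 4%N) => u v w u0 v0 w0.
    by field; rewrite u0 v0 w0.
  rewrite [leRHS]exprMn [(K4 * _) ^+ 2]exprMn exprVn -[leRHS]mulrA ler_wpM2r //.
    by rewrite divr_ge0 ?sqr_ge0.
  have : K4 <= K4 ^+ 2 by rewrite expr2 ler_peMr //; lra.
  rewrite /K4; lra.
have Ap : (A < p)%N by apply: leq_ltn_trans sp.
have Mp' : (0 < M <= p)%N by rewrite M0.
have := burgess_inequality pr chiP psiP psi1 B n0 Ap Mp' szQ AN lam0.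
set S := abs _; move=> bi.
have ABgt0 : 0 < (A * B)%:R :> R by rewrite ltr0n muln_gt0 A0.
rewrite -(ler_pM2l ABgt0); apply: le_trans bi _.
have -> : (A * B)%:R * ((2 + (1 + (16 * D)%:R) + K4) * s%:R / x ^+ e) =
  (A * B)%:R * (2 * (s%:R / x ^+ e)) +
  (A%:R * s%:R) * (B%:R * (1 + (16 * D)%:R) / x ^+ e) +
  B%:R * (K4 * (A%:R * s%:R) / x ^+ e) by rewrite natrM; ring.
apply: lerD; last by rewrite ler_wpM2l.
apply: lerD.
  rewrite ler_wpM2l ?(ltW ABgt0) // natrM ler_wpM2l // ler_pdivlMr //.
  rewrite natrM BE -mulrA -exprD addnC; exact: AskR.
have -> : lam + B%:R * ((16 * D * B ^ D)%:R / M%:R) = B%:R * (1 + (16 * D)%:R) / x ^+ e.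
  rewrite mulrDr mulr1 mulrDl; congr (_ + _).
    rewrite /lam BE; apply: (mulIf (xn0 e)); rewrite divfK // -exprD.
    by rewrite /be q4.
  rewrite /M [(_ * B ^ D)%:R]natrM [(B ^ D * _)%:R]natrM natrX -/x natrX BE.
  move: (x ^+ e) (x ^+ be) (xn0 e) (xn0 be) => u v u0 v0.
  by field; rewrite u0 expf_neq0.
rewrite natrM ler_wpM2r //.
  by rewrite divr_ge0 ?(ltW (xgt0 _)) // mulr_ge0 // addr_ge0.
by rewrite ler_wpM2l // ler_nat.
Qed.

(** * Short sums of polynomial phases of degree at least three *)

Section Weyl.
Variables (R : rcfType) (p : nat) (psi : 'F_p -> R[i]).
Hypotheses (pr : prime p) (psiP : additive_char psi).
Hypothesis psi_far : forall n : nat, (0 < n)%N -> (2 * n <= p)%N ->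
  2 * n%:R / p%:R <= abs (psi n%:R - 1).
Implicit Types (f : nat -> 'F_p) (c : 'F_p).

(** Group the pairs of indices by their difference. *)
Lemma van_der_corput (u : nat -> R[i]) N : (forall i, abs (u i) <= 1) ->
  abs (\sum_(i < N) u i) ^+ 2 <= N%:R +
    2 * \sum_(h < N) abs (\sum_(i < N - h.+1) u (i + h.+1)%N * (u i)^*%C).
Proof.
move=> u1; pose a i j := u i * (u j)^*%C.
have dbl M : \sum_(i < M) \sum_(j < M) a i j = \sum_(i < M) a i i +
    \sum_(h < M) \sum_(i < M - h.+1) (a (i + h.+1)%N i + a i (i + h.+1)%N).
  elim: M => [|M IH]; first by rewrite !big_ord0 addr0.
  rewrite big_ord_recr /= (eq_bigr (fun i : 'I_M => \sum_(j < M) a i j + a i M)).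
    rewrite big_split /= IH big_ord_recr /= [\sum_(i < M.+1) a i i]big_ord_recr /=.
    have -> : \sum_(h < M.+1) \sum_(i < M.+1 - h.+1) (a (i + h.+1)%N i + a i (i + h.+1)%N)
       = \sum_(h < M) \sum_(i < M - h.+1) (a (i + h.+1)%N i + a i (i + h.+1)%N) +
         \sum_(h < M) (a M h + a h M).
      rewrite big_ord_recr /= subnn big_ord0 addr0.
      rewrite [X in _ + X](reindex_inj rev_ord_inj) /= -big_split /=.
      apply: eq_bigr => h _; have hM := ltn_ord h.
      by rewrite subSS -(subnSK hM) big_ord_recr /= subnK.
    rewrite big_split /=; set X := \sum_(h < M) \sum_(i < _) _; ring.
  by move=> i _; rewrite big_ord_recr.
have E : (abs (\sum_(i < N) u i) ^+ 2)%:C = \sum_(i < N) \sum_(j < N) a i j.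
  rewrite -mulcJ_abs rmorph_sum mulr_suml; apply: eq_bigr => i _.
  by rewrite mulr_sumr.
rewrite -(abs_real (sqr_ge0 _)) E dbl.
apply: le_trans (absD _ _) _; apply: lerD.
  apply: le_trans (abs_sum _ _ _) _.
  rewrite -[X in _ <= X%:R]card_ord -sumr_const; apply: ler_sum => i _.
  by apply: abs_le1M; rewrite ?absJ.
apply: le_trans (abs_sum _ _ _) _; rewrite mulr_sumr; apply: ler_sum => h _.
rewrite big_split /=; apply: le_trans (absD _ _) _.
have -> : \sum_(i < N - h.+1) a i (i + h.+1)%N =
    (\sum_(i < N - h.+1) u (i + h.+1)%N * (u i)^*%C)^*%C.
  by rewrite rmorph_sum; apply: eq_bigr => i _; rewrite /a rmorphM /= conjcK mulrC.
by rewrite absJ mulr_natl mulr2n.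
Qed.

(** Polynomial functions of degree [d], seen through their iterated differences;
    [c] is [d!] times the coefficient of degree [d]. *)
Fixpoint poly_phase d c f : Prop :=
  if d is d'.+1 then
    forall h : nat, poly_phase d' (c * h%:R) (fun i => f (i + h)%N - f i)
  else forall i, f i = c.

Lemma psi_van_der_corput f N :
  abs (\sum_(i < N) psi (f i)) ^+ 2 <= N%:R +
    2 * \sum_(h < N) abs (\sum_(i < N - h.+1) psi (f (i + h.+1)%N - f i)).
Proof.
have := @van_der_corput (fun i => psi (f i)) N.
move=> /(_ (fun i => _)) h; apply: le_trans (h _) _ => [i|].
  by rewrite (abs_psi psiP).
rewrite lerD2l ler_pM2l //; apply: ler_sum => k _.
rewrite le_eqVlt; apply/orP; left; apply/eqP; congr abs.
by apply: eq_bigr => i _; rewrite (psiD psiP) (psiN psiP).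
Qed.

(** The bound for a geometric sum of at most [s] terms with slope [c]. *)
Definition geometric_weight (s : nat) c : R :=
  if c == 0 then s%:R else Num.min s%:R (2 / abs (psi c - 1)).

Lemma psi_neq1 c : c != 0 -> 0 < abs (psi c - 1).
Proof.
move=> c0; rewrite lt_neqAle abs_ge0 andbT eq_sym abs_eq0 subr_eq0.
apply/eqP => e; have := avg_psi psiP c; rewrite (negbTE c0).
have aux n : psi (n%:R * c) = 1.
  elim: n => [|n IH]; first by rewrite mul0r (psi0 psiP).
  by rewrite -natr1 mulrDl mul1r (psiD psiP) IH e mul1r.
rewrite (@eq_avg _ _ _ (fun=> 1)) ?avg_const => [/eqP|x]; first by rewrite oner_eq0.
by rewrite -[x]natr_Zp aux.
Qed.

Lemma linear_phase_sum c f N s : poly_phase 1 c f -> (N <= s)%N ->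
  abs (\sum_(i < N) psi (f i)) <= geometric_weight s c.
Proof.
move=> lin Ns.
have triv : abs (\sum_(i < N) psi (f i)) <= s%:R.
  apply: (@le_trans _ _ N%:R); last by rewrite ler_nat.
  apply: le_trans (abs_sum _ _ _) _.
  rewrite -[X in _ <= X%:R]card_ord -sumr_const; apply: ler_sum => i _.
  by rewrite (abs_psi psiP).
rewrite /geometric_weight; case: ifPn => // c0.
rewrite le_min triv /= ler_pdivlMr ?psi_neq1 // -absM.
have -> : (\sum_(i < N) psi (f i)) * (psi c - 1) = psi (f N) - psi (f 0%N).
  elim: N {Ns triv} => [|N IH]; first by rewrite big_ord0 mul0r subrr.
  rewrite big_ord_recr /= mulrDl IH mulrBr mulr1 -(psiD psiP).
  have := lin 1%N N; rewrite mulr1 addn1 => <-; rewrite addrC [f N + _]addrC subrK.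
  by ring.
apply: le_trans (absB _ _) _.
by rewrite !(abs_psi psiP) -mulr2n.
Qed.

(** The slopes at distance [n] from 0 have weight at most [p / n]. *)
Lemma geometric_weight_sum s :
  \sum_c geometric_weight s c ^+ 2 <= s%:R ^+ 2 + 2 * (s%:R * p%:R * harmonic_sum R p).
Proof.
have pp : 0 < p%:R :> R by rewrite ltr0n prime_gt0.
have w c : c != 0 -> geometric_weight s c ^+ 2 <=
    s%:R * p%:R * ((c : nat)%:R^-1 + (p - c)%N%:R^-1).
  move=> c0; rewrite /geometric_weight (negbTE c0).
  have cp : (c < p)%N by rewrite -[X in (_ < X)%N](Fp_cast pr) ltn_ord.
  have cn0 : (0 < c)%N by rewrite lt0n; apply: contra c0 => /eqP h; apply/eqP/val_inj.
  have q0 : 0 <= 2 / abs (psi c - 1) by rewrite divr_ge0 ?abs_ge0.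
  set q := 2 / _ in q0 *.
  have qb : q <= p%:R * ((c : nat)%:R^-1 + (p - c)%N%:R^-1).
    have aux n : (0 < n)%N -> (2 * n <= p)%N -> abs (psi n%:R - 1) = abs (psi c - 1) ->
        q <= p%:R * n%:R^-1.
      move=> n0 hn e; rewrite /q ler_pdivrMr ?psi_neq1 // -e.
      have := psi_far n0 hn; rewrite ler_pdivrMr //.
      have nn : n%:R != 0 :> R by rewrite pnatr_eq0 -lt0n.
      have npos : 0 < n%:R :> R by rewrite ltr0n.
      move=> h; rewrite mulrAC ler_pdivlMr // [p%:R * _]mulrC; exact: h.
    have [h|h] := leqP (2 * c) p.
      apply: le_trans (aux c cn0 h _) _; first by rewrite natr_Zp.
      by rewrite ler_pM2l // lerDl invr_ge0.
    apply: le_trans (aux (p - c)%N _ _ _) _.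
    - by rewrite subn_gt0.
    - lia.
    - have -> : (p - c)%N%:R = - c :> 'F_p.
        by rewrite natrB ?(ltnW cp) // natr_Zp pchar_Fp_0 // add0r.
      by rewrite (psiN psiP) -[RHS]absJ rmorphB rmorph1.
    - by rewrite ler_pM2l // lerDr invr_ge0.
  rewrite expr2 -[leRHS]mulrA; apply: ler_pM.
  - by rewrite le_min ler0n.
  - by rewrite le_min ler0n.
  - by rewrite ge_min lexx.
  - by apply: le_trans qb; rewrite ge_min lexx orbT.
rewrite (bigD1 0) //= {1}/geometric_weight eqxx lerD2l.
apply: (@le_trans _ _ (\sum_(c : 'F_p | c != 0)
   s%:R * p%:R * ((c : nat)%:R^-1 + (p - c)%N%:R^-1))).
  by apply: ler_sum => c; exact: w.
rewrite -mulr_sumr mulrCA ler_wpM2l ?mulr_ge0 //.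
have E (g : nat -> R) : \sum_(c : 'F_p | c != 0) g c = \sum_(1 <= i < p) g i.
  transitivity (\sum_(i < p | i != 0 :> nat) g i).
    rewrite (reindex (cast_ord (Fp_cast pr))) /=; first by apply: eq_bigl.
    by exists (cast_ord (esym (Fp_cast pr))) => i _; rewrite ?cast_ordK ?cast_ordKV.
  rewrite -(big_mkord (fun i => i != 0%N)) big_ltn_cond ?prime_gt0 //=.
  by rewrite big_nat_cond [RHS]big_nat_cond; apply: eq_bigl => i; case: i.
have Hp : \sum_(1 <= i < p) i%:R^-1 <= harmonic_sum R p.
  by rewrite /harmonic_sum big_nat_recr ?prime_gt0 //= lerDl invr_ge0.
rewrite big_split /= (E (fun i => i%:R^-1)) (E (fun i => (p - i)%N%:R^-1)).
rewrite [X in _ + X]big_nat_rev /= mulr_natl mulr2n lerD //.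
apply: le_trans Hp; rewrite le_eqVlt; apply/orP; left; apply/eqP.
rewrite big_nat [RHS]big_nat; apply: eq_bigr => i /andP[i0 ip].
by congr (_%:R^-1); lia.
Qed.

End Weyl.

Section PolynomialDifferences.
Variable p : nat.

Lemma eq_poly_phase d (c c' : 'F_p) f g :
  c = c' -> f =1 g -> poly_phase d c f -> poly_phase d c' g.
Proof.
move=> <- {c'}; elim: d c f g => [|d IH] c f g e /=; first by move=> h i; rewrite -e.
by move=> h k; apply: IH (h k) => i; rewrite !e.
Qed.

(** By induction on the degree, writing the polynomial as [Q * 'X + c]. *)
Lemma difference_poly d (Q : {poly 'F_p}) h : (size Q <= d.+2)%N ->
  exists Q' : {poly 'F_p}, [/\ (size Q' <= d.+1)%N,
    Q'`_d = d.+1%:R * h * Q`_d.+1 & forall x, Q'.[x] = Q.[x + h] - Q.[x]].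
Proof.
elim: d Q => [|d IH] Q; elim/poly_ind: Q => [|Q c _] szQ.
- by exists 0; rewrite size_poly0 !coef0 mulr0; split=> // x; rewrite !horner0 subrr.
- have szQ1 : (size Q <= 1)%N.
    by move: szQ; rewrite size_MXaddC; case: ifP => [/andP[/eqP -> _]|_]; rewrite ?size_poly0.
  rewrite (size1_polyC szQ1) coefD coefMX coefC /= coefC /= addr0.
  exists (h * Q`_0)%:P; split; first by rewrite size_polyC; case: eqP.
    by rewrite coefC mul1r.
  by move=> x; rewrite !hornerE; ring.
- by exists 0; rewrite size_poly0 !coef0 mulr0; split=> // x; rewrite !horner0 subrr.
have szQ1 : (size Q <= d.+2)%N.
  by move: szQ; rewrite size_MXaddC; case: ifP => [/andP[/eqP -> _]|_]; rewrite ?size_poly0.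
have [Q1 [sz1 c1 e1]] := IH Q szQ1.
exists (Q1 * ('X + h%:P) + h *: Q); split.
- rewrite (leq_trans (size_polyD _ _)) // geq_max; apply/andP; split.
    apply: leq_trans (size_polyMleq _ _) _; rewrite size_XaddC addnC /=; exact: sz1.
  exact: leq_trans (size_scale_leq _ _) szQ1.
- rewrite coefD mulrDr coefD coefMX coefMC coefZ /= c1 coefD coefMX coefC /= addr0.
  have -> : Q1`_d.+1 = 0 by apply: nth_default.
  by rewrite -[d.+2%:R]natr1; ring.
- move=> x; rewrite !hornerE e1; ring.
Qed.

Lemma poly_phase_poly d (Q : {poly 'F_p}) : (size Q <= d.+1)%N ->
  poly_phase d ((d`!)%:R * Q`_d) (fun i => Q.[i%:R]).
Proof.
elim: d Q => [|d IH] Q szQ.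
  by move=> i /=; rewrite (size1_polyC szQ) hornerC coefC mul1r.
move=> h; have [Q' [sz' c' e']] := difference_poly h%:R szQ.
apply: eq_poly_phase (IH Q' sz'); first by rewrite c' factS natrM; ring.
by move=> i; rewrite e' natrD.
Qed.

End PolynomialDifferences.

Section Cubic.
Variables (R : rcfType) (p : nat) (psi : 'F_p -> R[i]).
Hypotheses (pr : prime p) (psiP : additive_char psi).
Hypothesis psi_far : forall n : nat, (0 < n)%N -> (2 * n <= p)%N ->
  2 * n%:R / p%:R <= abs (psi n%:R - 1).

(** After two squarings a cubic phase becomes linear with slope a multiple of
    [h * k]; the products [h * k] seldom coincide. *)
Lemma slopes_sum c s : c != 0 -> (2 * s ^ 2 <= p)%N ->
  (\sum_(h < s) \sum_(k < s) geometric_weight psi s (c * h.+1%:R * k.+1%:R)) ^+ 2 <=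
  (s%:R ^+ 2 + 2 * (s%:R * p%:R * harmonic_sum R p)) *
  (s%:R ^+ 2 * (1 + harmonic_sum R s ^+ 2)).
Proof.
move=> c0 s2; rewrite pair_bigA /=.
pose f (t : 'I_s * 'I_s) : 'F_p := c * t.1.+1%:R * t.2.+1%:R.
apply: le_trans (cauchy_schwarz_collisions f (geometric_weight psi s)) _.
have s0 : 0 <= \sum_c geometric_weight psi s c ^+ 2 by apply: sumr_ge0 => y _; rewrite sqr_ge0.
apply: ler_pM => //.
- by apply: sumr_ge0 => t _; apply: sumr_ge0.
- exact: geometric_weight_sum.
pose x (t : 'I_s * 'I_s) : 'F_p := (1 + t.2%:R) / t.1.+1%:R.
have nz (h : 'I_s) : h.+1%:R != 0 :> 'F_p.
  apply: natF_neq0 => //=; have := ltn_ord h; have : (s <= s ^ 2)%N by case: (s) => // n; rewrite -mulnn leq_pmulr.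
  lia.
apply: (@le_trans _ _ (\sum_t \sum_u ((x t == x u)%:R : R))).
  have -> : \sum_t \sum_u ((f t == f u)%:R : R) = \sum_(h < s) \sum_(k < s)
      \sum_(h' < s) \sum_(k' < s) (f (h, k) == f (h', k'))%:R.
    rewrite [RHS]pair_bigA /=; apply: eq_bigr => -[h k] _.
    by rewrite [RHS]pair_bigA /=; apply: eq_bigr => -[h' k'] _.
  have -> : \sum_t \sum_u ((x t == x u)%:R : R) = \sum_(h' < s) \sum_(k < s)
      \sum_(h < s) \sum_(k' < s) (x (h', k) == x (h, k'))%:R.
    rewrite [RHS]pair_bigA /=; apply: eq_bigr => -[h k] _.
    by rewrite [RHS]pair_bigA /=; apply: eq_bigr => -[h' k'] _.
  under eq_bigr do rewrite exchange_big /=.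
  rewrite exchange_big /= le_eqVlt; apply/orP; left; apply/eqP.
  apply: eq_bigr => h' _; rewrite exchange_big; apply: eq_bigr => k _.
  apply: eq_bigr => h _; apply: eq_bigr => k' _.
  rewrite /x /f /= eqr_div // -!mulrA (inj_eq (mulfI c0)) -!natr1.
  by congr (_%:R); congr (_ == _ :> 'F_p); ring.
apply: le_trans (@energy_bound R p pr s s 1 x _ _) _ => //.
  by rewrite -mulnA mulnn.
by rewrite expr2; lra.
Qed.

Lemma sum_ord_extend (N s : nat) (T : nat -> R) : (N <= s)%N ->
  (forall h, 0 <= T h) -> \sum_(h < N) T h <= \sum_(h < s) T h.
Proof.
move=> Ns T0; rewrite (big_ord_widen s T Ns) big_mkcond /=.
by apply: ler_sum => h _; case: ifP.
Qed.

Lemma cubic_inequality c f N s : poly_phase 3 c f -> c != 0 -> (N <= s)%N ->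
  (2 * s ^ 2 <= p)%N ->
  exists2 T : R, abs (\sum_(i < N) psi (f i)) ^+ 2 <= s%:R + 2 * T &
  exists2 U : R, T ^+ 2 <= s%:R * (s%:R * s%:R + 2 * U) & 0 <= T /\ 0 <= U /\
  U ^+ 2 <= (s%:R ^+ 2 + 2 * (s%:R * p%:R * harmonic_sum R p)) *
    (s%:R ^+ 2 * (1 + harmonic_sum R s ^+ 2)).
Proof.
move=> f3 c0 Ns s2.
pose Sh h := abs (\sum_(i < N - h.+1) psi (f (i + h.+1)%N - f i)).
have Sh0 h : 0 <= Sh h by exact: abs_ge0.
exists (\sum_(h < s) Sh h).
  apply: le_trans (psi_van_der_corput psiP f N) _.
  rewrite lerD ?ler_nat // ler_pM2l //; exact: sum_ord_extend.
have w0 c' : 0 <= geometric_weight psi s c'.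
  rewrite /geometric_weight; case: ifP => // _.
  by rewrite le_min ler0n divr_ge0 ?abs_ge0.
exists (\sum_(h < s) \sum_(k < s) geometric_weight psi s (c * h.+1%:R * k.+1%:R)).
  have := cauchy_schwarz_sum (fun=> 1) (fun h : 'I_s => Sh h).
  have -> : \sum_(h < s) 1 * Sh h = \sum_(h < s) Sh h.
    by apply: eq_bigr => h _; rewrite mul1r.
  have -> : \sum_(h < s) 1 ^+ 2 = s%:R :> R.
    by under eq_bigr do rewrite expr1n; rewrite sumr_const card_ord.
  move=> /le_trans; apply; rewrite ler_wpM2l //.
  have -> : s%:R * s%:R = \sum_(h < s) (s%:R : R).
    by rewrite sumr_const card_ord mulr_natl.
  rewrite mulr_sumr -big_split /=; apply: ler_sum => h _.
  apply: le_trans (psi_van_der_corput psiP (fun i => f (i + h.+1)%N - f i) _) _; apply: lerD.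
    by rewrite ler_nat (leq_trans (leq_subr _ _)).
  rewrite ler_pM2l //.
  apply: (@le_trans _ _ (\sum_(k < s) abs (\sum_(i < N - h.+1 - k.+1)
      psi (f (i + k.+1 + h.+1)%N - f (i + k.+1)%N - (f (i + h.+1)%N - f i))))).
    have ls : (N - h.+1 <= s)%N by apply: leq_trans (leq_subr _ _) Ns.
    apply: (@sum_ord_extend _ _ (fun k => abs (\sum_(i < N - h.+1 - k.+1)
      psi (f (i + k.+1 + h.+1)%N - f (i + k.+1)%N - (f (i + h.+1)%N - f i)))) ls) => k.
    exact: abs_ge0.
  apply: ler_sum => k _.
  apply: (@linear_phase_sum R p psi psiP _ (fun i => f (i + k.+1 + h.+1)%N -
    f (i + k.+1)%N - (f (i + h.+1)%N - f i))).
    exact: (f3 h.+1 k.+1).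
  by apply: leq_trans Ns; apply: leq_trans (leq_subr _ _) (leq_subr _ _).
split; first exact: sumr_ge0.
split; last exact: slopes_sum.
by apply: sumr_ge0 => h _; apply: sumr_ge0.
Qed.

End Cubic.

Lemma cubic_short_sum (R : rcfType) e : exists m (K : R), 0 <= K /\
  forall (p : nat) (psi : 'F_p -> R[i]) b s N c f,
    prime p -> additive_char psi ->
    (forall n : nat, (0 < n)%N -> (2 * n <= p)%N ->
      2 * n%:R / p%:R <= abs (psi n%:R - 1)) ->
    scale R m p b s -> (N <= s)%N -> poly_phase 3 c f -> c != 0 ->
    abs (\sum_(i < N) psi (f i)) <= K * s%:R / b%:R ^+ e.
Proof.
pose k := (e * 8 + 6)%N.
exists (2 * k + 3)%N, 10; split=> // p psi b s N c f pr psiP far sc Ns f3 c0.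
have [b0 bm Hp s1 s2] := sc.
have sk := scale_sqrt_ge (prime_gt0 pr) sc.
have [T hT [U hU [T0 [U0 hU2]]]] := cubic_inequality pr psiP far f3 c0 Ns s1.
pose x : R := b%:R; have x1 : 1 <= x by rewrite ler1n.
have x0 : 0 < x by lra.
have xgt0 i : 0 < x ^+ i by rewrite exprn_gt0.
have xge1 i : 1 <= x ^+ i by rewrite exprn_ege1.
pose S : R := s%:R; have S0 : 0 <= S by rewrite ler0n.
have skR : x ^+ k <= S by rewrite -natrX ler_nat.
have Sle i : (i <= k)%N -> x ^+ i <= S.
  by move=> h; apply: le_trans skR; rewrite ler_weXn2l.
have pS : p%:R <= 8 * S ^+ 2 by rewrite -natrX -natrM ler_nat.
have Hp0 := harmonic_sum_ge0 R p.
have Hx : harmonic_sum R p <= x ^+ 2 by rewrite -natrX.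
have sp : (s <= p)%N.
  have : (s <= s ^ 2)%N by case: (s) => // n; rewrite -mulnn leq_pmulr.
  by move=> h; apply: leq_trans s1; apply: leq_trans h _; rewrite leq_pmull.
have Hs : harmonic_sum R s ^+ 2 <= x ^+ 4.
  rewrite (exprM _ 2 2) lerXn2r ?nnegrE ?harmonic_sum_ge0 ?(ltW (xgt0 _)) //.
  exact: le_trans (harmonic_sum_mono R sp) Hx.
have pS0 : 0 <= p%:R :> R by rewrite ler0n.
have A1 : S ^+ 2 + 2 * (S * p%:R * harmonic_sum R p) <= 17 * S ^+ 3 * x ^+ 2.
  have h1 : S * p%:R * harmonic_sum R p <= (S * (8 * S ^+ 2)) * x ^+ 2.
    by apply: ler_pM => //; rewrite ?mulr_ge0 // ler_wpM2l.
  have h2 : S ^+ 2 <= S ^+ 3 * x ^+ 2.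
    rewrite [S ^+ 3]exprSr -[leRHS]mulrA ler_peMr ?sqr_ge0 //.
    by apply: mulr_ege1; rewrite ?xge1 //; apply: le_trans (xge1 k) skR.
  have -> : 17 * S ^+ 3 * x ^+ 2 = S ^+ 3 * x ^+ 2 + 2 * ((S * (8 * S ^+ 2)) * x ^+ 2) by ring.
  lra.
have A2 : S ^+ 2 * (1 + harmonic_sum R s ^+ 2) <= 2 * S ^+ 2 * x ^+ 4.
  have h : 1 + harmonic_sum R s ^+ 2 <= 2 * x ^+ 4.
    by have := xge1 4%N; lra.
  by apply: le_trans (ler_wpM2l (sqr_ge0 S) h) _; rewrite mulrCA mulrA.
have [y yE y1] : exists2 y : R, y = x ^+ e & 1 <= y by exists (x ^+ e).
have y0 : 0 < y by lra.
(* [y ^ 8 * x ^ 6 <= S] is what turns the saving of the energy bound into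
   the saving [y]. *)
have big : y ^+ 8 * x ^+ 6 <= S.
  by rewrite yE -exprM -exprD; exact: Sle.
have U2 : U * y ^+ 4 <= 6 * S ^+ 3.
  have h : (U * y ^+ 4) ^+ 2 <= (6 * S ^+ 3) ^+ 2.
    rewrite exprMn; apply: (@le_trans _ _ ((17 * S ^+ 3 * x ^+ 2) *
        (2 * S ^+ 2 * x ^+ 4) * (y ^+ 4) ^+ 2)).
      rewrite ler_wpM2r ?sqr_ge0 //; apply: le_trans hU2 _.
      apply: ler_pM => //; first by rewrite addr_ge0 ?sqr_ge0 ?mulr_ge0.
      by rewrite mulr_ge0 ?sqr_ge0 ?addr_ge0 ?sqr_ge0.
    have -> : (17 * S ^+ 3 * x ^+ 2) * (2 * S ^+ 2 * x ^+ 4) * (y ^+ 4) ^+ 2 =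
      34 * S ^+ 5 * (y ^+ 8 * x ^+ 6) by ring.
    have -> : (6 * S ^+ 3) ^+ 2 = 36 * S ^+ 5 * S by ring.
    apply: ler_pM => //; rewrite ?mulr_ge0 ?exprn_ge0 ?(ltW y0) ?(ltW x0) //.
    by rewrite ler_wpM2r ?exprn_ge0 // ler_nat.
  by move: h; rewrite ler_pXn2r ?nnegrE ?mulr_ge0 ?exprn_ge0 ?(ltW y0).
have yS : y ^+ 4 <= S.
  apply: le_trans big; rewrite -[leLHS]mulr1; apply: ler_pM => //.
  - by rewrite exprn_ge0 ?(ltW y0).
  - by rewrite ler_weXn2l.
have T2 : T * y ^+ 2 <= 4 * S ^+ 2.
  have h : (T * y ^+ 2) ^+ 2 <= (4 * S ^+ 2) ^+ 2.
    rewrite exprMn -exprM; apply: (le_trans (ler_wpM2r _ hU)).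
      by rewrite exprn_ge0 ?(ltW y0).
    rewrite -/S; have -> : S * (S * S + 2 * U) * y ^+ (2 * 2) =
      S ^+ 3 * y ^+ 4 + 2 * (S * (U * y ^+ 4)) by ring.
    have h1 : S ^+ 3 * y ^+ 4 <= S ^+ 3 * S by rewrite ler_wpM2l ?exprn_ge0.
    have h2 : S * (U * y ^+ 4) <= S * (6 * S ^+ 3) by rewrite ler_wpM2l.
    have -> : (4 * S ^+ 2) ^+ 2 = S ^+ 3 * S + 2 * (S * (6 * S ^+ 3)) + 3 * (S ^+ 2) ^+ 2 by ring.
    have := sqr_ge0 (S ^+ 2); lra.
  by move: h; rewrite ler_pXn2r ?nnegrE ?mulr_ge0 ?exprn_ge0 ?(ltW y0).
rewrite -yE ler_pdivlMr //.
have h : (abs (\sum_(i < N) psi (f i)) * y) ^+ 2 <= (10 * S) ^+ 2.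
  rewrite exprMn; apply: (le_trans (ler_wpM2r (sqr_ge0 y) hT)).
  rewrite -/S mulrDl -[2 * T * _]mulrA.
  have y24 : y ^+ 2 <= y ^+ 4 by rewrite ler_weXn2l.
  have h1 : S * y ^+ 2 <= S * S by rewrite ler_wpM2l // (le_trans y24).
  by nra.
by move: h; rewrite ler_pXn2r ?nnegrE ?mulr_ge0 ?abs_ge0 ?(ltW y0).
Qed.

(** Each squaring lowers the degree by one and halves the exponent of the
    saving. *)
Lemma weyl_phase_sum (R : rcfType) d e : exists m (K : R), 0 <= K /\
  forall (p : nat) (psi : 'F_p -> R[i]) b s N c f,
    prime p -> additive_char psi ->
    (forall n : nat, (0 < n)%N -> (2 * n <= p)%N ->
      2 * n%:R / p%:R <= abs (psi n%:R - 1)) ->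
    scale R m p b s -> (N <= s)%N -> poly_phase d.+3 c f -> c != 0 ->
    abs (\sum_(i < N) psi (f i)) <= K * s%:R / b%:R ^+ e.
Proof.
elim: d e => [|d IH] e; first exact: cubic_short_sum.
have [m [K [K0 W]]] := IH (2 * e)%N.
exists (m + (2 * (2 * e) + 3))%N, (1 + 2 * K).
split=> [|p psi b s N c f pr psiP far sc Ns fd c0]; first by lra.
have scm : scale R m p b s by apply: scale_weaken sc; exact: leq_addr.
have [b0 bm Hp s1 s2] := sc.
have sk : (b ^ (2 * e) <= s)%N.
  apply: (@scale_sqrt_ge R _ p _ _ (prime_gt0 pr)).
  by apply: scale_weaken sc; exact: leq_addl.
pose x : R := b%:R; have x1 : 1 <= x by rewrite ler1n.
have x0 : 0 < x by lra.
have s0 : (0 < s)%N by apply: leq_trans sk; rewrite expn_gt0 b0.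
have sp : (s < p)%N.
  apply: leq_trans s1; rewrite -mulnn mulnA.
  by rewrite -[ltnLHS]mul1n ltn_pmul2r //; lia.
pose S : R := s%:R; have S0 : 0 <= S by rewrite ler0n.
pose y := x ^+ e; have y0 : 0 < y by rewrite exprn_gt0.
have yS : y ^+ 2 <= S by rewrite -exprM mulnC -natrX ler_nat.
have Sh (h : 'I_N) : abs (\sum_(i < N - h.+1) psi (f (i + h.+1)%N - f i)) <= K * S / y ^+ 2.
  rewrite -exprM mulnC; apply: (W p psi b s _ (c * h.+1%:R)
    (fun i => f (i + h.+1)%N - f i)) => //.
  - by apply: leq_trans (leq_subr _ _) Ns.
  - rewrite mulf_neq0 // natF_neq0 //=.
    by apply: leq_ltn_trans sp; apply: leq_trans Ns.
have main : abs (\sum_(i < N) psi (f i)) ^+ 2 <= S + 2 * (S * (K * S / y ^+ 2)).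
  apply: le_trans (psi_van_der_corput psiP f N) _.
  apply: lerD; first by rewrite ler_nat.
  rewrite ler_pM2l //; apply: le_trans (ler_sum _ (fun h _ => Sh h)) _.
  rewrite sumr_const card_ord -mulr_natl ler_wpM2r ?ler_nat //.
  by apply: divr_ge0; [exact: mulr_ge0 | exact: sqr_ge0].
rewrite -/x -/y ler_pdivlMr // -/S.
have K1 : 1 + 2 * K <= (1 + 2 * K) ^+ 2 by nra.
have h : (abs (\sum_(i < N) psi (f i)) * y) ^+ 2 <= ((1 + 2 * K) * S) ^+ 2.
  rewrite exprMn; apply: (le_trans (ler_wpM2r (sqr_ge0 y) main)).
  have -> : (S + 2 * (S * (K * S / y ^+ 2))) * y ^+ 2 = S * y ^+ 2 + 2 * K * S ^+ 2.
    by field; rewrite lt0r_neq0.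
  have h1 : S * y ^+ 2 <= S * S by rewrite ler_wpM2l.
  rewrite exprMn; apply: (@le_trans _ _ ((1 + 2 * K) * S ^+ 2)); first by lra.
  by rewrite ler_wpM2r ?sqr_ge0.
by move: h; rewrite ler_pXn2r ?nnegrE ?mulr_ge0 ?abs_ge0 ?(ltW y0) //; lra.
Qed.

Lemma weyl_short_sum (R : rcfType) d e : (3 <= d)%N -> exists m (K : R), 0 <= K /\
  forall (p : nat) (psi : 'F_p -> R[i]) b s N (Q : {poly 'F_p}),
    prime p -> (d < p)%N -> additive_char psi ->
    (forall n : nat, (0 < n)%N -> (2 * n <= p)%N ->
      2 * n%:R / p%:R <= abs (psi n%:R - 1)) ->
    scale R m p b s -> (N <= s)%N -> size Q = d.+1 ->
    abs (\sum_(i < N) psi Q.[(i : nat)%:R]) <= K * s%:R / b%:R ^+ e.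
Proof.
move=> d3; have [k ->] : exists k, d = k.+3 by exists (d - 3)%N; lia.
have [m [K [K0 W]]] := weyl_phase_sum R k e.
exists m, K; split=> // p psi b s N Q pr dp psiP far sc Ns szQ.
have Qp : poly_phase k.+3 (((k.+3)`!)%:R * Q`_k.+3) (fun i => Q.[i%:R]).
  by apply: poly_phase_poly; rewrite szQ.
apply: (W p psi b s N _ (fun i => Q.[i%:R]) pr psiP far sc Ns Qp).
rewrite mulf_neq0 //.
  have fac n : (n < p)%N -> n`!%:R != 0 :> 'F_p.
    elim: n => [|n IH] np; first by rewrite oner_eq0.
    rewrite factS natrM; apply: mulf_neq0; first exact: natF_neq0.
    by apply: IH; exact: ltnW.
  exact: fac.
have -> : Q`_k.+3 = lead_coef Q by rewrite lead_coefE szQ.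
by rewrite lead_coef_eq0 -size_poly_eq0 szQ.
Qed.

(** * Completion: from the Fourier transform back to short sums *)

Section Abel.
Variable R : rcfType.
Local Notation C := (R[i]).

Lemma abel_summation (u k : nat -> C) n :
  \sum_(i < n.+1) u i * k i = (\sum_(i < n.+1) u i) * k n -
    \sum_(i < n) (\sum_(j < i.+1) u j) * (k i.+1 - k i).
Proof.
elim: n => [|n IH]; first by rewrite !big_ord1 big_ord0 subr0.
rewrite big_ord_recr /= IH.
rewrite [X in _ = X * _ - _]big_ord_recr /= [X in _ = _ - X]big_ord_recr /=.
set U := \sum_(i < n.+1) u i; set V := \sum_(i < n) _; ring.
Qed.

Lemma sum_blocks (u : nat -> C) (L : nat) (M : R) :
  (0 < L)%N -> 0 <= M ->
  (forall y N, (N <= L)%N -> abs (\sum_(i < N) u (y + i)%N) <= M) ->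
  forall n y, abs (\sum_(i < n) u (y + i)%N) * L%:R <= M * (n + L)%:R.
Proof.
move=> L0 M0 hu n; have [m] := ubnP n; elim: m n => [//|m IH] n nm y.
have [nL|Ln] := leqP n L.
  apply: (@le_trans _ _ (M * L%:R)); first by rewrite ler_wpM2r // hu.
  by rewrite ler_wpM2l // ler_nat leq_addl.
have [k ek] : exists k, n = (L + k)%N.
  by exists (n - L)%N; rewrite subnKC // ltnW.
subst n; rewrite big_split_ord /=.
rewrite [X in _ + X](eq_bigr (fun i : 'I_k => u (y + L + i)%N)) => [|i _]; last by rewrite addnA.
apply: le_trans (ler_wpM2r (ler0n _ _) (absD _ _)) _.
have h1 : abs (\sum_(i < L) u (y + i)%N) * L%:R <= M * L%:R.
  by rewrite ler_wpM2r // hu.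
have kn : (k < m)%N.
  by rewrite -ltnS; apply: leq_trans nm; rewrite ltnS -[ltnLHS]add0n ltn_add2r.
have := IH k kn (y + L)%N.
rewrite !natrD mulrDl; lra.
Qed.

(** Partial summation against a kernel that behaves like [1 / x]. *)
Lemma abel_bound (u k : nat -> C) (L n : nat) (M kap kap' : R) :
  (0 < L)%N -> 0 <= M -> 0 <= kap -> 0 <= kap' ->
  (forall y N, (N <= L)%N -> abs (\sum_(i < N) u (y + i)%N) <= M) ->
  (forall x, (0 < x < L + n)%N -> abs (k x) <= kap / x%:R) ->
  (forall x, (0 < x)%N -> (x.+1 < L + n)%N ->
     abs (k x.+1 - k x) <= kap' / x%:R ^+ 2) ->
  abs (\sum_(i < n) u (L + i)%N * k (L + i)%N) <=
    2 * M / L%:R * (kap + kap' * harmonic_sum R (L + n)).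
Proof.
move=> L0 M0 kap0 kap0' hu hk hk'.
have LR : 0 < L%:R :> R by rewrite ltr0n.
have H0 := harmonic_sum_ge0 R (L + n).
case: n hk hk' H0 => [|n] hk hk' H0.
  by rewrite big_ord0 abs0 mulr_ge0 ?divr_ge0 ?mulr_ge0 ?addr_ge0 ?(ltW LR) // mulr_ge0.
have U i : abs (\sum_(j < i.+1) u (L + j)%N) <= 2 * M / L%:R * (L + i)%:R.
  have := sum_blocks L0 M0 hu i.+1 L.
  rewrite -ler_pdivlMr // => /le_trans; apply.
  have -> : 2 * M / L%:R * (L + i)%:R = M * (2 * (L + i)%:R) / L%:R by ring.
  rewrite ler_wpM2r ?invr_ge0 ?(ltW LR) // ler_wpM2l // -natrM ler_nat; lia.
rewrite (abel_summation (fun i => u (L + i)%N) (fun i => k (L + i)%N)).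
apply: le_trans (absB _ _) _; rewrite mulrDr; apply: lerD.
  rewrite absM; apply: le_trans (ler_pM (abs_ge0 _) (abs_ge0 _) (U n) (hk _ _)) _.
    by rewrite addn_gt0 L0 /= addnS.
  have x0 : (L + n)%:R != 0 :> R by rewrite pnatr_eq0 -lt0n addn_gt0 L0.
  move: ((L + n)%:R : R) (L%:R : R) x0 (lt0r_neq0 LR) => X Y X0 Y0.
  by rewrite le_eqVlt; apply/orP; left; apply/eqP; field; rewrite X0 Y0.
apply: le_trans (abs_sum _ _ _) _.
apply: (@le_trans _ _ (\sum_(i < n) 2 * M / L%:R * kap' * (L + i)%:R^-1)).
  apply: ler_sum => i _; rewrite absM.
  have xi : (0 < L + i)%N by rewrite addn_gt0 L0.
  have hk'' : abs (k (L + i.+1)%N - k (L + i)%N) <= kap' / (L + i)%:R ^+ 2.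
    by rewrite addnS; apply: hk' => //; have := ltn_ord i; lia.
  apply: le_trans (ler_pM (abs_ge0 _) (abs_ge0 _) (U i) hk'') _.
  have x0 : (L + i)%:R != 0 :> R by rewrite pnatr_eq0 -lt0n.
  move: ((L + i)%:R : R) (L%:R : R) x0 (lt0r_neq0 LR) => X Y X0 Y0.
  by rewrite le_eqVlt; apply/orP; left; apply/eqP; field; rewrite X0 Y0.
rewrite -mulr_sumr -mulrA ler_wpM2l ?divr_ge0 ?mulr_ge0 ?(ltW LR) //.
rewrite ler_wpM2l // /harmonic_sum.
have -> : \sum_(i < n) ((L + i)%:R : R)^-1 = \sum_(L <= i < L + n) i%:R^-1.
  rewrite -{2}[L]add0n big_addn addKn big_mkord.
  by apply: eq_bigr => i _; rewrite addnC.
rewrite [leRHS](@big_cat_nat _ _ _ L) ?leqW ?leq_addr //=.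
rewrite [X in _ + X](@big_cat_nat _ _ _ (L + n)) ?leq_addr ?leqW ?leq_add2l //=.
have g0 a b : 0 <= \sum_(a <= i < b) (i%:R : R)^-1.
  by apply: sumr_ge0 => i _; rewrite invr_ge0.
by have := g0 1%N L; have := g0 (L + n)%N (L + n.+1).+1; lra.
Qed.

End Abel.

(** Representatives between [- h] and [h] are the ones for which the kernel
    decays like the inverse of the argument. *)
Lemma sum_symmetric (R : rcfType) (p : nat) (pr : prime p) h (g : 'F_p -> R[i]) :
  p = (2 * h).+1 ->
  \sum_x g x = g 0 + \sum_(i < h) (g i.+1%:R + g (- i.+1%:R)).
Proof.
move=> ph.
have -> : \sum_x g x = \sum_(i < p) g i%:R.
  rewrite (reindex (cast_ord (Fp_cast pr))) /=.
    by apply: eq_bigr => i _; rewrite natr_Zp.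
  by exists (cast_ord (esym (Fp_cast pr))) => i _; rewrite ?cast_ordK ?cast_ordKV.
transitivity (\sum_(i < h.+1 + h) g i%:R).
  by rewrite (_ : h.+1 + h = p)%N // ph mul2n -addnn.
rewrite big_split_ord /= big_ord_recl /= -addrA big_split /=; congr (_ + (_ + _)).
rewrite (reindex_inj rev_ord_inj) /=; apply: eq_bigr => i _; congr g.
have ip : (i.+1 <= p)%N by have := ltn_ord i; lia.
apply/eqP; rewrite -addr_eq0 -natrD.
rewrite (_ : (h.+1 + (h - i.+1) + i.+1)%N = p) ?pchar_Fp_0 //.
by rewrite -addnA subnK ?ltn_ord // ph; lia.
Qed.

Section Completion.
Variables (R : rcfType) (p : nat) (psi phi : 'F_p -> R[i]).
Hypotheses (pr : prime p) (psiP : additive_char psi).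
Hypothesis psi1 : abs (psi 1 - 1) <= 8 / p%:R.
Hypothesis psi_far : forall n : nat, (0 < n)%N -> (2 * n <= p)%N ->
  2 * n%:R / p%:R <= abs (psi n%:R - 1).
Hypothesis phi1 : forall x, abs (phi x) <= 1.

Let pp : 0 < p%:R :> R.
Proof. by rewrite ltr0n prime_gt0. Qed.

Section Kernel.
Variables (H : nat) (n0 : 'F_p).

Definition kernel_sum (x : 'F_p) : R[i] := \sum_(i < H) psi ((n0 + (i : nat)%:R) * x).

Lemma kernel_sum_le x : abs (kernel_sum x) <= H%:R.
Proof.
apply: le_trans (abs_sum _ _ _) _.
rewrite -[X in _ <= X%:R]card_ord -sumr_const; apply: ler_sum => i _.
by rewrite (abs_psi psiP).
Qed.

Lemma kernel_sum_geometric x : kernel_sum x * (psi x - 1) =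
  psi ((n0 + H%:R) * x) - psi (n0 * x).
Proof.
rewrite /kernel_sum; elim: H => [|H' IH].
  by rewrite big_ord0 mul0r addr0 subrr.
rewrite big_ord_recr /= mulrDl IH mulrBr mulr1 -(psiD psiP).
have -> : (n0 + H'.+1%:R) * x = (n0 + H'%:R) * x + x by rewrite -natr1; ring.
by ring.
Qed.

Variable sgn : bool.
Let e (x : nat) : 'F_p := (-1) ^+ sgn * x%:R.
Let k (x : nat) : R[i] := (psi (e x) - 1)^-1.

Lemma abs_psi_sign (y : 'F_p) : abs (psi ((-1) ^+ sgn * y) - 1) = abs (psi y - 1).
Proof.
case: sgn; rewrite ?expr0 ?mul1r // expr1 mulN1r (psiN psiP).
by rewrite -[RHS]absJ rmorphB rmorph1.
Qed.

Lemma inverse_kernel_bound x : (0 < x)%N -> (2 * x <= p)%N ->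
  abs (k x) <= (p%:R / 2) / x%:R.
Proof.
move=> x0 xp; have := psi_far x0 xp.
have xr : 0 < x%:R :> R by rewrite ltr0n.
rewrite /k absV abs_psi_sign => h.
have h0 : 0 < 2 * x%:R / p%:R :> R by rewrite divr_gt0 ?mulr_gt0.
have -> : p%:R / 2 / x%:R = (2 * x%:R / p%:R)^-1 :> R.
  by field; rewrite !lt0r_neq0.
by rewrite lef_pV2 ?posrE // (lt_le_trans h0).
Qed.

Lemma inverse_kernel_variation x : (0 < x)%N -> (2 * x.+1 <= p)%N ->
  abs (k x.+1 - k x) <= (2 * p%:R) / x%:R ^+ 2.
Proof.
move=> x0 xp; have xp' : (2 * x <= p)%N by lia.
have xr : 0 < x%:R :> R by rewrite ltr0n.
have nz y : (0 < y)%N -> (2 * y <= p)%N -> psi (e y) - 1 != 0.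
  move=> y0 yp; rewrite -abs_eq0 abs_psi_sign lt0r_neq0 //.
  by apply: lt_le_trans (psi_far y0 yp); rewrite divr_gt0 ?mulr_gt0 ?pp ?ltr0n.
have -> : k x.+1 - k x = (psi (e x) - psi (e x.+1)) * (k x * k x.+1).
  rewrite /k; have := nz x x0 xp'; have := nz x.+1 isT xp.
  move: (psi (e x)) (psi (e x.+1)) => a c c1 a1; field.
  by rewrite a1 c1.
rewrite !absM.
have d : abs (psi (e x) - psi (e x.+1)) <= 8 / p%:R.
  have -> : e x.+1 = e x + (-1) ^+ sgn * 1 by rewrite /e -[x.+1%:R]natr1 mulrDr mulr1.
  rewrite (psiD psiP) -{1}[psi (e x)]mulr1 -mulrBr absM (abs_psi psiP) mul1r.
  by rewrite absBC abs_psi_sign.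
have k1 := inverse_kernel_bound x0 xp'.
have k2 : abs (k x.+1) <= (p%:R / 2) / x%:R.
  apply: le_trans (inverse_kernel_bound _ xp) _ => //.
  by rewrite ler_wpM2l ?divr_ge0 ?(ltW pp) // lef_pV2 ?posrE ?ltr0n // ler_nat.
apply: le_trans (ler_pM (abs_ge0 _) _ d (ler_pM (abs_ge0 _) (abs_ge0 _) k1 k2)) _.
  by rewrite mulr_ge0 ?abs_ge0.
move: (p%:R : R) (x%:R : R) (lt0r_neq0 pp) (lt0r_neq0 xr) => P X P0 X0.
by rewrite le_eqVlt; apply/orP; left; apply/eqP; field; rewrite P0 X0.
Qed.

Variables (h : nat) (ph : p = (2 * h).+1).

(** Away from the origin the kernel is [1 / (psi x - 1)] times two linear
    phases, which are absorbed into the short sums. *)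
Lemma kernel_tail (L : nat) (M : R) : (0 < L <= h)%N -> 0 <= M ->
  (forall n y N, (N <= L)%N ->
     abs (\sum_(i < N) phi (e (y + i)) * psi (n * e (y + i))) <= M) ->
  abs (\sum_(i < h.+1 - L) phi (e (L + i)) * kernel_sum (e (L + i))) <=
    2 * (2 * M) / L%:R * (p%:R / 2 + 2 * p%:R * harmonic_sum R p).
Proof.
move=> /andP[L0 Lh] M0 hM.
pose u (x : nat) := phi (e x) * (psi ((n0 + H%:R) * e x) - psi (n0 * e x)).
have kE x : (0 < x)%N -> (x <= h)%N -> phi (e x) * kernel_sum (e x) = u x * k x.
  move=> x0 xh; rewrite /u -kernel_sum_geometric /k -!mulrA mulfV ?mulr1 //.
  rewrite -abs_eq0 abs_psi_sign lt0r_neq0 //.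
  apply: lt_le_trans (psi_far x0 _); last by rewrite ph leqW // leq_mul2l.
  by rewrite divr_gt0 ?mulr_gt0 ?pp ?ltr0n.
rewrite (eq_bigr (fun i : 'I_(h.+1 - L) => u (L + i)%N * k (L + i)%N)); last first.
  move=> i _; apply: kE; first by rewrite addn_gt0 L0.
  by have := ltn_ord i; lia.
have hu y N : (N <= L)%N -> abs (\sum_(i < N) u (y + i)%N) <= 2 * M.
  move=> NL; rewrite /u; under eq_bigr do rewrite mulrBr.
  rewrite sumrB; apply: le_trans (absB _ _) _.
  rewrite (_ : 2 * M = M + M); last by ring.
  by apply: lerD; exact: hM.
have Ln : (L + (h.+1 - L) = h.+1)%N by lia.
have ab := @abel_bound R u k L (h.+1 - L) (2 * M) (p%:R / 2) (2 * p%:R) L0.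
apply: le_trans (ab _ _ _ hu _ _) _; rewrite ?Ln.
- by rewrite mulr_ge0.
- by rewrite divr_ge0 ?(ltW pp).
- by rewrite mulr_ge0 ?(ltW pp).
- move=> x /andP[x0 xh]; apply: inverse_kernel_bound => //; rewrite ph; lia.
- move=> x x0 xh; apply: inverse_kernel_variation => //; rewrite ph; lia.
rewrite ler_wpM2l ?divr_ge0 ?mulr_ge0 // lerD2l ler_wpM2l ?mulr_ge0 ?(ltW pp) //.
by apply: harmonic_sum_mono; rewrite ph; lia.
Qed.

Lemma kernel_trivial : abs (\sum_(i < h) phi (e i.+1) * kernel_sum (e i.+1)) <=
  p%:R * harmonic_sum R p.
Proof.
clear psi1; apply: le_trans (abs_sum _ _ _) _.
apply: (@le_trans _ _ (\sum_(i < h) p%:R * i.+1%:R^-1)).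
  apply: ler_sum => i _; rewrite absM -[leRHS]mul1r.
  apply: ler_pM; rewrite ?abs_ge0 //.
  have ih := ltn_ord i.
  have k1 : abs (k i.+1) <= (p%:R / 2) / i.+1%:R.
    by apply: inverse_kernel_bound => //; rewrite ph; lia.
  have -> : kernel_sum (e i.+1) =
      (psi ((n0 + H%:R) * e i.+1) - psi (n0 * e i.+1)) * k i.+1.
    rewrite -kernel_sum_geometric mulfK // -abs_eq0 abs_psi_sign lt0r_neq0 //.
    apply: lt_le_trans (psi_far _ _) => //; last by rewrite ph; lia.
    by rewrite divr_gt0 ?mulr_gt0 ?pp ?ltr0n.
  rewrite absM; apply: (@le_trans _ _ (2 * (p%:R / 2 / i.+1%:R))).
    apply: ler_pM; rewrite ?abs_ge0 //.
    by apply: le_trans (absB _ _) _; rewrite !(abs_psi psiP).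
  by rewrite mulrA [2 * _]mulrC divfK ?pnatr_eq0.
rewrite -mulr_sumr ler_wpM2l ?(ltW pp) //.
apply: (@le_trans _ _ (harmonic_sum R h)).
  by rewrite /harmonic_sum big_add1 big_mkord.
by apply: harmonic_sum_mono; rewrite ph; lia.
Qed.

End Kernel.
End Completion.

(** The cut is at [L = s / b ^ 5]: below it the kernel is bounded by [H], above
    it partial summation gains the ratio of the saving [b ^ 8] to [s / L]. For
    [H > s * b ^ 4] the trivial bound for the kernel is enough. *)
Lemma completion_bound (R : rcfType) (p : nat) (psi phi : 'F_p -> R[i])
    (b s H : nat) (n0 : 'F_p) (K : R) :
  prime p -> odd p -> additive_char psi -> abs (psi 1 - 1) <= 8 / p%:R ->
  (forall n : nat, (0 < n)%N -> (2 * n <= p)%N ->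
    2 * n%:R / p%:R <= abs (psi n%:R - 1)) ->
  (forall x, abs (phi x) <= 1) -> scale R (2 * 5 + 3) p b s -> 0 <= K ->
  (forall (sgn : bool) n y N, (N <= s)%N ->
     abs (\sum_(i < N) phi ((-1) ^+ sgn * (y + i)%N%:R) *
                       psi (n * ((-1) ^+ sgn * (y + i)%N%:R)))
       <= K * s%:R / b%:R ^+ 8) ->
  abs (\sum_x phi x * kernel_sum psi H n0 x) <=
    (20 + 320 * K) * s%:R * (s%:R + H%:R) / b%:R.
Proof.
move=> pr po psiP psi1 far phi1 sc K0 short.
have [b0 bm Hp s1 s2] := sc.
have sk := scale_sqrt_ge (prime_gt0 pr) sc.
pose h := p./2.
have ph : p = (2 * h).+1 by rewrite -[LHS]odd_double_half po mul2n.
have b5 : (0 < b ^ 5)%N by rewrite expn_gt0 b0.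
have s0 : (0 < s)%N by apply: leq_trans sk.
pose x : R := b%:R; have x1 : 1 <= x by rewrite ler1n.
have x0 : 0 < x by rewrite ltr0n.
pose S : R := s%:R; have S1 : 1 <= S by rewrite ler1n.
pose P : R := p%:R; have P0 : 0 <= P by rewrite ler0n.
have PS : P <= 8 * S ^+ 2 by rewrite -natrX -natrM ler_nat.
pose Hr := harmonic_sum R p; have Hr0 : 0 <= Hr by exact: harmonic_sum_ge0.
have Hx : Hr <= x ^+ 2 by rewrite -natrX.
have Sx5 : x ^+ 5 <= S by rewrite -natrX ler_nat.
have Sx : x <= S by apply: le_trans Sx5; rewrite -{1}[x]expr1 ler_weXn2l.
have H0 : 0 <= H%:R :> R by rewrite ler0n.
pose g y := phi y * kernel_sum psi H n0 y.
have g1 y : abs (g y) <= H%:R.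
  rewrite absM -[leRHS]mul1r; apply: ler_pM; rewrite ?abs_ge0 //.
  exact: kernel_sum_le.
pose T (sgn : bool) := abs (\sum_(i < h) g ((-1) ^+ sgn * i.+1%:R)).
have split_T : abs (\sum_x g x) <= H%:R + (T false + T true).
  rewrite (sum_symmetric pr g ph) big_split /=; apply: le_trans (absD _ _) _.
  apply: lerD => //; apply: le_trans (absD _ _) _; rewrite /T.
  rewrite (eq_bigr (fun i : 'I_h => g ((-1) ^+ false * i.+1%:R))); last first.
    by move=> i _; rewrite expr0 mul1r.
  apply: lerD => //.
  rewrite (eq_bigr (fun i : 'I_h => g ((-1) ^+ true * i.+1%:R))) // => i _.
  by rewrite expr1 mulN1r.
apply: le_trans split_T _; rewrite -/x -/S ler_pdivlMr //.
have [hH|hH] := lerP H%:R (S * x ^+ 4).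
  pose L := (s %/ b ^ 5)%N.
  have L0 : (0 < L)%N by rewrite divn_gt0.
  have Ls : (L <= s)%N by exact: leq_div.
  have Lh : (L <= h)%N.
    apply: leq_trans Ls _; rewrite -[s]doubleK; apply: half_leq.
    by apply: leq_trans s1; rewrite -mul2n leq_mul2l /= -mulnn leq_pmulr.
  pose l : R := L%:R; have l0 : 0 < l by rewrite ltr0n.
  have l1 : 1 <= l by rewrite ler1n.
  have lS : l * x ^+ 5 <= S by rewrite -natrX -natrM ler_nat leq_trunc_div.
  have Sl : S <= 2 * (l * x ^+ 5).
    rewrite -natrX -!natrM ler_nat; have := ltn_ceil s b5; rewrite -/L.
    have : (b ^ 5 <= L * b ^ 5)%N by rewrite leq_pmull.
    rewrite mulSn mul2n -addnn => h1 h2; apply: ltnW; apply: leq_trans h2 _.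
    by rewrite leq_add2r.
  pose M := K * S / x ^+ 8.
  have M0 : 0 <= M by rewrite divr_ge0 ?exprn_ge0 ?mulr_ge0 ?(ltW x0) //; lra.
  have Tb sgn : T sgn <= l * H%:R + 2 * (2 * M) / l * (P / 2 + 2 * P * Hr).
    have := @kernel_tail R p psi phi pr psiP psi1 far H n0 sgn h ph L M.
    rewrite L0 Lh => /(_ isT M0) tail.
    have {}tail := tail (fun n y N NL => short sgn n y N (leq_trans NL Ls)).
    rewrite /T.
    have -> : \sum_(i < h) g ((-1) ^+ sgn * i.+1%:R) =
        \sum_(i < L.-1) g ((-1) ^+ sgn * i.+1%:R) +
        \sum_(i < h.+1 - L) g ((-1) ^+ sgn * (L + i)%N%:R).
      transitivity (\sum_(i < L.-1 + (h.+1 - L)) g ((-1) ^+ sgn * i.+1%:R)).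
        by rewrite (_ : L.-1 + (h.+1 - L) = h)%N // subSn // addnS -addSn prednK // subnKC.
      rewrite big_split_ord /=; congr (_ + _); apply: eq_bigr => i _.
      by rewrite -addSn prednK.
    apply: le_trans (absD _ _) _; apply: lerD => //.
    apply: le_trans (abs_sum _ _ _) _.
    apply: (@le_trans _ _ (\sum_(i < L.-1) (H%:R : R))).
      by apply: ler_sum => i _; exact: g1.
    by rewrite sumr_const card_ord -[_ *+ L.-1]mulr_natl ler_wpM2r // ler_nat leq_pred.
  have tl : 2 * (2 * M) / l * (P / 2 + 2 * P * Hr) * x <= 160 * K * S ^+ 2.
    have M3 : M / l <= 2 * K / x ^+ 3.
      rewrite ler_pdivrMr // /M; apply: (@le_trans _ _ (K * (2 * (l * x ^+ 5)) / x ^+ 8)).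
        by rewrite ler_wpM2r ?invr_ge0 ?exprn_ge0 ?(ltW x0) // ler_wpM2l.
      rewrite le_eqVlt; apply/orP; left; apply/eqP.
      by field; rewrite lt0r_neq0.
    have PH : P / 2 + 2 * P * Hr <= 20 * S ^+ 2 * x ^+ 2.
      have xx : 1 <= x ^+ 2 by rewrite exprn_ege1.
      have h1 : P * Hr <= P * x ^+ 2 by rewrite ler_wpM2l.
      have h2 : P * 1 <= P * x ^+ 2 by rewrite ler_wpM2l.
      have h3 : P * x ^+ 2 <= 8 * S ^+ 2 * x ^+ 2 by rewrite ler_wpM2r ?sqr_ge0.
      lra.
    have e1 : 2 * (2 * M) / l * (P / 2 + 2 * P * Hr) * x =
       4 * ((M / l) * (P / 2 + 2 * P * Hr)) * x by ring.
    have e2 : 160 * K * S ^+ 2 = 4 * ((2 * K / x ^+ 3) * (20 * S ^+ 2 * x ^+ 2)) * x.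
      by field; rewrite lt0r_neq0.
    rewrite e1 e2 ler_wpM2r ?(ltW x0) // ler_pM2l //; apply: ler_pM => //.
      by rewrite divr_ge0 ?(ltW l0).
    by rewrite addr_ge0 ?divr_ge0 ?mulr_ge0.
  have lH : l * H%:R * x <= S * S.
    apply: (@le_trans _ _ (l * (S * x ^+ 4) * x)).
      by rewrite ler_wpM2r ?(ltW x0) // ler_wpM2l ?(ltW l0).
    have -> : l * (S * x ^+ 4) * x = S * (l * x ^+ 5) by ring.
    by rewrite ler_wpM2l //; lra.
  have HH : H%:R * x <= l * H%:R * x.
    by rewrite ler_wpM2r ?(ltW x0) // ler_peMl.
  have t0 := Tb false; have t1 := Tb true.
  set A := 2 * (2 * M) / l * _ in tl t0 t1.
  have q0 : T false * x <= (l * H%:R + A) * x by rewrite ler_wpM2r ?(ltW x0).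
  have q1 : T true * x <= (l * H%:R + A) * x by rewrite ler_wpM2r ?(ltW x0).
  have KS : 0 <= (20 + 320 * K) * S * H%:R by rewrite !mulr_ge0 //; lra.
  have S2 : 0 <= S * S by rewrite mulr_ge0 //; lra.
  apply: (@le_trans _ _ (3 * (S * S) + 320 * K * S ^+ 2)).
    have -> : (H%:R + (T false + T true)) * x =
      H%:R * x + (T false * x + T true * x) by ring.
    rewrite mulrDl in q0; rewrite mulrDl in q1; lra.
  have -> : (20 + 320 * K) * S * (S + H%:R) =
    20 * (S * S) + 320 * K * S ^+ 2 + (20 + 320 * K) * S * H%:R by ring.
  lra.
have Tb sgn : T sgn <= P * Hr.
  exact: (kernel_trivial pr psiP far phi1 H n0 sgn ph).
have t0 := Tb false; have t1 := Tb true.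
have PHr : P * Hr <= 8 * S ^+ 2 * x ^+ 2.
  by apply: ler_pM.
have big : S ^+ 2 * x ^+ 2 * x <= S * H%:R.
  apply: (@le_trans _ _ (S * (S * x ^+ 4))); last by rewrite ler_wpM2l ?(ltW hH) //; lra.
  have -> : S ^+ 2 * x ^+ 2 * x = S * (S * x ^+ 3) by ring.
  have S0 : 0 <= S by lra.
  by apply: ler_wpM2l => //; apply: ler_wpM2l => //; apply: ler_weXn2l.
have HS : H%:R * x <= S * H%:R by rewrite mulrC ler_wpM2r.
have q : (T false + T true) * x <= 16 * (S ^+ 2 * x ^+ 2 * x).
  have -> : 16 * (S ^+ 2 * x ^+ 2 * x) = (8 * S ^+ 2 * x ^+ 2 + 8 * S ^+ 2 * x ^+ 2) * x by ring.
  by rewrite ler_wpM2r ?(ltW x0) // lerD // (le_trans _ PHr).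
have KS : 0 <= K * S * H%:R by rewrite !mulr_ge0 //; lra.
have KS2 : 0 <= (20 + 320 * K) * S * S by rewrite !mulr_ge0 //; lra.
have SH : 0 <= S * H%:R by rewrite mulr_ge0 //; lra.
have -> : (20 + 320 * K) * S * (S + H%:R) = (20 + 320 * K) * S * S +
  (20 * (S * H%:R) + 320 * (K * S * H%:R)) by ring.
rewrite mulrDl; lra.
Qed.

(** * The characters of F_p *)

Section StandardCharacter.
Variables (R : realType) (p : nat).
Hypothesis pr : prime p.

Definition circle (t : R) : R[i] := cos t +i* sin t.

Lemma circleD s t : circle (s + t) = circle s * circle t.
Proof.
rewrite /circle cosD sinD; apply/eqP; rewrite eq_complex /= eqxx /=.
by rewrite addrC.
Qed.

Lemma circle_2pi n : circle (2 * pi * n%:R) = 1.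
Proof.
elim: n => [|n IH]; first by rewrite mulr0 /circle cos0 sin0.
rewrite -[n.+1%:R]natr1 mulrDr mulr1 circleD IH mul1r /circle.
by rewrite mulr_natl cos2pi sin2pi.
Qed.

Lemma normc_circle t : `|circle t| = 1.
Proof. by rewrite normc_def /= cos2Dsin2 sqrtr1. Qed.

Lemma abs_ge_Re (z : R[i]) : complex.Re z <= abs z.
Proof.
by rewrite -lecR -absE; apply: le_trans (normc_ge_Re z); rewrite lecR ler_norm.
Qed.

Let p0 : (p%:R : R) != 0.
Proof. by rewrite pnatr_eq0 -lt0n prime_gt0. Qed.

Lemma e_p_nat (n : nat) : e_p R (n%:R : 'F_p) = circle (2 * pi * (n%:R / p%:R)).
Proof.
rewrite /e_p val_Fp_nat // -/(circle _) {2}(divn_eq n p) natrD natrM.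
have -> : 2 * pi * (((n %/ p)%:R * p%:R + (n %% p)%:R) / p%:R) =
  2 * pi * (n %/ p)%:R + 2 * pi * (n %% p)%:R / p%:R :> R by field.
by rewrite circleD circle_2pi mul1r.
Qed.

Lemma e_pD : {morph e_p R (p := p) : x y / x + y >-> x * y}.
Proof.
move=> x y; rewrite -[x]natr_Zp -[y]natr_Zp -natrD !e_p_nat.
by rewrite -circleD -mulrDr -mulrDl -natrD.
Qed.

Lemma abs_e_p (x : 'F_p) : abs (e_p R x) = 1.
Proof. by rewrite -[x]natr_Zp e_p_nat /abs normc_circle. Qed.

(** Doubling [n] multiplies the distance to [1] by at most 2, and once the
    angle lies in the second quadrant this distance is at least [1]. *)
Lemma e_p_dist_ge (n : nat) : (0 < n)%N -> (2 * n <= p)%N ->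
  2 * n%:R / p%:R <= abs (e_p R (n%:R : 'F_p) - 1).
Proof.
have pp : 0 < p%:R :> R by rewrite lt_neqAle eq_sym p0 ler0n.
have [k] := ubnP (p - n); elim: k n => [//|k IH] n hk n0 hn.
have [h4|h4] := leqP (4 * n) p.
  have := IH (2 * n)%N _ _ _; rewrite natrM.
  move=> /(_ ltac:(lia) ltac:(lia) ltac:(lia)) h.
  have dbl : abs (e_p R ((2 * n)%:R : 'F_p) - 1) <= 2 * abs (e_p R (n%:R : 'F_p) - 1).
    rewrite mul2n -addnn natrD e_pD.
    set z := e_p R _; rewrite (_ : z * z - 1 = (z + 1) * (z - 1)); last by ring.
    rewrite absM ler_wpM2r ?abs_ge0 //; apply: le_trans (absD _ _) _.
    by rewrite abs1 abs_e_p.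
  have e : 2 * (2 * n%:R) / p%:R = 2 * (2 * n%:R / p%:R) :> R by ring.
  rewrite e in h; have := le_trans h dbl; by rewrite ler_pM2l.
apply: (@le_trans _ _ 1).
  by rewrite ler_pdivrMr // mul1r -natrM ler_nat.
rewrite -absN opprB; apply: le_trans (abs_ge_Re _).
rewrite e_p_nat /= lerBrDr gerDl.
set t := 2 * pi * _.
have -> : t = (t - pi / 2) + pi / 2 by rewrite subrK.
rewrite cosDpihalf oppr_le0; apply: sin_ge0_pi.
have pi0 := pi_gt0 R.
have t1 : 1 / 4 <= n%:R / p%:R :> R.
  rewrite ler_pdivlMr // mulrAC ler_pdivrMr // mul1r -natrM ler_nat mulnC; exact: ltnW.
have t2 : n%:R / p%:R <= 1 / 2 :> R.
  by rewrite ler_pdivrMr // mulrAC ler_pdivlMr // mul1r -natrM ler_nat mulnC.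
apply/andP; split; rewrite /t; nra.
Qed.

Lemma sin_le_id (t : R) : 0 <= t -> sin t <= t.
Proof.
move=> t0.
have cs : {within `[0, t], continuous (@sin R)}%classic.
  exact/continuous_subspaceT/continuous_sin.
have [c _] := @MVT_segment R sin cos 0 t t0 (fun x _ => is_derive_sin x) cs.
by rewrite sin0 !subr0 => ->; rewrite ler_piMl //; exact: cos_le1.
Qed.

Lemma e_p1_dist_le : abs (e_p R (1 : 'F_p) - 1) <= 8 / p%:R.
Proof.
have pp : 0 < p%:R :> R by rewrite lt_neqAle eq_sym p0 ler0n.
have -> : e_p R (1 : 'F_p) = circle ((pi / p%:R) *+ 2).
  rewrite -[1 : 'F_p]/(1%:R) e_p_nat; congr circle.
  by rewrite -mulr_natl; ring.
set t := pi / p%:R.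
have pi0 := pi_gt0 R; have pi4 : pi <= 4 :> R by have := pihalf_lt2 R; lra.
have t0 : 0 <= t by rewrite divr_ge0 // ltW.
have tpi : t <= pi.
  by rewrite /t ler_pdivrMr // ler_peMr ?(ltW pi0) // ler1n prime_gt0.
have s0 : 0 <= sin t by apply: sin_ge0_pi; rewrite t0.
have st := sin_le_id t0.
have sq : abs (circle (t *+ 2) - 1) ^+ 2 = (2 * sin t) ^+ 2.
  apply: complexI; rewrite rmorphXn /= -absE -add_Re2_Im2; congr _%:C.
  rewrite /= cos_mulr2n sin_mulr2n oppr0 addr0.
  have := cos2Dsin2 t; set c := cos t; set s := sin t => e.
  have c2 : c ^+ 2 = 1 - s ^+ 2 by rewrite -e addrK.
  have e4 : (c * s + c * s) ^+ 2 = 4 * c ^+ 2 * s ^+ 2 by ring.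
  by rewrite !mulr2n e4 c2; ring.
have -> : abs (circle (t *+ 2) - 1) = 2 * sin t.
  apply/eqP; rewrite -(@eqrXn2 _ 2) ?abs_ge0 ?mulr_ge0 //; exact/eqP.
apply: (@le_trans _ _ (2 * t)); first by rewrite ler_pM2l.
by rewrite /t mulrA ler_wpM2r ?invr_ge0 ?(ltW pp) //; lra.
Qed.

Lemma e_p_additive_char : additive_char (e_p R (p := p)).
Proof.
split; [exact: e_pD | exact: abs_e_p |].
set S := \sum_x _.
have : e_p R (1 : 'F_p) * S = S.
  rewrite /S mulr_sumr [RHS](reindex_inj (addrI (1 : 'F_p))) /=.
  by apply: eq_bigr => x _; rewrite e_pD.
move/eqP; rewrite -subr_eq0 -[X in _ - X]mul1r -mulrBl mulf_eq0 => /orP[|/eqP//].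
rewrite -abs_eq0 => /eqP e.
have := @e_p_dist_ge 1 isT (prime_gt1 pr); rewrite [1%:R]/1 e => h.
have pp : 0 < p%:R :> R by rewrite lt_neqAle eq_sym p0 ler0n.
by move: h; rewrite leNgt mulr1 divr_gt0.
Qed.

End StandardCharacter.

Section CharExt.
Variables (R : realType) (p : nat).
Hypothesis pr : prime p.
Variable chi : {unit 'F_p} -> R[i].
Hypothesis chiP : mul_character chi.

Lemma char_ext_trivial x : trivial_char chi -> char_ext chi x = 1.
Proof. by rewrite /char_ext => ->. Qed.

Lemma char_ext_mult_char : ~~ trivial_char chi -> mult_char (char_ext chi).
Proof.
move=> nt; have [chi1 chiM] := chiP.
have E x : char_ext chi x = if insub x is Some u then chi u else 0.
  by rewrite /char_ext (negbTE nt).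
have E0 : char_ext chi 0 = 0.
  by rewrite E insubF // unitr0.
have Eu (u : {unit 'F_p}) : char_ext chi (val u) = chi u by rewrite E valK.
have un x : x != 0 -> {u : {unit 'F_p} | x = val u}.
  rewrite -unitfE => xu; exists (Sub x xu); by rewrite SubK.
have EM : {morph char_ext chi : x y / x * y}.
  move=> x y.
  have [->|x0] := eqVneq x 0; first by rewrite !mul0r E0 mul0r.
  have [->|y0] := eqVneq y 0; first by rewrite !mulr0 E0 mulr0.
  have [u ->] := un x x0; have [v ->] := un y y0.
  by rewrite !Eu -chiM -Eu.
have abs1u (u : {unit 'F_p}) : abs (chi u) = 1.
  have chiX n : chi (u ^+ n)%g = chi u ^+ n.
    by elim: n => [|n IH]; rewrite ?expg0 // expgS chiM IH exprS.
  have := congr1 (@abs R) (chiX #[u]%g).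
  rewrite expg_order chi1 abs1 absX => /esym/eqP.
  by rewrite pexpr_eq1 ?abs_ge0 ?order_gt0 // => /eqP.
split=> // [x x0|].
  by have [u ->] := un x x0; rewrite Eu.
have /forallPn[u hu] := nt.
set S := \sum_x _.
have u0 : val u != 0 by rewrite -unitfE; exact: valP.
have : chi u * S = S.
  rewrite /S mulr_sumr [RHS](reindex_inj (mulfI u0)) /=.
  by apply: eq_bigr => x _; rewrite EM Eu.
move/eqP; rewrite -subr_eq0 -[X in _ - X]mul1r -mulrBl mulf_eq0 => /orP[|/eqP//].
by rewrite subr_eq0 (negbTE hu).
Qed.

End CharExt.

(** * Sums of the Fourier transform over an interval *)

Lemma sum_int_points (R : realType) (a b : R) (l r : bool) (g : int -> R[i]) :
  a <= b -> exists (n1 : int) (H : nat), H%:R <= b - a + 1 /\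
  \sum_(n \in int_points (Interval (BSide l a) (BSide r b))) g n =
    \sum_(i < H) g (n1 + (i : nat)%:Z).
Proof.
move=> ab.
(* The first and last integers of the interval. *)
pose n1 : int := if l then Num.ceil a else Num.floor a + 1.
pose n2 : int := if r then Num.ceil b - 1 else Num.floor b.
have mem n : ((n%:~R : R) \in Interval (BSide l a) (BSide r b)) = (n1 <= n <= n2).
  rewrite itv_boundlr /n1 /n2; congr (_ && _).
    by case: l {n1}; rewrite /= ?ceil_le_int ?lezD1 ?floor_lt_int.
  by case: r {n2}; rewrite /= ?floor_ge_int // lerBrDr lezD1 ceil_gt_int.
pose H := absz (Num.max 0 (n2 - n1 + 1)).
have HE : H%:Z = Num.max 0 (n2 - n1 + 1) by rewrite gez0_abs // le_max lexx.
exists n1, H; split.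
  have n1a : a <= n1%:~R.
    rewrite /n1; case: l {n1 mem H HE}; first by rewrite -ceil_le_int.
    by apply: ltW; rewrite -floor_lt_int ltrDl.
  have n2b : n2%:~R <= b.
    rewrite /n2; case: r {n2 mem H HE}; last by rewrite -floor_ge_int.
    by apply: ltW; rewrite -ceil_gt_int gtrDl.
  have -> : H%:R = (H%:Z)%:~R :> R by rewrite pmulrn.
  rewrite HE; case: (leP 0 (n2 - n1 + 1)) => _; last by rewrite addr_ge0 ?subr_ge0.
  by rewrite intrD intrB lerD2r lerB.
rewrite [RHS](fsbig_ord _ H (fun i => g (n1 + i%:Z))); apply: (@reindex_fsbig _ _ _ nat int (fun i => n1 + i%:Z)).
split.
- move=> i /= iH; rewrite /int_points /= mem; lia.
- by move=> i j _ _ /= /addrI [].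
- move=> n; rewrite /int_points /= mem => nn.
  by exists (absz (n - n1)) => /=; lia.
Qed.

Section Twists.
Variables (R : realType) (p : nat).
Hypothesis pr : prime p.

Lemma phi_hat_sum (chi : {unit 'F_p} -> R[i]) (P : {poly 'F_p}) (n1 : int) (H : nat) :
  \sum_(i < H) phi_hat chi P (n1 + (i : nat)%:Z) =
  ((Num.sqrt (p%:R : R))^-1)%:C *
  \sum_(x : 'F_p) (char_ext chi x * e_p R P.[x]) * kernel_sum (e_p R (p := p)) H n1%:~R x.
Proof.
rewrite /phi_hat -mulr_sumr exchange_big /=; congr (_ * _); apply: eq_bigr => x _.
rewrite /kernel_sum mulr_sumr; apply: eq_bigr => i _.
by rewrite -mulrA -(e_pD R pr) intrD mulrDl.
Qed.

(** A linear twist does not affect the degree when it is at least 3. *)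
Lemma twisted_poly (P : {poly 'F_p}) (s n c : 'F_p) : s != 0 ->
  exists Q : {poly 'F_p}, [/\ (size Q <= (size P).+2)%N,
    ((4 <= size P)%N -> size Q = size P) &
    forall i, Q.[i] = P.[s * (c + i)] + n * (s * (c + i))].
Proof.
move=> s0; pose L : {poly 'F_p} := s *: 'X + (s * c)%:P.
have szL : size L = 2%N.
  rewrite size_polyDl size_scale ?size_polyX // size_polyC; by case: eqP.
have LE i : L.[i] = s * (c + i) by rewrite /L !hornerE; ring.
have szn : (size (n *: L) <= 2)%N by rewrite -szL size_scale_leq.
have szP : size (P \Po L) = size P by apply: size_comp_poly2.
exists (P \Po L + n *: L); split.
- rewrite (leq_trans (size_polyD _ _)) // szP geq_max (leq_trans szn) // andbT.
  by apply: leqW; apply: leqW.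
- move=> P4; rewrite size_polyDl szP //; apply: leq_ltn_trans szn _.
  exact: leq_trans P4.
- by move=> i; rewrite hornerD hornerZ horner_comp LE.
Qed.

Variable chi : {unit 'F_p} -> R[i].
Hypothesis chiP : mul_character chi.

Lemma abs_char_ext_le1 x : abs (char_ext chi x) <= 1.
Proof.
have [t|nt] := boolP (trivial_char chi).
  by rewrite (char_ext_trivial _ t) abs1.
exact: abs_chi_le1 (char_ext_mult_char chiP nt) x.
Qed.

End Twists.

(** Both signs are needed because completion splits the residues into [x] and
    [- x]. *)
Lemma mixed_short_sum (R : realType) d : exists m (K : R), 0 <= K /\
  forall (p : nat) (P : {poly 'F_p}) (chi : {unit 'F_p} -> R[i]) b s
    (sgn : bool) n y N,
    prime p -> (d < p)%N -> size P = d.+1 -> mul_character chi ->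
    ~~ trivial_char chi \/ (3 <= d)%N -> scale R m p b s -> (N <= s)%N ->
    abs (\sum_(i < N) (char_ext chi ((-1) ^+ sgn * (y + i)%N%:R) *
          e_p R P.[(-1) ^+ sgn * (y + i)%N%:R]) *
        e_p R (n * ((-1) ^+ sgn * (y + i)%N%:R : 'F_p)))
      <= K * s%:R / b%:R ^+ 8.
Proof.
have [m1 [K1 [K10 burgess]]] := burgess_short_sum R d.+3 8.
have [m2 [K2 [K20 weyl]]] : exists m (K : R), 0 <= K /\
  ((3 <= d)%N -> forall (p : nat) (psi : 'F_p -> R[i]) b s N (Q : {poly 'F_p}),
    prime p -> (d < p)%N -> additive_char psi ->
    (forall n : nat, (0 < n)%N -> (2 * n <= p)%N ->
      2 * n%:R / p%:R <= abs (psi n%:R - 1)) ->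
    scale R m p b s -> (N <= s)%N -> size Q = d.+1 ->
    abs (\sum_(i < N) psi Q.[(i : nat)%:R]) <= K * s%:R / b%:R ^+ 8).
  have [d3|d3] := leqP 3 d; last by exists 0%N, 0; split.
  by have [m [K [K0 W]]] := weyl_short_sum R 8 d3; exists m, K; split.
exists (m1 + m2)%N, (K1 + K2); split; first by rewrite addr_ge0.
move=> p P chi b s sgn n y N pr dp szP chiP nt sc Ns.
have s0 : (-1) ^+ sgn != 0 :> 'F_p by rewrite signr_eq0.
have [Q [szQ szQ' QE]] := twisted_poly P n y%:R s0.
have psiP := e_p_additive_char R pr.
have sb0 : 0 <= s%:R / b%:R ^+ 8 :> R by rewrite divr_ge0 ?exprn_ge0.
have Ks K : K * s%:R / b%:R ^+ 8 = K * (s%:R / b%:R ^+ 8) :> R by rewrite mulrA.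
have E (i : 'I_N) : char_ext chi ((-1) ^+ sgn * (y + i)%N%:R) *
    e_p R P.[(-1) ^+ sgn * (y + i)%N%:R] * e_p R (n * ((-1) ^+ sgn * (y + i)%N%:R)) =
    char_ext chi ((-1) ^+ sgn * (y + i)%N%:R) * e_p R Q.[(i : nat)%:R].
  by rewrite -mulrA -(e_pD R pr) QE -natrD.
rewrite (eq_bigr _ (fun i _ => E i)) {E}.
have [t|ntr] := boolP (trivial_char chi).
  have d3 : (3 <= d)%N by case: nt => //; rewrite t.
  under eq_bigr do rewrite (char_ext_trivial _ t) mul1r.
  apply: le_trans (weyl d3 p _ b s N Q pr dp psiP (@e_p_dist_ge R p pr) _ Ns _) _.
  - by apply: scale_weaken sc; rewrite leq_addl.
  - by rewrite szQ' szP.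
  by rewrite !Ks ler_wpM2r // lerDr.
have cP := char_ext_mult_char chiP ntr.
have E (i : 'I_N) : char_ext chi ((-1) ^+ sgn * (y + i)%N%:R) * e_p R Q.[(i : nat)%:R] =
    char_ext chi ((-1) ^+ sgn) * (char_ext chi (y%:R + (i : nat)%:R) * e_p R Q.[(i : nat)%:R]).
  by rewrite (chiM cP) natrD mulrA.
rewrite (eq_bigr _ (fun i _ => E i)) -mulr_sumr absM (abs_chi cP) // mul1r.
apply: le_trans (burgess p _ _ b s N y%:R Q pr cP psiP (e_p1_dist_le R pr) _ Ns _) _.
- by apply: scale_weaken sc; rewrite leq_addr.
- by rewrite szP in szQ.
by rewrite !Ks ler_wpM2r // lerDl.
Qed.

(** Take the largest [b] and [s]; [m ^ m <= p] makes [b >= m], so that the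
    harmonic sum, at most [b * m], is at most [b ^ 2]. *)
Lemma scale_exists (R : realType) m p : (0 < m)%N -> (m ^ m <= p)%N -> (1 < p)%N ->
  exists b s, scale R m p b s /\ (p < b.+1 ^ m)%N.
Proof.
move=> m0 mp p1.
have ex1 : exists i, (i ^ m <= p)%N by exists 1%N; rewrite exp1n ltnW.
have bd1 i : (i ^ m <= p)%N -> (i <= p)%N.
  move=> h; apply: leq_trans h; case: i => // i.
  by rewrite -{1}(expn1 i.+1) leq_pexp2l.
have ex2 : exists i, (2 * i ^ 2 <= p)%N by exists 1%N.
have bd2 i : (2 * i ^ 2 <= p)%N -> (i <= p)%N.
  move=> h; apply: leq_trans h; case: i => // i; rewrite -mulnn mulnA.
  by rewrite leq_pmull.
case: (ex_maxnP ex1 bd1) => b hb maxb.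
case: (ex_maxnP ex2 bd2) => s hs maxs.
have pb : (p < b.+1 ^ m)%N.
  by rewrite ltnNge; apply/negP => /maxb; rewrite ltnn.
have ps : (p < 2 * s.+1 ^ 2)%N.
  by rewrite ltnNge; apply/negP => /maxs; rewrite ltnn.
have s1 : (1 <= s)%N by apply: maxs.
exists b, s; split=> //; split=> //.
- by apply: maxb; rewrite exp1n ltnW.
- apply: le_trans (harmonic_sum_base R pb) _.
  by rewrite ler_nat -mulnn leq_mul2l maxb ?orbT.
- apply: ltnW; apply: leq_trans ps _.
  have : (s.+1 ^ 2 <= (2 * s) ^ 2)%N by rewrite leq_exp2r //; lia.
  rewrite expnMn; lia.
Qed.

(** The saving is [b >= p ^ (1 / m) / 2 = p ^ (2 dl) / 2]: one factor [p ^ dl]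
    pays for the exponent [1 - dl], the other for intervals that are shorter than
    [p ^ (1 / 2)] by a factor [p ^ dl]. *)
Lemma scale_to_power (R : realType) (m p b s H : nat) (l : R) :
  (0 < m)%N -> (0 < p)%N -> (0 < b)%N -> (p < b.+1 ^ m)%N -> (2 * s ^ 2 <= p)%N ->
  let dl : R := (2 * m%:R)^-1 in
  p%:R `^ (2^-1 - dl) <= l -> 1 <= l -> l <= p%:R -> H%:R <= l + 1 ->
  (s%:R + H%:R) / b%:R <= 6 * l `^ (1 - dl).
Proof.
move=> m0 pgt0 b0 pb s2 dl hl l1 lp Hl.
have mR : 0 < m%:R :> R by rewrite ltr0n.
have dl0 : 0 < dl by rewrite /dl invr_gt0 mulr_gt0.
have dlm : dl * 2 = m%:R^-1 by rewrite /dl invfM mulrAC mulVf ?mul1r ?pnatr_eq0.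
have dl2 : dl <= 2^-1.
  by rewrite /dl lef_pV2 ?posrE ?mulr_gt0 // ler_peMr // ler1n.
pose P : R := p%:R; have P1 : 1 <= P by rewrite ler1n.
have P0 : 0 < P by lra.
have bR : 0 < b%:R :> R by rewrite ltr0n.
have pm : P `^ (dl * 2) <= 2 * b%:R.
  have h : P <= (2 * b%:R) ^+ m.
    rewrite -natrM -natrX ler_nat; apply: leq_trans (ltnW pb) _.
    by rewrite leq_exp2r //; lia.
  have := @ge0_ler_powR R (dl * 2) _ P ((2 * b%:R) ^+ m).
  rewrite !nnegrE => /(_ _ (ltW P0) _ h) h'.
  apply: le_trans (h' _ _) _; rewrite ?exprn_ge0 ?mulr_ge0 ?(ltW bR) ?(ltW dl0) //.
  rewrite -powR_mulrn ?mulr_ge0 ?(ltW bR) // -powRrM dlm mulfV ?pnatr_eq0 -?lt0n //.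
  by rewrite powRr1 // mulr_ge0 // ltW.
have ib : b%:R^-1 <= 2 * P `^ (- (dl * 2)).
  rewrite powRN ler_pdivlMr ?powR_gt0 // mulrC ler_pdivrMr //.
have ss : s%:R <= P `^ 2^-1.
  rewrite powR12_sqrt ?(ltW P0) // -[leLHS](ger0_norm (ler0n _ _)) -sqrtr_sqr.
  rewrite ler_sqrt ?(ltW P0) // -natrX ler_nat; apply: leq_trans s2.
  by rewrite leq_pmull.
have Pne (r : R) : (r == 0) ==> (P != 0) by rewrite (lt0r_neq0 P0) implybT.
have sb : s%:R / b%:R <= 2 * l `^ (1 - dl).
  apply: (@le_trans _ _ (P `^ 2^-1 * (2 * P `^ (- (dl * 2))))).
    by apply: ler_pM; rewrite ?invr_ge0.
  have -> : P `^ 2^-1 * (2 * P `^ (- (dl * 2))) = 2 * P `^ (2^-1 - dl * 2).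
    by rewrite mulrCA powRD.
  rewrite ler_wpM2l //.
  apply: (@le_trans _ _ ((P `^ (2^-1 - dl)) `^ (1 - dl))).
    by rewrite -powRrM; apply: ler_powR => //; nra.
  by apply: ge0_ler_powR; rewrite ?nnegrE ?powR_ge0 //; lra.
have Hb : H%:R / b%:R <= 4 * l `^ (1 - dl).
  apply: (@le_trans _ _ ((2 * l) * (2 * P `^ (- (dl * 2))))).
    apply: ler_pM; rewrite ?invr_ge0 //; lra.
  have -> : 2 * l * (2 * P `^ (- (dl * 2))) = 4 * (l * P `^ (- (dl * 2))) by ring.
  rewrite ler_pM2l // powRD; last by rewrite gt_eqF //; lra.
  rewrite powRr1; last by lra.
  rewrite ler_wpM2l //; first by lra.
  rewrite !powRN lef_pV2 ?posrE ?powR_gt0 //; last by lra.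
  apply: (@le_trans _ _ (P `^ dl)).
    by apply: ge0_ler_powR; rewrite ?nnegrE //; lra.
  by apply: ler_powR => //; lra.
by rewrite mulrDl; lra.
Qed.

Theorem corollary1p5 (R : realType) (d : nat) :
  exists2 delta : R, 0 < delta &
  exists C : R,
  forall (p : nat) (P : {poly 'F_p}) (chi : {unit 'F_p} -> R[i]),
    prime p -> P != 0 -> (size P).-1 = d -> mul_character chi ->
    ~~ trivial_char chi \/ (3 <= d)%N ->
  forall (a b : R) (l r : bool),
    p%:R `^ (2^-1 - delta) <= b - a -> b - a <= p%:R ->
    `| \sum_(n \in int_points (Interval (BSide l a) (BSide r b)))
         phi_hat chi P n |
      <= (C * (b - a) `^ (1 - delta))%:C.
Proof.
have [m' [K [K0 short]]] := mixed_short_sum R d.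
pose m := (m' + 13)%N; have m0 : (0 < m)%N by rewrite /m addnS.
pose delta : R := (2 * m%:R)^-1.
have mR : 0 < m%:R :> R by rewrite ltr0n.
have d0 : 0 < delta by rewrite invr_gt0 mulr_gt0.
have d2 : delta <= 2^-1.
  by rewrite lef_pV2 ?posrE ?mulr_gt0 // ler_peMr // ler1n.
(* Smaller primes are covered by the constant; larger ones exceed [d], are odd
   and leave room for the scale. *)
pose p0 := (m ^ m + d + 3)%N.
exists delta => //.
pose K' := 20 + 320 * K; have K'0 : 0 <= K' by rewrite /K'; lra.
exists (6 * K' + 2 * p0%:R ^+ 2) => p P chi pr Pn0 degP chiP nt a b l r lo hi.
pose len := b - a.
have pp : 0 < p%:R :> R by rewrite ltr0n prime_gt0.
have p1 : 1 <= p%:R :> R by rewrite ler1n prime_gt0.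
have len1 : 1 <= len.
  apply: le_trans lo; rewrite -[leLHS](powRr0 p%:R); apply: ler_powR => //; lra.
have ab : a <= b by rewrite -subr_ge0; apply: le_trans len1.
have szP : size P = d.+1 by rewrite -degP prednK // lt0n size_poly_eq0.
rewrite absE lecR.
have [n1 [H [Hlen ->]]] := sum_int_points l r (phi_hat chi P) ab.
rewrite phi_hat_sum //; set phi := fun x => char_ext chi x * e_p R P.[x].
have sq1 : 1 <= Num.sqrt p%:R :> R by rewrite -[leLHS]sqrtr1 ler_sqrt.
have sq0 : 0 < Num.sqrt p%:R :> R by lra.
have iq1 : (Num.sqrt p%:R : R)^-1 <= 1 by rewrite invf_le1.
rewrite absM abs_real ?invr_ge0 ?(ltW sq0) //.
have phi1 x : abs (phi x) <= 1.
  apply: abs_le1M; first exact: abs_char_ext_le1.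
  by rewrite (abs_e_p R pr).
have psiP := e_p_additive_char R pr.
have C1 : 0 <= K' * (len `^ (1 - delta)) by rewrite mulr_ge0 ?powR_ge0.
have C2 : 0 <= p0%:R ^+ 2 * (len `^ (1 - delta)) by rewrite mulr_ge0 ?powR_ge0 ?sqr_ge0.
have [small|large] := ltnP p p0.
  set S := abs _.
  have SH : S <= p%:R * H%:R.
    apply: le_trans (abs_sum _ _ _) _.
    apply: (@le_trans _ _ (\sum_(x : 'F_p) (H%:R : R))).
      apply: ler_sum => x _; rewrite absM -[leRHS]mul1r.
      apply: ler_pM; rewrite ?abs_ge0 //; first exact: phi1.
      exact: kernel_sum_le.
    by rewrite sumr_const card_Fp // -[_ *+ p]mulr_natl.
  apply: (@le_trans _ _ (p%:R * H%:R)).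
    by apply: le_trans SH; rewrite ler_piMl ?abs_ge0.
  have pp0 : p%:R <= p0%:R :> R by rewrite ler_nat ltnW.
  have le2 : H%:R <= 2 * len by rewrite -/len in Hlen; lra.
  have lenE : len = len `^ (1 - delta) * len `^ delta.
    rewrite -powRD ?subrK ?powRr1 //; first by lra.
    by rewrite (gt_eqF (_ : 0 < len)) ?implybT //; lra.
  have lend : len `^ delta <= p0%:R.
    apply: (@le_trans _ _ len); last by apply: le_trans pp0.
    by rewrite -[leRHS]powRr1; [apply: ler_powR => //|]; lra.
  apply: (@le_trans _ _ (p0%:R * (2 * len))); first by apply: ler_pM.
  rewrite {1}lenE.
  have := ler_wpM2l (powR_ge0 len (1 - delta)) lend => h.
  have h2 := ler_wpM2l (ler0n R p0) h; rewrite -/len.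
  have -> : (6 * K' + 2 * p0%:R ^+ 2) * len `^ (1 - delta) =
    6 * (K' * len `^ (1 - delta)) + 2 * (p0%:R * (len `^ (1 - delta) * p0%:R)) by ring.
  by lra.
have pm : (m ^ m <= p)%N by apply: leq_trans large; rewrite /p0 -addnA leq_addr.
have dp : (d < p)%N.
  apply: leq_trans large; rewrite /p0 addnS ltnS.
  exact: leq_trans (leq_addl _ d) (leq_addr 2 _).
have p3 : (3 <= p)%N by apply: leq_trans large; rewrite leq_addl.
have po : odd p by case/even_prime: pr p3 => [->|].
have [bb [s [sc pb]]] := @scale_exists R m p m0 pm (prime_gt1 pr).
have [b0 _ _ s2 _] := sc.
have cb := @completion_bound R p (e_p R (p := p)) phi bb s H n1%:~R K pr po psiP
  (e_p1_dist_le R pr) (@e_p_dist_ge R p pr) phi1.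
have {}cb := cb (scale_weaken (leq_addl _ _) sc) K0.
have {}cb := cb (fun sgn n y N Ns => short p P chi bb s sgn n y N pr dp szP chiP nt
  (scale_weaken (leq_addr _ _) sc) Ns).
have fin := scale_to_power m0 (prime_gt0 pr) b0 pb s2 lo len1 hi Hlen.
have ssq : s%:R <= Num.sqrt p%:R :> R.
  rewrite -[leLHS](ger0_norm (ler0n _ _)) -sqrtr_sqr ler_sqrt ?(ltW pp) //.
  rewrite -natrX ler_nat; apply: leq_trans s2; by rewrite leq_pmull.
set S := abs _ in cb *; rewrite -/K' in cb.
rewrite mulrC ler_pdivrMr //.
apply: le_trans cb _.
have -> : K' * s%:R * (s%:R + H%:R) / bb%:R = (K' * ((s%:R + H%:R) / bb%:R)) * s%:R by ring.
apply: ler_pM => //.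
  by rewrite mulr_ge0 // divr_ge0 // addr_ge0.
apply: (@le_trans _ _ (K' * (6 * len `^ (1 - delta)))); first by rewrite ler_wpM2l.
rewrite -/len.
have -> : (6 * K' + 2 * p0%:R ^+ 2) * len `^ (1 - delta) =
  K' * (6 * len `^ (1 - delta)) + 2 * (p0%:R ^+ 2 * len `^ (1 - delta)) by ring.
by rewrite lerDl mulr_ge0.
Qed.
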